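(* Let $\theta^*=(Q^*,f^* )$ and suppose the probability measures $f_1^*\lambda,\dots,f_k^*\lambda$ are linearly independent and $Q^*$ has full rank. Let $\underline q>0$, assume $\mu_i\ge\underline q$ for all $i$, that the support of the prior $\pi$ is included in $\Theta(\underline q)$, and that (A1) and (A2) hold (for some integer $l\ge3$). Then for every neighborhood $U_{Q^*}$ of $Q^*$ (for the norm $\|\cdot\|$) and every family of neighborhoods $U_{f_i^*}$ of $f_i^*\lambda$ in the weak topology on probability measures on $\mathbb R^d$, $1\le i\le k$, $$\mathbb P^{\theta^*}\Big(\lim_{n\to\infty}\pi\big(\{(Q,f):\exists\sigma\in\mathcal S_k,\ \sigma Q\in U_{Q^*},\ f_{\sigma(i)}\lambda\in U_{f_i^*}\ \forall\, 1\le i\le k\}\ \big|\ Y_{1:n}\big)=1\Big)=1,$$ where $\mathcal S_k$ is the symmetric group on $\{1,\dots,k\}$ and $(\sigma Q)_{i,j}=Q_{\sigma(i),\sigma(j)}$.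
   Context: Fix integers $k\ge1$, $d\ge1$. $\lambda$ is a $\sigma$-finite reference measure on $\mathbb R^d$ (Borel $\sigma$-field) and $\mathcal F$ is the set of probability densities with respect to $\lambda$. $\Delta_k=\{x\in[0,\infty)^k:\sum_i x_i=1\}$; a transition matrix is an element $Q\in\Delta_k^k$ (each row lies in $\Delta_k$). For $\underline q\ge0$, $\Delta^k(\underline q)=\{Q\in\Delta_k^k:\min_{i,j}Q_{i,j}\ge\underline q\}$, $\Theta=\Delta_k^k\times\mathcal F^k$ and $\Theta(\underline q)=\Delta^k(\underline q)\times\mathcal F^k$. For $\underline q>0$ and $Q\in\Delta^k(\underline q)$, $\mu^Q$ denotes the unique stationary distribution of $Q$. For $\theta=(Q,f)$, $f=(f_1,\dots,f_k)\in\mathcal F^k$, and an initial distribution $\nu\in\Delta_k$, $\mathbb P^{\theta,\nu}$ is the law of the hidden Markov model $(X_t,Y_t)_{t\ge1}$: $(X_t)$ is a Markov chain on $\{1,\dots,k\}$ with initial law $\nu$ and transition matrix $Q$, and conditionally on $(X_t)_t$ the variables $Y_t\in\mathbb R^d$ are independent, $Y_t$ having density $f_{X_t}$ with respect to $\lambda$. $\mathbb P^\theta:=\mathbb P^{\theta,\mu^Q}$. The density of $Y_{1:l}$ with respect to $\lambda^{\otimes l}$ is $p_l^{\theta,\nu}(y_{1:l})=\sum_{x_1,\dots,x_l=1}^k\nu_{x_1}Q_{x_1,x_2}\cdots Q_{x_{l-1},x_l}f_{x_1}(y_1)\cdots f_{x_l}(y_l)$; $p_l^\theta:=p_l^{\theta,\mu^Q}$.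 The prior is $\pi=\pi_Q\otimes\pi_f$ on $\Theta$ together with a fixed initial distribution $\mu\in\Delta_k$; the posterior is $\pi(A\mid Y_{1:n})=\int_A p_n^{\theta,\mu}(Y_{1:n})\pi(d\theta)\big/\int_\Theta p_n^{\theta,\mu}(Y_{1:n})\pi(d\theta)$. The observations are distributed according to $\mathbb P^{\theta^*}$. Notation: $\|M\|=\max_{i,j}|M_{i,j}|$; $d(g,\tilde g)=\max_j\|g_j-\tilde g_j\|_{L_1(\lambda)}$; $N(\delta,A,D)$ is the minimal number of $D$-balls of radius $\delta$ centered at points needed to cover $A$. Assumption (A1) (for given $\underline q>0$): there is $\epsilon_0>0$ such that for every $\epsilon\in(0,\epsilon_0)$ there is a set $\Theta_\epsilon\subset\Theta(\underline q)$ with $\pi(\Theta_\epsilon)>0$ such that every $\theta=(Q,f)\in\Theta_\epsilon$ satisfies: (A1a) $\|Q-Q^*\|<\epsilon$; (A1b) $\max_{1\le i\le k}\int f_i^*(y)\max_{1\le j\le k}\log\big(f_j^*(y)/f_j(y)\big)\lambda(dy)<\epsilon$; (A1c) for all $y$ with $\sum_i f_i^*(y)>0$, $\sum_j f_j(y)>0$; (A1d) $\sup_{y:\sum_i f_i^*(y)>0}\max_j f_j(y)<\infty$; (A1e) $\sum_{i=1}^k\int f_i^*(y)\,\big|\log\big(\sum_{j=1}^k f_j(y)\big)\big|\lambda(dy)<\infty$. Assumption (A2) (for given $\underline q>0$ and $l$): for every $\delta>0$ there exist sets $\mathcal F_n\subset\mathcal F^k$ ($n\ge1$) and constants $r_1>0$,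 $C>0$ such that $\pi_f(\mathcal F^k\setminus\mathcal F_n)\le Ce^{-nr_1}$ for all $n$ and $\sum_{n\ge1}N\big(\tfrac{\delta}{36l},\mathcal F_n,d\big)\exp\big(-\tfrac{n\delta^2k^2\underline q^2}{32l}\big)<\infty$. *)

(* Defs.v *)
From HB Require Import structures.
From mathcomp Require Import all_boot all_order all_algebra.
From mathcomp Require Import all_classical all_reals all_analysis.
From mathcomp Require Import measurable_realfun.

Set Implicit Arguments.
Unset Strict Implicit.
Unset Printing Implicit Defensive.

Import Order.TTheory GRing.Theory Num.Theory.
Import numFieldNormedType.Exports.

Local Open Scope classical_set_scope.
Local Open Scope ring_scope.

Definition Rd (R : realType) (d : nat) :=
  g_sigma_algebraType (open : set_system 'rV[R]_d).

(* The measure  f.lam : A |-> \int_A f dlam  (for f measurable, >= 0).       *)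
(* For other f it is (arbitrarily) set to the zero measure, so that it is a *)
(* measure in all cases; it is only ever applied to densities.              *)
Section density_measure.
Context (R : realType) (dd : measure_display) (T : measurableType dd).
Variables (lam : {measure set T -> \bar R}) (f : T -> R).

Definition dmeasure_fun (A : set T) : \bar R :=
  if `[< measurable_fun setT f /\ (forall y, 0 <= f y) >]
  then (\int[lam]_(y in A) (f y)%:E)%E else 0%E.

Let dm0 : dmeasure_fun set0 = 0%E.
Proof. by rewrite /dmeasure_fun; case: ifPn => // _; rewrite integral_set0. Qed.

Let dm_ge0 A : (0 <= dmeasure_fun A)%E.
Proof.
rewrite /dmeasure_fun; case: ifPn => // /asboolP[_ f0].
by apply: integral_ge0 => y _; rewrite lee_fin.
Qed.

Let dm_sigma_additive : semi_sigma_additive dmeasure_fun.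
Proof.
move=> F mF tF mUF; rewrite /dmeasure_fun; case: ifPn => [/asboolP[mf f0]|_].
  rewrite ge0_integral_bigcup//.
  - apply: is_cvg_ereal_nneg_natsum_cond => n _ _.
    by apply: integral_ge0 => y _; rewrite lee_fin.
  - apply/measurable_EFinP.
    exact: (measurable_funS _ (@subsetT _ _) mf).
  - by move=> y _; rewrite lee_fin.
have -> : (fun n => \sum_(0 <= i < n) (0 : \bar R)) = fun=> 0%E.
  by apply/funext => n; rewrite big1.
exact: cvg_cst.
Qed.

HB.instance Definition _ := isMeasure.Build _ _ _
  dmeasure_fun dm0 dm_ge0 dm_sigma_additive.

Definition dmeasure : {measure set T -> \bar R} := dmeasure_fun.

End density_measure.

Section model.
Context (R : realType) (dd : measure_display) (T : measurableType dd).

Definition is_density (lam : {measure set T -> \bar R}) (f : T -> R) :=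
  [/\ measurable_fun setT f, (forall y, 0 <= f y) &
      (\int[lam]_y (f y)%:E = 1)%E].

Definition is_distribution (k : nat) (m : 'I_k -> R) :=
  (forall i, 0 <= m i) /\ \sum_i m i = 1.

Definition is_transition (k : nat) (Q : 'M[R]_k) :=
  forall i, is_distribution (fun j => Q i j).

Definition Delta_q (k : nat) (q : R) (Q : 'M[R]_k) :=
  is_transition Q /\ forall i j, q <= Q i j.

Definition is_stationary (k : nat) (Q : 'M[R]_k) (m : 'I_k -> R) :=
  is_distribution m /\ forall j, \sum_i m i * Q i j = m j.

Definition Theta_q (k : nat) (lam : {measure set T -> \bar R}) (q : R)
    (th : 'M[R]_k * ('I_k -> T -> R)) :=
  Delta_q q th.1 /\ forall i, is_density lam (th.2 i).

(* p_{n+1}^{theta,m}(y_1, ..., y_{n+1}); the observation y_{t+1} is  y t *)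
Definition likS (k : nat) (Q : 'M[R]_k) (f : 'I_k -> T -> R) (m : 'I_k -> R)
    (n : nat) (y : nat -> T) : R :=
  \sum_(x : {ffun 'I_n.+1 -> 'I_k})
     (m (x ord0) * \prod_(t < n) Q (x (inord t)) (x (inord t.+1))
                 * \prod_(t < n.+1) f (x t) (y t)).

Definition lik (k : nat) (Q : 'M[R]_k) (f : 'I_k -> T -> R) (m : 'I_k -> R)
    (n : nat) (y : nat -> T) : R :=
  if n is n'.+1 then likS Q f m n' y else 1.

Definition eln (x : R) : \bar R := if x == 0 then -oo%E else (ln x)%:E.

Definition elogratio (a b : R) : \bar R :=
  if a == 0 then -oo%E else if b == 0 then +oo%E else (ln (a / b))%:E.

Definition dL1 (k : nat) (lam : {measure set T -> \bar R})
    (g g' : 'I_k -> T -> R) : \bar R :=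
  (\big[maxe/0]_(j < k) \int[lam]_y (`|g j y - g' j y|)%:E)%E.

Definition covering_number (k : nat) (lam : {measure set T -> \bar R})
    (delta : R) (A : set ('I_k -> T -> R)) : \bar R :=
  ereal_inf [set (m%:R)%:E | m in
    [set m : nat | exists c : 'I_m -> ('I_k -> T -> R),
        (forall j, A (c j)) /\
        (forall g, A g -> exists j, (dL1 lam (c j) g < delta%:E)%E)]].

End model.

Definition weak_nbhd (R : realType) (d : nat)
    (nu0 : {measure set (Rd R d) -> \bar R})
    (U : set {measure set (Rd R d) -> \bar R}) : Prop :=
  exists (m : nat) (g : 'I_m -> 'rV[R]_d -> R) (e : R), 0 < e /\
    (forall j, continuous (g j) /\ exists M : R, forall y, `|g j y| <= M) /\
    forall nu : {measure set (Rd R d) -> \bar R}, nu setT = 1%E ->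
      (forall j, `| \int[nu]_y (g j y)%:E - \int[nu0]_y (g j y)%:E | < e%:E)%E ->
      U nu.

Definition norm_nbhd (R : realType) (k : nat) (Qs : 'M[R]_k)
    (U : set 'M[R]_k) : Prop :=
  exists e : R, 0 < e /\ forall Q, mx_norm (Q - Qs) < e -> U Q.

(* Posterior probability of a set A of prior indices, given y_1..y_n:        *)
(*   pi(A | y_{1:n}) = \int_A p_n^{theta,m}(y) dpi / \int p_n^{theta,m}(y) dpi *)
(* where the prior is the image of pi under theta.  (For a non-measurable  *)
(* A the numerator is MathComp's lower integral, i.e. an inner measure.)    *)
Definition posterior (R : realType) (dd : measure_display) (T : measurableType dd)
    (dp : measure_display) (Tp : measurableType dp) (k : nat)
    (pi : {measure set Tp -> \bar R}) (theta : Tp -> 'M[R]_k * ('I_k -> T -> R))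
    (m : 'I_k -> R) (n : nat) (y : nat -> T) (A : set Tp) : \bar R :=
  ((\int[pi]_(t in A) (lik (theta t).1 (theta t).2 m n y)%:E)
   / (\int[pi]_t (lik (theta t).1 (theta t).2 m n y)%:E))%E.

(* Main.v *)
(* The posterior mass of a set is compared with the likelihood of the true
   parameter.

   Lower bound.  On the sets given by (A1), the ratio of the likelihoods of
   theta and theta* is bounded below path by path: the transition terms cost a
   factor (1 + e / q)^n and the emission terms the exponential of the sum over
   time of max_j (log (f*_j / f_j))^+, whose mean is small by (A1b).  That sum
   is controlled by truncation at dyadic levels and Chebyshev's inequality
   conditionally on the hidden path.  Hence the evidence exceeds b^n times the
   true likelihood eventually, for every b < 1.

   Upper bound.  For [0, 1]-valued test functions, the means of products of
   three consecutive observations determine (Q, f) up to relabelling, because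
   Q* is invertible and the emission laws are independent: the triple moments
   give a simultaneous diagonalisation of matrices similar to the diagonal
   matrices of emission means.  Compactness turns this into a uniform gap
   outside a neighbourhood of theta*.  Entries of Q bounded below by q > 0 make
   the chain forget its past within p steps, uniformly, so products over blocks
   of length p + 3 of factors 1 + tau (product of three observables - c) have
   exponentially small expectation under the parameters on one side of the gap
   while staying exponentially larger along the observations.  These tests make
   the posterior mass of each of finitely many sets covering the complement of
   the neighbourhood tend to 0. *)

Require Import Defs.
From HB Require Import structures.
From mathcomp Require Import all_boot all_order all_algebra.
From mathcomp Require Import perm.
From mathcomp Require Import all_classical all_reals all_analysis.
From mathcomp Require Import measurable_realfun.
From mathcomp Require Import lra ring.

Set Implicit Arguments.
Unset Strict Implicit.
Unset Printing Implicit Defensive.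

Import Order.TTheory GRing.Theory Num.Theory.
Import numFieldNormedType.Exports.

Local Open Scope classical_set_scope.
Local Open Scope ring_scope.

(** * Identifiability of the triple moments *)

(** In the moments of three consecutive observations the outer two supply fixed full-rank factors
    and the middle one a diagonal factor that varies; with two observations nothing would be left to
    diagonalise. Linear independence of the emission laws and the weak neighbourhoods both reduce to
    finitely many [0, 1]-valued observables, so compactness is that of a finite-dimensional cube.

    The tests come in pairs of opposite sign, [tau] and [- tau]. Path by path their product is
    bounded below by a quantity that differs from 1 at second order in [tau], whereas the gap acts
    at first order: the test that is small in mean under the true parameter forces the other one to
    be at least 1 along the observations. The upper bound thus rests on expectations of products
    over blocks and on no ergodic theorem. Posterior masses enter divided by the true likelihood,
    which makes their means computable by Tonelli's theorem.

    In the lower bound the exceptional null set depends on the parameter; Tonelli's theorem on the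
    product of prior and sample space provides one null set for almost all parameters. *)

Section identifiability.
Context (R : fieldType) (k : nat).
Implicit Types (Q : 'M[R]_k) (v w m : 'I_k -> R).

Definition mxapp Q v : 'I_k -> R := fun i => \sum_j Q i j * v j.

(** With [u], [v], [w] the emission means of three observables, this is the conditional mean of
    their product over three consecutive times, given the hidden state at the first. *)
Definition window Q (u v w : 'I_k -> R) : 'I_k -> R :=
  fun x => u x * mxapp Q (fun y => v y * mxapp Q w y) x.

Definition triple_moment Q m (u v w : 'I_k -> R) : R :=
  \sum_x m x * window Q u v w x.

(** Only the diagonal factor depends on the middle observable; the two outer factors are common to
    all of them. *)
Lemma window_mx (I : finType) Q m (O : I -> 'I_k -> R) a b c :
  let Om : 'M[R]_(#|I|, k) := \matrix_(b, i) O (enum_val b) i in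
  (Om *m diag_mx (\row_i m i) *m Q *m diag_mx (row b Om) *m (Q *m Om^T)) a c
  = triple_moment Q m (O (enum_val a)) (O (enum_val b)) (O (enum_val c)).
Proof.
move=> Om; rewrite /triple_moment /window /mxapp.
rewrite mxE.
transitivity (\sum_x \sum_y Om a x * m x * Q x y * Om b y * (\sum_z Q y z * Om c z)).
  rewrite exchange_big /=; apply: eq_bigr => y _.
  rewrite -mulr_suml; congr (_ * _); last first.
    by rewrite mxE; apply: eq_bigr => z _; rewrite !mxE.
  rewrite mul_mx_diag mxE mxE mulr_suml; apply: eq_bigr => x _.
  by rewrite mul_mx_diag !mxE.
apply: eq_bigr => x _; rewrite mulr_sumr mulr_sumr; apply: eq_bigr => y _.
under eq_bigr do rewrite mxE.
rewrite !mxE; ring.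
Qed.

(* With [A], [B] one-sided inverses built from the true parameter, the matrix
   [U := A L] intertwines all the diagonal matrices [diag (O b)] and
   [diag (Os b)], hence is a permutation matrix up to scaling. *)
Lemma triple_moment_identifiable (I : finType) (b0 : I) (Q Qs : 'M[R]_k) (m ms : 'I_k -> R)
    (O Os : I -> 'I_k -> R) :
  (forall i, \sum_j Q i j = 1) -> (forall i, \sum_j Qs i j = 1) ->
  Qs \in unitmx -> (forall i, ms i != 0) ->
  (forall i, O b0 i = 1) -> (forall i, Os b0 i = 1) ->
  (forall a : 'I_k -> R, (forall b, \sum_i a i * Os b i = 0) ->
     forall i, a i = 0) ->
  (forall a b c, triple_moment Q m (O a) (O b) (O c) =
                 triple_moment Qs ms (Os a) (Os b) (Os c)) ->
  exists s : 'S_k, (forall i j, Q (s i) (s j) = Qs i j) /\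
                   (forall b i, O b (s i) = Os b i).
Proof.
move=> Q1 Qs1 uQs ms0 O1 Os1 indep TT.
pose Om : 'M[R]_(#|I|, k) := \matrix_(b, i) O (enum_val b) i.
pose Osm : 'M[R]_(#|I|, k) := \matrix_(b, i) Os (enum_val b) i.
pose L := Om *m diag_mx (\row_i m i) *m Q.
pose Ls := Osm *m diag_mx (\row_i ms i) *m Qs.
have TM b : L *m diag_mx (row b Om) *m (Q *m Om^T) =
            Ls *m diag_mx (row b Osm) *m (Qs *m Osm^T).
  by apply/matrixP => a c; rewrite !window_mx.
(* The constant observable [b0] in the middle turns the diagonal factor into the identity. *)
have T0 : L *m (Q *m Om^T) = Ls *m (Qs *m Osm^T).
  have d1 (P : I -> 'I_k -> R) : (forall i, P b0 i = 1) ->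
      diag_mx (row (enum_rank b0) (\matrix_(b, i) P (enum_val b) i)) = 1%:M.
    move=> P1; rewrite -diag_const_mx; congr diag_mx.
    by apply/rowP => i; rewrite !mxE enum_rankK P1.
  have := TM (enum_rank b0).
  by rewrite /Om /Osm !d1 // !mulmx1.
have rfree : row_free Osm^T.
  rewrite -kermx_eq0; apply/eqP/row_matrixP => i; rewrite row0.
  apply/rowP => j; rewrite [RHS]mxE.
  apply: (indep (fun j => (row i (kermx Osm^T)) 0 j)) => b.
  have /rowP/(_ (enum_rank b)) : row i (kermx Osm^T) *m Osm^T = 0.
    by rewrite -row_mul mulmx_ker row0.
  rewrite !mxE => h; rewrite -[RHS]h; apply: eq_bigr => x _.
  by rewrite !mxE enum_rankK.
have [B OB] := row_freeP rfree.
have OBt : B^T *m Osm = 1%:M.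
  by rewrite -[LHS]trmxK trmx_mul trmxK OB trmx1.
have uD : diag_mx (\row_i ms i) *m Qs \in unitmx.
  rewrite unitmx_mul uQs andbT unitmxE det_diag unitfE.
  by apply/prodf_neq0 => i _; rewrite mxE.
(* [E] is a left inverse of [Ls] and [F] a right inverse of [Qs *m Osm^T]. Since both parameters
   give the same products, [U] and [W] below are inverse to each other. *)
pose E := invmx (diag_mx (\row_i ms i) *m Qs) *m B^T.
have EL : E *m Ls = 1%:M.
  by rewrite /E /Ls -mulmxA -(mulmxA Osm) (mulmxA B^T) OBt mul1mx mulVmx.
pose F := B *m invmx Qs.
have RF : (Qs *m Osm^T) *m F = 1%:M.
  by rewrite /F -mulmxA (mulmxA Osm^T) OB mul1mx mulmxV.
clearbody L Ls E F.
pose U := E *m L; pose W := (Q *m Om^T) *m F.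
have UW : U *m W = 1%:M.
  have := congr1 (fun M => E *m M *m F) T0.
  rewrite /U /W !mulmxA EL mul1mx => ->.
  exact: RF.
have WU : W *m U = 1%:M by apply: mulmx1C.
have UDW b : U *m diag_mx (row b Om) = diag_mx (row b Osm) *m U.
  have e : U *m diag_mx (row b Om) *m W = diag_mx (row b Osm).
    have := congr1 (fun M => E *m M *m F) (TM b).
    rewrite !mulmxA EL mul1mx => h; rewrite /U /W ?mulmxA h.
    by rewrite -(mulmxA _ Qs) -(mulmxA _ (Qs *m _)) RF mulmx1.
  by rewrite -e -(mulmxA _ W U) WU mulmx1.
have UQ : U *m (Q *m Om^T) = Qs *m Osm^T.
  by rewrite /U -mulmxA T0 (mulmxA E Ls) EL mul1mx.
clearbody U W.
(* A nonzero entry (i, j) of the intertwining matrix matches state j with the true state i. *)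
have key i j b : U i j != 0 -> O b j = Os b i.
  move=> nz; have /matrixP/(_ i j) := UDW (enum_rank b).
  rewrite mul_mx_diag mul_diag_mx !mxE enum_rankK mulrC => e.
  exact: (mulIf nz e).
have Osinj i i' : (forall b, Os b i = Os b i') -> i = i'.
  move=> e; apply/eqP/negPn/negP => ne.
  suff : (i == i)%:R - (i == i')%:R = 0 :> R.
    by rewrite eqxx (negbTE ne) subr0 => /eqP; rewrite oner_eq0.
  apply: (indep (fun j => (j == i)%:R - (j == i')%:R)) => b.
  under eq_bigr do rewrite mulrBl.
  rewrite sumrB (bigD1 i) //= eqxx mul1r big1 ?addr0; last first.
    by move=> j /negbTE ->; rewrite mul0r.
  rewrite (bigD1 i') //= eqxx mul1r big1 ?addr0; last first.
    by move=> j /negbTE ->; rewrite mul0r.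
  by rewrite e subrr.
have rownz i : exists j, U i j != 0.
  case: (pickP (fun j => U i j != 0)) => [j hj|h]; first by exists j.
  have /matrixP/(_ i i) := UW; rewrite !mxE eqxx big1 => [/eqP|j _].
    by rewrite eq_sym oner_eq0.
  by have /negbFE/eqP -> := h j; rewrite mul0r.
pose s0 i := xchoose (rownz i).
have s0P i : U i (s0 i) != 0 by apply: xchooseP (rownz i).
have s0inj : injective s0.
  move=> i i' e; apply: Osinj => b.
  by rewrite -(key _ _ b (s0P i)) -(key _ _ b (s0P i')) e.
pose s := perm s0inj.
have sP i : s i = s0 i by rewrite permE.
have OS b i : O b (s i) = Os b i by rewrite sP; apply: key.
have U0 i j : j != s i -> U i j = 0.
  move=> ne; apply/eqP/negPn/negP => nz.
  have [j' ej] : exists j', s j' = j by exists (s^-1 j)%g; rewrite permKV.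
  have : i = j' by apply: Osinj => b; rewrite -(OS b j') ej; apply/esym/key.
  by move=> e; move: ne; rewrite -ej e eqxx.
have UQb i b : U i (s i) * (\sum_x Q (s i) x * O b x) = \sum_x Qs i x * Os b x.
  have /matrixP/(_ i (enum_rank b)) := UQ; rewrite !mxE => h.
  rewrite -[RHS](_ : \sum_j Qs i j * Osm^T j (enum_rank b) = _); last first.
    by apply: eq_bigr => x _; rewrite !mxE enum_rankK.
  rewrite -h [RHS](bigD1 (s i)) //= [X in _ = _ + X]big1 ?addr0 => [|j /U0 ->]; last by rewrite mul0r.
  congr (_ * _); rewrite mxE; apply: eq_bigr => x _; by rewrite !mxE enum_rankK.
(* [U] has a single nonzero entry per row; the constant observable and the unit row sums of both
   matrices fix its value. *)
have U1 i : U i (s i) = 1.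
  have := UQb i b0.
  under eq_bigr do rewrite O1 mulr1.
  under [in RHS]eq_bigr do rewrite Os1 mulr1.
  by rewrite Q1 Qs1 mulr1.
exists s; split=> // i j.
apply/eqP; rewrite -subr_eq0; apply/eqP.
(* The difference of the two rows integrates every [Os b] to 0, hence vanishes by independence. *)
apply: (indep (fun j => Q (s i) (s j) - Qs i j)) => b.
under eq_bigr do rewrite mulrBl.
rewrite sumrB -(UQb i b) U1 mul1r [X in _ - X](reindex_inj (@perm_inj _ s)) /=.
by under [X in _ - X]eq_bigr do rewrite OS; rewrite subrr.
Qed.

End identifiability.

(** * Forgetting of the initial state *)

Section contraction.
Context (R : realType) (k : nat).
Implicit Types (Q : 'M[R]_k) (v : 'I_k -> R).

Lemma Delta_q_le1 (q : R) Q (i0 : 'I_k) : Delta_q q Q -> k%:R * q <= 1.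
Proof.
move=> [hQ hq]; have [_ e] := hQ i0; rewrite -[leRHS]e.
rewrite mulr_natl -[X in _ *+ X]card_ord -sumr_const.
by apply: ler_sum => j _.
Qed.

(** Doeblin minorisation: [Q i j] splits into [q], which contributes the same [q * s] to every row,
    and a remainder of total mass [1 - k%:R * q], which alone carries the oscillation of [v]. *)
Lemma mxapp_contract (q : R) Q v (a b : R) : Delta_q q Q ->
  (forall i, a <= v i <= b) ->
  exists a', forall i, a' <= mxapp Q v i <= a' + (1 - k%:R * q) * (b - a).
Proof.
move=> [hQ hq] hv; pose s := \sum_j v j.
exists (q * s + (1 - k%:R * q) * a) => i.
have e1 : \sum_j (Q i j - q) = 1 - k%:R * q.
  rewrite sumrB; have [_ ->] := hQ i.
  by rewrite sumr_const card_ord mulr_natl.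
have -> : mxapp Q v i = q * s + \sum_j (Q i j - q) * v j.
  rewrite /mxapp /s mulr_sumr -big_split /=; apply: eq_bigr => j _; ring.
rewrite lerD2l -addrA -mulrDr addrCA subrr addr0 lerD2l -e1 !mulr_suml.
apply/andP; split; apply: ler_sum => j _; apply: ler_wpM2l; rewrite ?subr_ge0 //.
  by have /andP[] := hv j.
by have /andP[] := hv j.
Qed.

Lemma iter_mxapp_contract (q : R) Q v (a b : R) p : Delta_q q Q ->
  (forall i, a <= v i <= b) ->
  exists a', forall i,
    a' <= iter p (mxapp Q) v i <= a' + (1 - k%:R * q) ^+ p * (b - a).
Proof.
move=> dQ hv; elim: p => [|p [a' IH]].
  by exists a => i; rewrite expr0 mul1r addrCA subrr addr0 /=.
have [c hc] := mxapp_contract dQ IH.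
by exists c => i; have := hc i; rewrite exprS -mulrA [a' + _ - _]addrAC subrr add0r.
Qed.

Lemma iter_mxapp_osc (q : R) Q v p i j : Delta_q q Q ->
  (forall i, 0 <= v i <= 1) ->
  iter p (mxapp Q) v i <= iter p (mxapp Q) v j + (1 - k%:R * q) ^+ p.
Proof.
move=> dQ hv; have [a h] := iter_mxapp_contract p dQ hv.
by have := h i; have := h j; rewrite subr0 mulr1; lra.
Qed.

(** One distribution serves all [v]: the law of the chain p steps after state i, later taken as the
    initial law of a triple moment. *)
Lemma iter_mxapp_row Q p i : is_transition Q ->
  exists m : 'I_k -> R, is_distribution m /\
    forall v, iter p (mxapp Q) v i = \sum_x m x * v x.
Proof.
move=> hQ; elim: p => [|p [m [[m0 m1] hm]]].
  exists (fun x => (x == i)%:R); split; last first.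
    move=> v /=; rewrite (bigD1 i) //= eqxx mul1r big1 ?addr0 // => j /negbTE ->.
    by rewrite mul0r.
  split=> [x|]; first by case: (x == i).
  by rewrite (bigD1 i) //= eqxx big1 ?addr0 // => j /negbTE ->.
exists (fun x => \sum_y m y * Q y x); split.
  split=> [x|].
    by apply: sumr_ge0 => y _; rewrite mulr_ge0 //; have [] := hQ y.
  rewrite exchange_big /= -[RHS]m1; apply: eq_bigr => y _.
  by rewrite -mulr_sumr; have [_ ->] := hQ y; rewrite mulr1.
move=> v; rewrite iterSr hm /mxapp.
under eq_bigr do rewrite mulr_sumr.
rewrite exchange_big /=; apply: eq_bigr => x _.
by rewrite mulr_suml; apply: eq_bigr => y _; rewrite mulrA.
Qed.

Lemma stationary_iter_mxapp Q m v p : is_stationary Q m ->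
  \sum_i m i * iter p (mxapp Q) v i = \sum_i m i * v i.
Proof.
move=> [_ hm]; elim: p v => [//|p IH] v.
rewrite iterSr IH /mxapp.
under eq_bigr do rewrite mulr_sumr.
rewrite exchange_big /=; apply: eq_bigr => x _.
by rewrite -[in RHS](hm x) mulr_suml; apply: eq_bigr => y _; rewrite mulrA.
Qed.

Lemma stationary_iter_mxapp_close (q : R) Q m v p i : Delta_q q Q ->
  is_stationary Q m -> (forall i, 0 <= v i <= 1) ->
  `|iter p (mxapp Q) v i - \sum_i m i * v i| <= (1 - k%:R * q) ^+ p.
Proof.
move=> dQ sm hv; rewrite -(stationary_iter_mxapp v p sm).
have [[m0 m1] _] := sm.
have -> : iter p (mxapp Q) v i = \sum_j m j * iter p (mxapp Q) v i.
  by rewrite -mulr_suml m1 mul1r.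
rewrite -sumrB.
apply: (le_trans (ler_norm_sum _ _ _)).
rewrite -[leRHS]mul1r -[X in X * _]m1 mulr_suml; apply: ler_sum => j _.
rewrite -mulrBr normrM ger0_norm // ler_wpM2l // ler_distl.
have h1 := iter_mxapp_osc p i j dQ hv; have h2 := iter_mxapp_osc p j i dQ hv.
by apply/andP; split; lra.
Qed.

Lemma window_itv Q (u v w : 'I_k -> R) : is_transition Q ->
  (forall i, 0 <= u i <= 1) -> (forall i, 0 <= v i <= 1) ->
  (forall i, 0 <= w i <= 1) -> forall i, 0 <= window Q u v w i <= 1.
Proof.
move=> hQ.
have ha (z : 'I_k -> R) : (forall i, 0 <= z i <= 1) -> forall i, 0 <= mxapp Q z i <= 1.
  move=> hz i; have [Q0 Q1] := hQ i; apply/andP; split.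
    by apply: sumr_ge0 => j _; rewrite mulr_ge0 //; have /andP[] := hz j.
  rewrite -[leRHS]Q1; apply: ler_sum => j _; rewrite ler_piMr //.
  by have /andP[] := hz j.
have hm (z z' : 'I_k -> R) : (forall i, 0 <= z i <= 1) ->
    (forall i, 0 <= z' i <= 1) -> forall i, 0 <= z i * z' i <= 1.
  move=> hz hz' i; have /andP[a b] := hz i; have /andP[c d] := hz' i.
  by rewrite mulr_ge0 //= mulr_ile1.
move=> hu hv hw; rewrite /window; apply: (hm _ _) => //; apply: (ha _).
by apply: hm => //; apply: ha.
Qed.

End contraction.

(** * Uniform separation of triple moments by compactness *)

Section continuity.
Context (R : realType) (Z : topologicalType).
Implicit Types f g : Z -> R.

Lemma continuous_sumr (J : finType) (f : J -> Z -> R) :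
  (forall j, continuous (f j)) -> continuous (fun z => \sum_j f j z).
Proof.
move=> cf; apply: (@continuous_big R J +%R 0 xpredT) => //.
exact: add_continuous.
Qed.

Lemma continuous_mulr f g :
  continuous f -> continuous g -> continuous (fun z => f z * g z).
Proof. by move=> cf cg z; apply: continuousM; [exact: cf|exact: cg]. Qed.

Lemma continuous_addr f g :
  continuous f -> continuous g -> continuous (fun z => f z + g z).
Proof. by move=> cf cg z; apply: cvgD; [exact: cf|exact: cg]. Qed.

Lemma continuous_distr f (a : R) :
  continuous f -> continuous (fun z => `|f z - a|).
Proof.
move=> cf z; apply: cvg_norm; apply: cvgB; [exact: cf|exact: cvg_cst].
Qed.

End continuity.

(** The parameters far from every relabelling of the truth form a compact set, on which the
    discrepancy is continuous and, by identifiability, never 0. The law [m] is arbitrary, so the gap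
    applies to the law of the chain after any number of steps. *)
Lemma triple_moment_separation (R : realType) (k : nat) (I : finType) (b0 : I)
    (Qs : 'M[R]_k) (ms : 'I_k -> R)
    (Os : I -> 'I_k -> R) (e : R) :
  (forall i, \sum_j Qs i j = 1) -> Qs \in unitmx -> (forall i, ms i != 0) ->
  (forall i, Os b0 i = 1) ->
  (forall a : 'I_k -> R, (forall b, \sum_i a i * Os b i = 0) ->
     forall i, a i = 0) ->
  0 < e ->
  exists2 kappa : R, 0 < kappa &
  forall (Q : 'M[R]_k) (m : 'I_k -> R) (O : I -> 'I_k -> R),
    is_transition Q -> is_distribution m ->
    (forall b i, 0 <= O b i <= 1) -> (forall i, O b0 i = 1) ->
    (forall s : 'S_k, (forall i j, `|Q (s i) (s j) - Qs i j| < e) ->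
       (forall b i, `|O b (s i) - Os b i| < e) -> False) ->
    exists a b c, kappa <= `|triple_moment Q m (O a) (O b) (O c)
                             - triple_moment Qs ms (Os a) (Os b) (Os c)|.
Proof.
move=> Qs1 uQs ms0 Os1 indep e0.
(* A parameter is a point of a cube with one coordinate for each entry of [Q], [m] and [O]. *)
pose S : finType := (('I_k * 'I_k) + 'I_k + (I * 'I_k))%type.
pose Z : topologicalType := prod_topology (fun _ : S => R).
have coord_continuous (s : S) : continuous (fun z : Z => z s : R).
  exact: (@proj_continuous S (fun _ => R) s).
pose zQ (z : Z) : 'M[R]_k := \matrix_(i, j) z (inl (inl (i, j))).
pose zm (z : Z) : 'I_k -> R := fun i => z (inl (inr i)).
pose zO (z : Z) : I -> 'I_k -> R := fun b i => z (inr (b, i)).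
pose d3 (z : Z) a b c :=
  `|triple_moment (zQ z) (zm z) (zO z a) (zO z b) (zO z c)
    - triple_moment Qs ms (Os a) (Os b) (Os c)|.
(* The unit row sums and the constraint at [b0] enter as penalties, so the compact set is the plain
   cube cut by [D], and a zero of [Phi] satisfies all the hypotheses of identifiability. *)
pose Phi (z : Z) : R := (\sum_a \sum_b \sum_c d3 z a b c
  + \sum_i `|\sum_j zQ z i j - 1|) + \sum_i `|zO z b0 i - 1|.
pose Psi (s : 'S_k) (z : Z) : R := \sum_i \sum_j `|zQ z (s i) (s j) - Qs i j|
  + \sum_b \sum_i `|zO z b (s i) - Os b i|.
have czQ i j : continuous (fun z => zQ z i j).
  by rewrite (_ : (fun z => _) = fun z => z (inl (inl (i, j)))) //;
    apply/funext => z; rewrite mxE.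
have czm i : continuous (fun z => zm z i) by exact: coord_continuous.
have czO b i : continuous (fun z => zO z b i) by exact: coord_continuous.
have cPhi : continuous Phi.
  apply: continuous_addr; [apply: continuous_addr|].
  - do 3 (apply: continuous_sumr => ?); apply: continuous_distr.
    rewrite /triple_moment /window /mxapp.
    apply: continuous_sumr => i; apply: continuous_mulr => //.
    apply: continuous_mulr => //; apply: continuous_sumr => j.
    apply: continuous_mulr => //; apply: continuous_mulr => //.
    by apply: continuous_sumr => l; apply: continuous_mulr.
  - apply: continuous_sumr => i; apply: continuous_distr.
    by apply: continuous_sumr.
  - by apply: continuous_sumr => i; apply: continuous_distr.
have cPsi s : continuous (Psi s).
  by apply: continuous_addr; do 2 (apply: continuous_sumr => ?); apply: continuous_distr.
pose B : set Z := [set z | forall s, `[0 : R, 1]%classic (z s)].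
have cB : compact B.
  apply: (@tychonoff S (fun _ => R) (fun _ => `[0 : R, 1]%classic)) => s.
  exact: segment_compact.
pose D : set Z := \bigcap_(s in setT) [set z | e <= Psi s z].
have cD : closed D.
  apply: closed_bigI => s _.
  apply: (@preimage_closed _ _ (Psi s) [set x | e <= x]).
    by move=> x _; apply: cPsi.
  exact: closed_ge.
have d30 z a b c : 0 <= d3 z a b c by exact: normr_ge0.
have cBD : compact (B `&` D) by apply: compact_closedI.
have cIm : closed (Phi @` (B `&` D)).
  apply: compact_closed; first exact: norm_hausdorff.
  by apply: continuous_compact => //; apply: continuous_subspaceT.
have Phi_ge (z : Z) : [/\ forall a b c, d3 z a b c <= Phi z,
     forall i, `|\sum_j zQ z i j - 1| <= Phi z & forall i, `|zO z b0 i - 1| <= Phi z].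
  have h1 (J : finType) (F : J -> R) j0 : (forall j, 0 <= F j) -> F j0 <= \sum_j F j.
    by move=> F0; rewrite (bigD1 j0) //= lerDl sumr_ge0.
  have s1 : 0 <= \sum_a \sum_b \sum_c d3 z a b c.
    by do 3 (apply: sumr_ge0 => ? _); exact: normr_ge0.
  have s2 : 0 <= \sum_i `|\sum_j zQ z i j - 1| by apply: sumr_ge0.
  have s3 : 0 <= \sum_i `|zO z b0 i - 1| by apply: sumr_ge0.
  split=> [a b c|i|i].
  - have : d3 z a b c <= \sum_a \sum_b \sum_c d3 z a b c.
      apply: (le_trans (h1 _ (fun c => d3 z a b c) c _)) => //.
      apply: (le_trans (h1 _ (fun b => \sum_c d3 z a b c) b _)) => [j|].
        by apply: sumr_ge0.
      apply: (h1 _ (fun a => \sum_b \sum_c d3 z a b c) a) => j.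
      by do 2 (apply: sumr_ge0 => ? _).
    by rewrite /Phi; lra.
  - have := h1 _ (fun i => `|\sum_j zQ z i j - 1|) i (fun _ => normr_ge0 _).
    by rewrite /Phi /=; lra.
  - have := h1 _ (fun i => `|zO z b0 i - 1|) i (fun _ => normr_ge0 _).
    by rewrite /Phi /=; lra.
have n0 : ~ (Phi @` (B `&` D)) 0.
  move=> [z [_ Dz] Pz0]; have [P1 P2 P3] := Phi_ge z; rewrite Pz0 in P1 P2 P3.
  have eq0 (x y : R) : `|x - y| <= 0 -> x = y.
    by rewrite normr_le0 subr_eq0 => /eqP.
  have [s [hs1 hs2]] := @triple_moment_identifiable R k I b0 (zQ z) Qs (zm z) ms
    (zO z) Os (fun i => eq0 _ _ (P2 i)) Qs1 uQs ms0 (fun i => eq0 _ _ (P3 i))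
    Os1 indep (fun a b c => eq0 _ _ (P1 a b c)).
  have := Dz s (Logic.I); rewrite /= /Psi big1 ?big1 ?addr0 => [|b _|i _].
  - by rewrite leNgt e0.
  - by rewrite big1 // => i _; rewrite hs2 subrr normr0.
  - by rewrite big1 // => j _; rewrite hs1 subrr normr0.
have : nbhs (0 : R) (~` (Phi @` (B `&` D))).
  by apply: open_nbhs_nbhs; split => //; rewrite openC.
move=> /nbhs_norm0P [kap /= kap0 hkap].
(* One more than the number of triples: if all discrepancies were below [kap / N], their sum would
   be strictly below [kap]. *)
pose N : R := (#|I| ^ 3).+1%:R.
exists (kap / N); first by rewrite divr_gt0 // ltr0n.
move=> Q m O hQ [m0 m1] hO O1 far.
pose z : Z := fun s => match s with
  | inl (inl ij) => Q ij.1 ij.2 | inl (inr i) => m i | inr bi => O bi.1 bi.2 end.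
have zQE : zQ z = Q by apply/matrixP => i j; rewrite mxE.
have Bz : B z.
  have d01 (mm : 'I_k -> R) i : is_distribution mm -> `[0 : R, 1]%classic (mm i).
    move=> [mm0 mm1] /=; rewrite in_itv /= mm0 -mm1 (bigD1 i) //= lerDl.
    by apply: sumr_ge0.
  move=> [[[i j]|i]|[b i]] /=.
  - exact: (d01 _ _ (hQ i)).
  - exact: (d01 m).
  - by rewrite in_itv /= hO.
have Dz : D z.
  move=> s _ /=; rewrite leNgt; apply/negP => Psilt.
  have psum (J J' : finType) (F : J -> J' -> R) j j' : (forall j j', 0 <= F j j') ->
      F j j' <= \sum_j \sum_j' F j j'.
    move=> F0; rewrite (bigD1 j) //= (bigD1 j') //= -addrA lerDl addr_ge0 //.
      by apply: sumr_ge0.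
    by apply: sumr_ge0 => ? _; apply: sumr_ge0.
  have q1 i j := psum _ _ (fun i j => `|zQ z (s i) (s j) - Qs i j|) i j
    (fun _ _ => normr_ge0 _).
  have q2 b i := psum _ _ (fun b i => `|zO z b (s i) - Os b i|) b i
    (fun _ _ => normr_ge0 _).
  have r1 : 0 <= \sum_i \sum_j `|zQ z (s i) (s j) - Qs i j|.
    by do 2 (apply: sumr_ge0 => ? _).
  have r2 : 0 <= \sum_b \sum_i `|zO z b (s i) - Os b i|.
    by do 2 (apply: sumr_ge0 => ? _).
  apply: (far s) => [i j|b i].
    rewrite -zQE; apply: (le_lt_trans (q1 i j)).
    by move: Psilt; rewrite /Psi; lra.
  apply: (le_lt_trans (q2 b i)).
  by move: Psilt; rewrite /Psi; lra.
have kPhi : kap <= Phi z.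
  rewrite leNgt; apply/negP => lt.
  have Phi0 : 0 <= Phi z by have [_ _ /(_ _)] := Phi_ge z; rewrite /Phi !addr_ge0 //;
    do ?(apply: sumr_ge0 => ? _).
  by apply: (hkap (Phi z)); rewrite /= ?ger0_norm //; exists z.
apply: contrapT => nex.
have lt3 a b c : d3 z a b c < kap / N.
  rewrite ltNge; apply/negP => h; apply: nex; exists a, b, c.
  by move: h; rewrite /d3 zQE.
have : Phi z <= kap / N * (#|I| ^ 3)%:R.
  rewrite /Phi zQE [X in _ + X + _]big1 ?addr0; last first.
    by move=> i _; have [_ ->] := hQ i; rewrite subrr normr0.
  rewrite [X in _ + X]big1 ?addr0; last first.
    by move=> i _; rewrite /zO /= O1 subrr normr0.
  apply: (@le_trans _ _ (\sum_(a : I) \sum_(b : I) \sum_(c : I) kap / N)).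
    by do 3 (apply: ler_sum => ? _); apply/ltW/lt3.
  by rewrite !sumr_const -!mulrnA -[leLHS]mulr_natr !expnS expn0 muln1 ?mulnA.
have : kap / N * (#|I| ^ 3)%:R < kap.
  by rewrite mulrAC ltr_pdivrMr ?ltr0n // ltr_pM2l // ltr_nat.
by move=> h1 h2; move: (le_lt_trans kPhi (le_lt_trans h2 h1)); rewrite ltxx.
Qed.

(** * Densities and nested product measures *)

Section density_integral.
Local Open Scope ereal_scope.
Context (R : realType) (dd : measure_display) (T : measurableType dd).
Variables (lam : {measure set T -> \bar R}) (f : T -> R).
Hypotheses (mf : measurable_fun setT f) (f0 : forall y, (0 <= f y)%R).

Lemma dmeasureE A : dmeasure lam f A = \int[lam]_(y in A) (f y)%:E.
Proof. by rewrite /dmeasure /= /dmeasure_fun asboolT. Qed.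

Lemma dmeasureE_indic A : measurable A ->
  dmeasure lam f A = \int[lam]_y ((\1_A y)%:E * (f y)%:E).
Proof.
move=> mA; rewrite dmeasureE integral_mkcond; apply: eq_integral => y _.
rewrite /patch; case: ifPn => [/[!inE] Ay|]; first by rewrite indicE mem_set // mul1e.
by rewrite notin_setE => Ay; rewrite indicE memNset // mul0e.
Qed.

Import HBNNSimple.

Let integral_dmeasure_nnsfun (h : {nnsfun T >-> R}) :
  \int[dmeasure lam f]_x (h x)%:E = \int[lam]_x ((h x)%:E * (f x)%:E).
Proof.
have me : measurable_fun setT (EFin \o f) by exact/measurable_EFinP.
under [LHS]eq_integral do rewrite fimfunE -fsumEFin//.
rewrite [LHS]ge0_integral_fsum//; last 2 first.
  - by move=> r; exact/measurable_EFinP/measurableT_comp.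
  - by move=> n x _; rewrite EFinM nnfun_muleindic_ge0.
under [RHS]eq_integral.
  move=> x xD; rewrite fimfunE -fsumEFin// ge0_mule_fsuml; last first.
    by move=> r; rewrite EFinM nnfun_muleindic_ge0.
  over.
rewrite [RHS]ge0_integral_fsum//; last 2 first.
  - move=> r; apply: emeasurable_funM => //.
    by apply/measurable_EFinP; apply/measurableT_comp => //.
  - by move=> n x _; rewrite EFinM mule_ge0// ?nnfun_muleindic_ge0 // lee_fin.
apply: eq_fsbigr => r _.
have [r0|r0] := ltP r 0%R.
  rewrite !integral0_eq // => x _; rewrite preimage_nnfun0 // indic0 mulr0 //.
  by rewrite mul0e.
rewrite integralZl_indic_nnsfun//= integral_indic// setIT dmeasureE_indic //.
under [RHS]eq_integral do rewrite EFinM -muleA.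
rewrite ge0_integralZl //.
- by apply: emeasurable_funM => //; apply/measurable_EFinP.
- by move=> x _; rewrite mule_ge0 // lee_fin.
Qed.

Lemma ge0_integral_dmeasure (g : T -> \bar R) :
  measurable_fun setT g -> (forall x, 0 <= g x) ->
  \int[dmeasure lam f]_x g x = \int[lam]_x (g x * (f x)%:E).
Proof.
move=> mg g0; pose g_ := nnsfun_approx measurableT mg.
have me : measurable_fun setT (EFin \o f) by exact/measurable_EFinP.
transitivity (limn (fun n => \int[dmeasure lam f]_x (g_ n x)%:E)).
  rewrite -monotone_convergence//=.
  - apply: eq_integral => x _; apply/esym/cvg_lim => //=.
    exact: cvg_nnsfun_approx.
  - by move=> n; apply: measurableT_comp => //; exact: measurable_funTS.
  - by move=> n x _; rewrite lee_fin.
  - by move=> x _ a b ab; rewrite lee_fin//; exact/lefP/nd_nnsfun_approx.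
rewrite (_ : \int[lam]_x _ =
    limn (fun n => \int[lam]_x ((g_ n x)%:E * (f x)%:E))); last first.
  rewrite -monotone_convergence//=.
  - apply: eq_integral => x _; apply/esym/cvg_lim => //.
    apply: cvgeZr => //; exact: cvg_nnsfun_approx.
  - by move=> n; apply: emeasurable_funM => //; exact/measurable_EFinP.
  - by move=> n x _; rewrite mule_ge0 ?lee_fin.
  - move=> x _ a b ab; apply: lee_wpmul2r; rewrite ?lee_fin //.
    exact/lefP/nd_nnsfun_approx.
by congr (limn _); apply/funext => n /=; rewrite integral_dmeasure_nnsfun.
Qed.

End density_integral.

(** Rectangles are stable under intersection and generate the product sigma-algebra. *)
Lemma measure_prod_unique (R : realType) (d1 d2 : measure_display)
    (T1 : measurableType d1) (T2 : measurableType d2)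
    (m1 m2 : {measure set (T1 * T2) -> \bar R}) :
  (m1 setT < +oo)%E ->
  (forall A B, measurable A -> measurable B -> m1 (A `*` B) = m2 (A `*` B)) ->
  forall X, measurable X -> m1 X = m2 X.
Proof.
move=> fin1 m12.
pose C : set (set (T1 * T2)) :=
  [set C | exists A, measurable A /\ exists B, measurable B /\ C = A `*` B].
have CI : setI_closed C.
  move=> /= _ _ [X1 [mX1 [X2 [mX2 ->]]]] [Y1 [mY1 [Y2 [mY2 ->]]]].
  rewrite -setXI; exists (X1 `&` Y1); split; first exact: measurableI.
  by exists (X2 `&` Y2); split => //; exact: measurableI.
move=> X mX; apply: (measure_unique C (fun=> setT)) => //.
- rewrite measurable_prod_measurableType //; congr (<<s _ >>).
  rewrite predeqE; split => [[A mA [B mB <-]]|[A [mA [B [mB ->]]]]].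
    by exists A; split => //; exists B.
  by exists A => //; exists B.
- by move=> n; exists setT; split => //; exists setT; split => //; rewrite setXTT.
- by rewrite bigcup_const.
- by move=> A [A1 [mA1 [A2 [mA2 ->]]]]; rewrite m12.
Qed.

(** The sum of the series has a finite integral, hence is finite almost everywhere, and each term is
    bounded by a vanishing tail. This plays the role of Markov's inequality followed by
    Borel-Cantelli. *)
Lemma ae_cvg0_summable (R : realType) (d : measure_display)
    (T : measurableType d) (mu : {measure set T -> \bar R})
    (f : (T -> \bar R)^nat) :
  (forall n, measurable_fun setT (f n)) -> (forall n x, 0 <= f n x)%E ->
  (\sum_(0 <= n <oo) \int[mu]_x f n x < +oo)%E ->
  {ae mu, forall x, f n x @[n --> \oo] --> 0%E}.
Proof.
move=> mf f0; rewrite -integral_nneseries // => fin.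
have mS : measurable_fun setT (fun x => \sum_(0 <= n <oo) f n x)%E.
  by apply: ge0_emeasurable_sum => // n x _ _; exact: f0.
have S0 x : (0 <= \sum_(0 <= n <oo) f n x)%E by apply: nneseries_ge0.
have iS : mu.-integrable setT (fun x => \sum_(0 <= n <oo) f n x)%E.
  apply/integrableP; split => //.
  by under eq_integral do rewrite gee0_abs //.
have := integrable_ae measurableT iS; apply: filterS => x /(_ I) Sx.
have tail := nneseries_tail_cvg (P := xpredT) (f := fun n => f n x) _ (fun n _ => f0 n x).
apply: (@squeeze_cvge _ _ _ _ (fun=> 0%E) _
  (fun N => \sum_(N <= n <oo) f n x)%E); last 2 first.
- exact: cvg_cst.
- by apply: tail; rewrite ltey_eq Sx.
near=> n; rewrite f0 /=.
have := @nneseries_lim_ge R (fun n => f n x) xpredT n n.+1 (fun k _ _ => f0 k x).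
by rewrite big_nat1.
Unshelve. all: by end_near. Qed.

(** * Iterated products of the reference measure *)

Section sigma_finite_product.
Context (R : realType) (d1 d2 : measure_display).
Context (T1 : measurableType d1) (T2 : measurableType d2).
Variables (m1 : {sigma_finite_measure set T1 -> \bar R}).
Variables (m2 : {sigma_finite_measure set T2 -> \bar R}).

Lemma sigma_finite_product : sigma_finite setT (m1 \x m2)%E.
Proof.
have [F TF Foo] := sigma_finiteT m1; have [G TG Goo] := sigma_finiteT m2.
(* An enumeration of pairs of indices, with a default pair at the integers that encode none. *)
pose pr n : nat * nat := odflt (0%N, 0%N) (unpickle n).
exists (fun n => F (pr n).1 `*` G (pr n).2).
  apply/seteqP; split=> // -[x y] _.
  have [i _ Fi] : (\bigcup_i F i) x by rewrite -TF.
  have [j _ Gj] : (\bigcup_i G i) y by rewrite -TG.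
  by exists (pickle (i, j)) => //; rewrite /pr pickleK.
move=> n; have [mF Foo'] := Foo (pr n).1; have [mG Goo'] := Goo (pr n).2.
split; first exact: measurableX.
by rewrite product_measure1E // lte_mul_pinfty // ge0_fin_numE.
Qed.

Definition sf_product : {sigma_finite_measure set (T1 * T2)%type -> \bar R} :=
  HB.pack_for {sigma_finite_measure set (T1 * T2)%type -> \bar R} (m1 \x m2)%E
    (Measure_isSigmaFinite.Build _ _ _ (m1 \x m2)%E sigma_finite_product).

End sigma_finite_product.

Section nested_product.
Context (R : realType) (dd : measure_display) (T : measurableType dd).
Variable lam : {sigma_finite_measure set T -> \bar R}.

(** The display of a product type depends on those of its factors, so display, type and measure have
    to come from a single recursion. *)
Record mspace := MSpace {
  ms_disp : measure_display;
  ms_type : measurableType ms_disp;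
  ms_measure : {sigma_finite_measure set ms_type -> \bar R} }.

(** Level n holds n.+1 observations, nested to the left: the last one is the second component and
    can be integrated out first. *)
Fixpoint nprod (n : nat) : mspace :=
  if n is n'.+1 then
    @MSpace _ [the measurableType _ of (ms_type (nprod n') * T)%type]
      (sf_product (ms_measure (nprod n')) lam)
  else @MSpace dd T lam.

Definition ntype n := ms_type (nprod n).
Definition nmeas n : {sigma_finite_measure set (ntype n) -> \bar R} :=
  ms_measure (nprod n).

(** Beyond index n the last coordinate is repeated, so that a function of infinite sequences applies
    to finite ones; the functions used depend on indices up to n only. *)
Fixpoint nacc (n : nat) : ntype n -> nat -> T :=
  match n return ntype n -> nat -> T with
  | 0 => fun y _ => y
  | n'.+1 => fun y t => if (t <= n')%N then nacc y.1 t else y.2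
  end.

Fixpoint nobs (n : nat) (s : nat -> T) : ntype n :=
  match n return ntype n with
  | 0 => s 0%N
  | n'.+1 => (nobs n' s, s n'.+1)
  end.

Lemma nacc_nobs n s t : (t <= n)%N -> nacc (nobs n s) t = s t.
Proof.
elim: n => [|n IH] /=; first by rewrite leqn0 => /eqP ->.
rewrite leq_eqVlt ltnS => /predU1P[->|tn]; first by rewrite ltnn.
by rewrite tn IH.
Qed.

Lemma measurable_nacc n t : measurable_fun setT (fun y : ntype n => nacc y t).
Proof.
elim: n => [|n IH] /=; first exact: measurable_id.
case: leqP => tn; last exact: measurable_snd.
by apply: (measurableT_comp IH); exact: measurable_fst.
Qed.

Lemma measurable_nobs (d : measure_display) (U : measurableType d)
    (Y : nat -> U -> T) n :
  (forall t, measurable_fun setT (Y t)) ->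
  measurable_fun setT (fun w => nobs n (Y ^~ w)).
Proof.
move=> mY; elim: n => [|n IH] /=; first exact: mY.
exact: (measurable_fun_pair IH (mY n.+1)).
Qed.

Lemma ge0_integral_nmeasS n (F : ntype n.+1 -> \bar R) :
  measurable_fun setT F -> (forall y, 0 <= F y)%E ->
  (\int[nmeas n.+1]_y F y = \int[nmeas n]_y \int[lam]_z F (y, z))%E.
Proof. by move=> mF F0; rewrite [LHS]fubini_tonelli1. Qed.

Lemma ge0_integral_nmeasSM n (F : ntype n -> \bar R) (g : T -> \bar R) :
  measurable_fun setT F -> (forall y, 0 <= F y)%E ->
  measurable_fun setT g -> (forall y, 0 <= g y)%E ->
  (\int[nmeas n.+1]_y (F y.1 * g y.2) =
   \int[nmeas n]_y F y * \int[lam]_z g z)%E.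
Proof.
move=> mF F0 mg g0; rewrite ge0_integral_nmeasS; last 2 first.
- apply: emeasurable_funM.
    by apply: (measurableT_comp mF); exact: measurable_fst.
  by apply: (measurableT_comp mg); exact: measurable_snd.
- by move=> y; rewrite mule_ge0.
under eq_integral do rewrite /= ge0_integralZl //.
by rewrite ge0_integralZr // integral_ge0.
Qed.

Lemma measurable_prod_nacc n N (g : nat -> T -> R) :
  (forall t, measurable_fun setT (g t)) ->
  measurable_fun setT (fun y : ntype n => \prod_(t < N) g t (nacc y t)).
Proof.
move=> mg; elim: N => [|N IH].
  by under eq_fun do rewrite big_ord0; exact: measurable_cst.
under eq_fun do rewrite big_ord_recr /=.
apply: measurable_funM => //; apply: (measurableT_comp (mg N)).
exact: measurable_nacc.
Qed.

Lemma prod_naccS n (g : nat -> T -> R) (y : ntype n.+1) :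
  \prod_(t < n.+2) g t (nacc y t) =
  (\prod_(t < n.+1) g t (nacc y.1 t)) * g n.+1 y.2.
Proof.
rewrite big_ord_recr /= ltnn; congr (_ * _).
by apply: eq_bigr => t _; rewrite -ltnS ltn_ord.
Qed.

Lemma integral_prod_nacc n (g : nat -> T -> R) :
  (forall t, measurable_fun setT (g t)) -> (forall t y, 0 <= g t y) ->
  (\int[nmeas n]_y (\prod_(t < n.+1) g t (nacc y t))%:E =
   \prod_(t < n.+1) \int[lam]_z (g t z)%:E)%E.
Proof.
move=> mg g0; elim: n => [|n IH].
  by rewrite big_ord1; apply: eq_integral => y _; rewrite big_ord1.
under eq_integral do rewrite prod_naccS EFinM.
rewrite (@ge0_integral_nmeasSM n
  (fun y => (\prod_(t < n.+1) g t (nacc y t))%:E) (fun z => (g n.+1 z)%:E)).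
- by rewrite IH [in RHS]big_ord_recr.
- by apply/measurable_EFinP; exact: measurable_prod_nacc.
- by move=> y; rewrite lee_fin; apply: prodr_ge0.
- exact/measurable_EFinP.
- by move=> y; rewrite lee_fin.
Qed.

End nested_product.

(** * The law of the observations *)

(** The joint law is prescribed on a hidden path and a box of observations, as in the hypothesis of
    [theorem2]; the next section extends it to all measurable sets of observations. *)
Definition hmm_law (R : realType) (k : nat) (dd dO : measure_display)
    (T : measurableType dd) (Omega : measurableType dO)
    (lam : {measure set T -> \bar R}) (Q : 'M[R]_k) (f : 'I_k -> T -> R)
    (m : 'I_k -> R) (P : probability Omega R) (X : nat -> Omega -> 'I_k)
    (Y : nat -> Omega -> T) : Prop :=
  forall (n : nat) (x : nat -> 'I_k) (B : nat -> set T),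
  (forall t, measurable (B t)) ->
  P [set w | forall t, (t <= n)%N -> X t w = x t /\ B t (Y t w)] =
  ((m (x 0%N))%:E * \prod_(t < n) (Q (x t) (x t.+1))%:E
    * \prod_(t < n.+1) dmeasure lam (f (x t)) (B t))%E.

Section joint_law.
Context (R : realType) (k : nat) (dd : measure_display) (T : measurableType dd).
Variable lam : {sigma_finite_measure set T -> \bar R}.
Variables (Q : 'M[R]_k) (f : 'I_k -> T -> R) (m : 'I_k -> R).
Hypotheses (hQ : is_transition Q) (hm : is_distribution m).
Hypothesis hf : forall i, is_density lam (f i).
Context (dO : measure_display) (Omega : measurableType dO).
Variables (P : probability Omega R) (X : nat -> Omega -> 'I_k).
Variable (Y : nat -> Omega -> T).
Hypothesis mX : forall t i, measurable [set w | X t w = i].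
Hypothesis mY : forall t, measurable_fun setT (Y t).
Hypothesis hlaw : hmm_law lam Q f m P X Y.

Definition path_weight (x : nat -> 'I_k) n : R :=
  m (x 0%N) * \prod_(t < n) Q (x t) (x t.+1).

Definition path_event (x : nat -> 'I_k) n : set Omega :=
  [set w | forall t, (t <= n)%N -> X t w = x t].

Definition path_density (x : nat -> 'I_k) n (y : ntype lam n) : R :=
  \prod_(t < n.+1) f (x t) (nacc y t).

Let mf i : measurable_fun setT (f i). Proof. by have [] := hf i. Qed.
Let f0 i y : 0 <= f i y. Proof. by have [] := hf i. Qed.

Lemma path_weight_ge0 x n : 0 <= path_weight x n.
Proof.
apply: mulr_ge0; first by have [] := hm.
by apply: prodr_ge0 => t _; have [] := hQ (x t).
Qed.

Lemma path_density_ge0 x n (y : ntype lam n) : 0 <= path_density x y.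
Proof. exact: prodr_ge0. Qed.

Lemma measurable_path_density x n :
  measurable_fun setT (fun y : ntype lam n => path_density x y).
Proof. by apply: (measurable_prod_nacc _ _ (g := fun t => f (x t))). Qed.

Let mes i (B : set T) : R := fine (dmeasure lam (f i) B).

Let mesT i : mes i setT = 1.
Proof. by rewrite /mes dmeasureE //; have [_ _ ->] := hf i. Qed.

Let mesE i B : measurable B -> dmeasure lam (f i) B = (mes i B)%:E.
Proof.
move=> mB; rewrite fineK // ge0_fin_numE //.
apply: (@le_lt_trans _ _ (dmeasure lam (f i) setT)).
  by apply: le_measure; rewrite ?inE.
by rewrite dmeasureE //; have [_ _ ->] := hf i; rewrite ltry.
Qed.

Let measurable_nobsY n : measurable_fun setT (fun w => nobs lam n (Y ^~ w)).
Proof. exact: measurable_nobs. Qed.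

Lemma measurable_path_event x n : measurable (path_event x n).
Proof.
rewrite (_ : path_event x n =
    \bigcap_(t in [set t | (t <= n)%N]) [set w | X t w = x t]).
  by apply: fin_bigcap_measurable => //; exact: (finite_II _.+1).
by apply/seteqP; split=> w h t; exact: h.
Qed.

Let event x N (B : nat -> set T) : set Omega :=
  [set w | forall t, (t <= N)%N -> X t w = x t /\ B t (Y t w)].

Let measurable_event x N B : (forall t, measurable (B t)) ->
  measurable (event x N B).
Proof.
move=> mB; rewrite (_ : event x N B =
    \bigcap_(t in [set t | (t <= N)%N])
       ([set w | X t w = x t] `&` (Y t @^-1` B t))).
  apply: fin_bigcap_measurable => [|t _]; first exact: (finite_II _.+1).
  apply: measurableI => //; rewrite -[X in measurable X]setTI; exact: mY.
by apply/seteqP; split=> w h t; exact: h.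
Qed.

(** The coordinates after n stay constrained by boxes up to [N]. This lets the induction exchange,
    one coordinate at a time, a box for an arbitrary measurable set of the coordinates seen so
    far. *)
Let path_law_box x N n (B : nat -> set T) : (n <= N)%N ->
  (forall t, measurable (B t)) -> (forall t, (t <= n)%N -> B t = setT) ->
  forall A : set (ntype lam n), measurable A ->
  P [set w | A (nobs lam n (Y ^~ w)) /\ event x N B w] =
  (\int[nmeas lam n]_(y in A)
    (path_weight x N * (\prod_(t < N.+1) mes (x t) (B t)) * path_density x y)%:E)%E.
Proof.
elim: n B => [|n IH] B nN mB BT A mA.
  pose B' t := if t == 0%N then A else B t.
  have -> : [set w | A (nobs lam 0 (Y ^~ w)) /\ event x N B w] = event x N B'.
    apply/seteqP; split=> w /=.
      move=> [Aw h] t tN; have [h1 h2] := h t tN; split=> //.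
      by rewrite /B'; case: eqP => [->|].
    move=> h; split; first by have [] := h 0%N isT.
    move=> t tN; have [h1] := h t tN; rewrite /B'; split=> //.
    by move: b; case: eqP => [->|//]; rewrite BT.
  rewrite hlaw; last by move=> t; rewrite /B'; case: eqP.
  under [X in (_ * X)%E = _]eq_bigr => t _.
    rewrite mesE; last by rewrite /B'; case: eqP.
    over.
  rewrite !prodEFin -!EFinM.
  under eq_integral do rewrite EFinM.
  rewrite ge0_integralZl //; last 3 first.
  - by apply/measurable_EFinP; apply: measurable_funTS; exact: measurable_path_density.
  - by move=> y _; rewrite lee_fin path_density_ge0.
  - rewrite lee_fin mulr_ge0 ?path_weight_ge0 //; apply: prodr_ge0 => t _.
    exact: fine_ge0.
  have -> : (\int[nmeas lam 0]_(y in A) (path_density x y)%:E = (mes (x 0%N) A)%:E)%E.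
    rewrite -mesE // dmeasureE //; apply: eq_integral => y _.
    by rewrite /path_density big_ord1.
  rewrite -EFinM; congr _%:E; rewrite -/(path_weight x N) -[RHS]mulrA; congr (_ * _).
  by rewrite [in LHS]big_ord_recl [in RHS]big_ord_recl /= BT // mesT mul1r [RHS]mulrC.
have mT0 : measurable_fun setT
   (fun y : ntype lam n.+1 => path_weight x N * (\prod_(t < N.+1) mes (x t) (B t))
     * path_density x y).
  by apply: measurable_funM => //; exact: measurable_path_density.
pose c := path_weight x N * (\prod_(t < N.+1) mes (x t) (B t)).
have c0 : 0 <= c.
  rewrite mulr_ge0 ?path_weight_ge0 //; apply: prodr_ge0 => t _; exact: fine_ge0.
have mE : measurable (event x N B) by exact: measurable_event.
have mI : measurable_fun setT (\1_(event x N B) : Omega -> R).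
  exact: measurable_indic.
have I0 w : 0 <= \1_(event x N B) w :> R by rewrite indicE ler0n.
pose g (w : Omega) : ntype lam n.+1 := nobs lam n.+1 (Y ^~ w).
have mg : measurable_fun setT g by exact: measurable_nobsY.
pose mfg : {mfun Omega >-> ntype lam n.+1} :=
  HB.pack g (isMeasurableFun.Build _ _ _ _ _ mg).
have m1E (C : set (ntype lam n.+1)) : measurable C ->
    pushforward (dmeasure P \1_(event x N B)) mfg C =
    P [set w | C (nobs lam n.+1 (Y ^~ w)) /\ event x N B w].
  move=> mC; rewrite /pushforward dmeasureE // integral_indic //.
  - by rewrite setIC.
  - by rewrite -[X in measurable X]setTI; exact: (mg measurableT C mC).
have m2E (C : set (ntype lam n.+1)) : measurable C ->
    dmeasure (nmeas lam n.+1) (fun y => c * path_density x y) C =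
    (\int[nmeas lam n.+1]_(y in C) (c * path_density x y)%:E)%E.
  move=> mC; rewrite dmeasureE // => y.
  by rewrite mulr_ge0 // path_density_ge0.
rewrite -m1E // -m2E //.
have fin1 : (pushforward (dmeasure P \1_(event x N B)) mfg setT < +oo)%E.
  rewrite m1E // (le_lt_trans _ (ltry 1)) // probability_le1 //.
  by rewrite (_ : [set w | _] = event x N B) //; apply/seteqP; split=> w // [].
(* As functions of the set, both sides are measures on the product and the first is finite, so
   rectangles suffice. *)
suff rect (A1 : set (ntype lam n)) (B1 : set T) : measurable A1 -> measurable B1 ->
    pushforward (dmeasure P \1_(event x N B)) mfg (A1 `*` B1) =
    dmeasure (nmeas lam n.+1) (fun y => c * path_density x y) (A1 `*` B1).
  exact: (@measure_prod_unique R _ _ (ntype lam n) T _ _ fin1 rect A mA).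
move=> mA1 mB1; rewrite m1E; last exact: measurableX.
rewrite m2E; last exact: measurableX.
pose B' t := if t == n.+1 then B1 else B t.
have mB' t : measurable (B' t) by rewrite /B'; case: eqP.
rewrite (_ : [set w | _] = [set w | A1 (nobs lam n (Y ^~ w)) /\ event x N B' w]); last first.
  apply/seteqP; split=> w /=.
    move=> [[h1 h2] h3]; split=> // t tN; have [h4 h5] := h3 t tN; split=> //.
    by rewrite /B'; case: eqP => [->|].
  move=> [h1 h2]; split.
    by split=> //; have [] := h2 n.+1 nN; rewrite /B' eqxx.
  move=> t tN; have [h4 h5] := h2 t tN; split=> //; move: h5; rewrite /B'.
  by case: eqP => // ->; rewrite BT.
rewrite IH //; last 2 first.
- exact: ltnW.
- by move=> t tn; rewrite /B' ltn_eqF ?ltnS // BT // leqW.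
have eqP' : \prod_(t < N.+1) mes (x t) (B' t) =
    mes (x n.+1) B1 * \prod_(t < N.+1) mes (x t) (B t).
  pose n' : 'I_N.+1 := Ordinal (nN : (n.+1 < N.+1)%N).
  rewrite (bigD1 n') //= [in RHS](bigD1 n') //= {1}/B' eqxx BT // mesT mul1r.
  congr (_ * _); apply: eq_bigr => t ne; rewrite /B'; case: eqP => // e.
  by move: ne; rewrite -val_eqE /= e eqxx.
rewrite eqP' [in RHS]integral_mkcond.
transitivity (\int[nmeas lam n.+1]_y
   ((\1_A1 y.1 * (c * path_density x y.1))%:E * (\1_B1 y.2 * f (x n.+1) y.2)%:E))%E; last first.
  apply: eq_integral => y _; rewrite /patch.
  case: ifPn => [/[!inE] -[h1 h2]|].
    rewrite !indicE !mem_set // !mul1r -EFinM -mulrA; congr (_ * _)%:E.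
    by rewrite /path_density (prod_naccS (fun t => f (x t))).
  rewrite notin_setE => /not_andP[h|h]; rewrite !indicE (memNset h) mul0r ?mule0 //.
  by rewrite mul0e.
rewrite (@ge0_integral_nmeasSM _ _ _ lam n (fun y => (\1_A1 y * (c * path_density x y))%:E)
   (fun z => (\1_B1 z * f (x n.+1) z)%:E)); last 4 first.
- apply/measurable_EFinP; apply: measurable_funM; first exact: measurable_indic.
  by apply: measurable_funM => //; exact: measurable_path_density.
- by move=> y; rewrite lee_fin mulr_ge0 // ?indicE // mulr_ge0 // path_density_ge0.
- apply/measurable_EFinP; apply: measurable_funM => //; exact: measurable_indic.
- by move=> y; rewrite lee_fin mulr_ge0 // indicE.
have -> : (\int[lam]_z (\1_B1 z * f (x n.+1) z)%:E = (mes (x n.+1) B1)%:E)%E.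
  rewrite -mesE // dmeasureE_indic //.
rewrite muleC -ge0_integralZl //; last 3 first.
- apply/measurable_EFinP; apply: measurable_funM; first exact: measurable_indic.
  by apply: measurable_funM => //; exact: measurable_path_density.
- by move=> y _; rewrite lee_fin mulr_ge0 // ?indicE // mulr_ge0 // path_density_ge0.
- by rewrite lee_fin fine_ge0.
rewrite [LHS]integral_mkcond. apply: eq_integral => y _; rewrite /patch indicE.
case: (y \in A1); last by rewrite mul0r mule0.
by rewrite mul1r -EFinM; congr _%:E; rewrite /c; ring.
Qed.

Lemma path_law x n (A : set (ntype lam n)) : measurable A ->
  P [set w | A (nobs lam n (Y ^~ w)) /\ path_event x n w] =
  (\int[nmeas lam n]_(y in A) (path_weight x n * path_density x y)%:E)%E.
Proof.
move=> mA.
have := @path_law_box x n n (fun=> setT) (leqnn n) (fun=> measurableT)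
  (fun _ _ => erefl) A mA.
rewrite big1 ?mulr1; last by move=> t _; exact: mesT.
move=> <-; congr (P _); apply/seteqP; split=> w /= [Aw h]; split=> // t tn.
  by split=> //; exact: h.
by have [] := h t tn.
Qed.

Lemma ge0_integral_path_law x n (F : ntype lam n -> \bar R) :
  measurable_fun setT F -> (forall y, 0 <= F y)%E ->
  (\int[P]_w (F (nobs lam n (Y ^~ w)) * (\1_(path_event x n) w)%:E) =
   \int[nmeas lam n]_y (F y * (path_weight x n * path_density x y)%:E))%E.
Proof.
move=> mF F0; pose g (w : Omega) : ntype lam n := nobs lam n (Y ^~ w).
have mg : measurable_fun setT g by exact: measurable_nobsY.
have mE := measurable_path_event x n.
have mI : measurable_fun setT (\1_(path_event x n) : Omega -> R).
  exact: measurable_indic.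
have I0 w : 0 <= \1_(path_event x n) w :> R by rewrite indicE ler0n.
pose mfg : {mfun Omega >-> ntype lam n} :=
  HB.pack g (isMeasurableFun.Build _ _ _ _ _ mg).
have mD : measurable_fun setT (fun y : ntype lam n => path_weight x n * path_density x y).
  by apply: measurable_funM => //; exact: measurable_path_density.
have D0 (y : ntype lam n) : 0 <= path_weight x n * path_density x y.
  by rewrite mulr_ge0 ?path_weight_ge0 ?path_density_ge0.
rewrite -(@ge0_integral_dmeasure _ _ _ P _ mI I0 (fun w => F (g w))); last 2 first.
- exact: measurableT_comp.
- by move=> w; exact: F0.
rewrite -(@ge0_integral_dmeasure _ _ _ (nmeas lam n) _ mD D0 F) //.
rewrite -[LHS](@ge0_integral_pushforward _ _ _ _ _ g mg (dmeasure P \1_(path_event x n)) setT F) //.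
apply: eq_measure_integral => A mA _.
have lhs : pushforward (dmeasure P \1_(path_event x n)) g A =
    P [set w | A (nobs lam n (Y ^~ w)) /\ path_event x n w].
  rewrite /pushforward dmeasureE // integral_indic // ?(setIC _ (g @^-1` A)) //.
  by rewrite -[X in measurable X]setTI; exact: (mg measurableT A mA).
have rhs := dmeasureE (nmeas lam n) mD D0 A.
by rewrite -path_law // in rhs; exact: (etrans lhs (esym rhs)).
Qed.

End joint_law.

(** * Forward recursion for the likelihood *)

Section forward.
Context (R : realType) (k : nat) (dd : measure_display) (T : measurableType dd).
Variables (Q : 'M[R]_k) (f : 'I_k -> T -> R) (m : 'I_k -> R).

(** The forward variables: [fwd n y j] is the joint density of the observations up to time n and of
    state j at time n. *)
Fixpoint fwd (n : nat) (y : nat -> T) : 'I_k -> R :=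
  if n is n'.+1 then fun j => (\sum_i fwd n' y i * Q i j) * f j (y n'.+1)
  else fun j => m j * f j (y 0%N).

Let term n (y : nat -> T) (x : {ffun 'I_n.+1 -> 'I_k}) :=
  m (x ord0) * \prod_(t < n) Q (x (inord t)) (x (inord t.+1))
             * \prod_(t < n.+1) f (x t) (y t).

(** The weight [G] of the final state strengthens the induction: summing out the last state turns
    [G] into another weight of the state before it. *)
Let sum_term n y (G : 'I_k -> R) :
  \sum_(x : {ffun 'I_n.+1 -> 'I_k}) term y x * G (x ord_max) =
  \sum_j fwd n y j * G j.
Proof.
elim: n G => [|n IH] G.
  rewrite (reindex (fun j : 'I_k => [ffun _ : 'I_1 => j])) /=.
    by apply: eq_bigr => j _; rewrite /term big_ord0 big_ord1 !ffunE mulr1.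
  exists (fun x => x ord0) => [j _|x _]; first by rewrite ffunE.
  by apply/ffunP => t; rewrite ffunE (ord1 t).
pose h (p : {ffun 'I_n.+1 -> 'I_k} * 'I_k) : {ffun 'I_n.+2 -> 'I_k} :=
  [ffun t : 'I_n.+2 => if (t < n.+1)%N then p.1 (inord t) else p.2].
have hlt p (t : 'I_n.+2) : (t < n.+1)%N -> h p t = p.1 (inord t).
  by move=> tn; rewrite ffunE tn.
have hmax p : h p ord_max = p.2 by rewrite ffunE /= ltnn.
rewrite (reindex h) /=; last first.
  exists (fun z => ([ffun t : 'I_n.+1 => z (inord t)], z ord_max)) => [[x j] _|z _].
    congr pair; last by rewrite hmax.
    apply/ffunP => t; have tn := ltn_ord t.
    have tn2 : (t < n.+2)%N by rewrite ltnW.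
    by rewrite ffunE hlt inordK // inord_val.
  apply/ffunP => t; rewrite ffunE /=; case: ifPn => [tn|].
    by rewrite ffunE inordK // inord_val.
  rewrite -leqNgt => nt; congr (z _); apply/val_inj => /=.
  by apply/eqP; rewrite eqn_leq nt -ltnS ltn_ord.
have termS p : term y (h p) =
    term y p.1 * (Q (p.1 ord_max) p.2 * f p.2 (y n.+1)).
  rewrite /term big_ord_recr [in LHS](big_ord_recr n.+1) /=.
  rewrite hmax (_ : inord n.+1 = ord_max); last first.
    by apply/val_inj; rewrite /= inordK.
  rewrite hmax (hlt p ord0) // (_ : inord (ord0 : 'I_n.+2) = ord0); last first.
    by apply/val_inj; rewrite /= inordK.
  rewrite (hlt p (inord n)) ?inordK ?ltnS // (_ : inord n = ord_max); last first.
    by apply/val_inj; rewrite /= inordK.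
  have -> : \prod_(i < n.+1) f (h p (widen_ord (leqnSn n.+1) i)) (y i) =
            \prod_(i < n.+1) f (p.1 i) (y i).
    apply: eq_bigr => t _; rewrite hlt /= ?ltn_ord //.
    by rewrite inord_val.
  have -> : \prod_(i < n) Q (h p (inord i)) (h p (inord i.+1)) =
            \prod_(i < n) Q (p.1 (inord i)) (p.1 (inord i.+1)).
    apply: eq_bigr => t _; have tn := ltn_ord t.
    have t1 : (t < n.+2)%N by rewrite (ltn_trans tn) // ltnW.
    have t2 : (t.+1 < n.+2)%N by rewrite ltnS ltnW.
    by rewrite !hlt !inordK // ltnW.
  ring.
pose G' i := \sum_j Q i j * f j (y n.+1) * G j.
transitivity (\sum_(x : {ffun 'I_n.+1 -> 'I_k}) term y x * G' (x ord_max)).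
  rewrite -(pair_bigA _ (fun x j => term y (h (x, j)) * G (h (x, j) ord_max))) /=.
  apply: eq_bigr => x _; rewrite /G' mulr_sumr; apply: eq_bigr => j _.
  by rewrite termS hmax /=; ring.
rewrite IH; under [LHS]eq_bigr do rewrite /G' mulr_sumr.
rewrite exchange_big /=; apply: eq_bigr => j _.
rewrite 2!mulr_suml; apply: eq_bigr => i _; ring.
Qed.

Lemma likS_fwd n y : likS Q f m n y = \sum_j fwd n y j.
Proof.
have := sum_term n y (fun=> 1).
under eq_bigr do rewrite mulr1; under [in RHS]eq_bigr do rewrite mulr1.
by move=> <-.
Qed.

Lemma likS_path n (y : nat -> T) : likS Q f m n y =
  \sum_(x : {ffun 'I_n.+1 -> 'I_k})
    path_weight Q m (fun t => x (inord t)) n *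
    \prod_(t < n.+1) f (x (inord t)) (y t).
Proof.
apply: eq_bigr => x _; rewrite /path_weight; congr (_ * _ * _).
  by congr (m (x _)); apply/val_inj; rewrite /= inordK.
by apply: eq_bigr => t _; rewrite inord_val.
Qed.

Lemma fwd_adapted n (y y' : nat -> T) :
  (forall t, (t <= n)%N -> y t = y' t) -> fwd n y = fwd n y'.
Proof.
elim: n y y' => [|n IH] y y' e; apply/funext => j /=; first by rewrite e.
by rewrite e // (IH y y') // => t tn; apply/e/leqW.
Qed.

Lemma fwd_ge0 n y j : (forall i j, 0 <= Q i j) -> (forall i, 0 <= m i) ->
  (forall i z, 0 <= f i z) -> 0 <= fwd n y j.
Proof.
move=> Q0 m0 f0; elim: n j => [|n IH] j /=; rewrite mulr_ge0 //.
by apply: sumr_ge0 => i _; rewrite mulr_ge0.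
Qed.

End forward.

Section observation_law.
Context (R : realType) (k : nat) (dd : measure_display) (T : measurableType dd).
Variable lam : {sigma_finite_measure set T -> \bar R}.
Variables (Q : 'M[R]_k) (f : 'I_k -> T -> R) (m : 'I_k -> R).
Hypotheses (hQ : is_transition Q) (hm : is_distribution m).
Hypothesis hf : forall i, is_density lam (f i).
Context (dO : measure_display) (Omega : measurableType dO).
Variables (P : probability Omega R) (X : nat -> Omega -> 'I_k).
Variable (Y : nat -> Omega -> T).
Hypothesis mX : forall t i, measurable [set w | X t w = i].
Hypothesis mY : forall t, measurable_fun setT (Y t).
Hypothesis hlaw : hmm_law lam Q f m P X Y.

Lemma sum_path_event n w :
  \sum_(x : {ffun 'I_n.+1 -> 'I_k})
     \1_(path_event X (fun t => x (inord t)) n) w = 1 :> R.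
Proof.
pose x0 : {ffun 'I_n.+1 -> 'I_k} := [ffun t : 'I_n.+1 => X t w].
rewrite (bigD1 x0) //= big1 ?addr0.
  rewrite indicE mem_set // => t tn /=.
  by rewrite /x0 ffunE inordK.
move=> x xx0; rewrite indicE memNset // => h.
move/eqP: xx0; apply; apply/ffunP => t; rewrite ffunE h ?inord_val //.
by rewrite -ltnS ltn_ord.
Qed.

(** The sample space is partitioned by the hidden path up to time n, and the path densities add up
    to the likelihood. *)
Lemma ge0_integral_obs_law n (F : ntype lam n -> \bar R) :
  measurable_fun setT F -> (forall y, 0 <= F y)%E ->
  (\int[P]_w F (nobs lam n (Y ^~ w)) =
   \int[nmeas lam n]_y (F y * (likS Q f m n (nacc y))%:E))%E.
Proof.
move=> mF F0.
have f0 i y : 0 <= f i y by have [] := hf i.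
transitivity (\int[P]_w (\sum_(x : {ffun 'I_n.+1 -> 'I_k})
    F (nobs lam n (Y ^~ w)) * (\1_(path_event X (fun t => x (inord t)) n) w)%:E)%E)%E.
  apply: eq_integral => w _; rewrite -ge0_sume_distrr //.
    by rewrite sumEFin sum_path_event mule1.
rewrite ge0_integral_sum //; last 2 first.
- move=> x; apply: emeasurable_funM.
    by apply: (measurableT_comp mF); exact: measurable_nobs.
  apply/measurable_EFinP; apply: measurable_indic.
  exact: measurable_path_event.
- by move=> x w _; rewrite mule_ge0.
under eq_bigr do rewrite (ge0_integral_path_law hQ hm hf mX mY hlaw) //.
rewrite -ge0_integral_sum //; last 2 first.
- move=> x; apply: emeasurable_funM => //; apply/measurable_EFinP.
  apply: measurable_funM => //; exact: (measurable_path_density hf).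
- move=> x y _; rewrite mule_ge0 // lee_fin mulr_ge0 //.
    exact: path_weight_ge0.
  exact: prodr_ge0.
apply: eq_integral => y _; rewrite -ge0_sume_distrr; last first.
  move=> x _; rewrite lee_fin mulr_ge0 //; first exact: path_weight_ge0.
  exact: prodr_ge0.
by rewrite sumEFin likS_path.
Qed.

End observation_law.

(** * Exponential tests *)

Section mass.
Context (R : realType) (k : nat) (dd : measure_display) (T : measurableType dd).
Variable lam : {sigma_finite_measure set T -> \bar R}.

Definition unit_fun (g : T -> R) :=
  measurable_fun setT g /\ forall z, 0 <= g z <= 1.

(** Defined on whole sequences, so that one statistic makes sense at every later horizon; the upper
    bound keeps its masses finite, which the subtractions in [mass_block] require. *)
Definition adapted n (F : (nat -> T) -> R) :=
  [/\ forall s, 0 <= F s, exists K, forall s, F s <= K,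
      forall s s', (forall t, (t <= n)%N -> s t = s' t) -> F s = F s' &
      measurable_fun setT (fun y : ntype lam n => F (nacc y))].

Lemma adaptedS n F : adapted n F -> adapted n.+1 F.
Proof.
move=> [F0 Fb Fa Fm]; split=> //.
  by move=> s s' e; apply: Fa => t tn; apply/e/leqW.
rewrite (_ : (fun y => _) = (fun y : ntype lam n => F (nacc y)) \o fst).
  by apply: (measurableT_comp Fm); exact: measurable_fst.
by apply/funext => y; apply: Fa => t /= ->.
Qed.

Lemma adapted_leq n n' F : (n <= n')%N -> adapted n F -> adapted n' F.
Proof.
move=> /subnK <-; elim: (n' - n)%N => // i IH /IH h.
by rewrite addSn; apply: adaptedS.
Qed.

Lemma adapted1 n : adapted n (fun=> 1%R).
Proof. by split=> //; exists 1. Qed.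

Lemma adaptedM n F G : adapted n F -> adapted n G ->
  adapted n (fun s => F s * G s).
Proof.
move=> [F0 [K FK] Fa Fm] [G0 [L GL] Ga Gm]; split.
- by move=> s; rewrite mulr_ge0.
- by exists (K * L) => s; rewrite ler_pM.
- by move=> s s' e; rewrite (Fa _ _ e) (Ga _ _ e).
- exact: measurable_funM.
Qed.

Lemma adapted_coord n t g : (t <= n)%N -> unit_fun g ->
  adapted n (fun s => g (s t)).
Proof.
move=> tn [mg g01]; split=> [s||s s' e|].
- by have /andP[] := g01 (s t).
- by exists 1 => s; have /andP[] := g01 (s t).
- by rewrite e.
- by apply: (measurableT_comp mg); exact: measurable_nacc.
Qed.

Definition block_factor (g1 g2 g3 : T -> R) (tau c : R) n (s : nat -> T) : R :=
  1 + tau * (g1 (s n.+1) * g2 (s n.+2) * g3 (s n.+3) - c).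

Lemma block_factor_itv g1 g2 g3 tau c n s :
  unit_fun g1 -> unit_fun g2 -> unit_fun g3 -> `|tau| * (1 + `|c|) <= 1 ->
  0 <= block_factor g1 g2 g3 tau c n s <= 2.
Proof.
move=> u1 u2 u3 tc.
have /andP[a b] := u1.2 (s n.+1); have /andP[a' b'] := u2.2 (s n.+2).
have /andP[a'' b''] := u3.2 (s n.+3).
rewrite /block_factor; set psi := (X in X - c).
have psi0 : 0 <= psi by rewrite !mulr_ge0.
have psi1 : psi <= 1 by rewrite !mulr_ile1 // mulr_ge0.
have : `|tau * (psi - c)| <= 1.
  rewrite normrM (le_trans _ tc) // ler_wpM2l // (le_trans (ler_normB _ _)) //.
  by rewrite lerD2r ger0_norm.
by rewrite ler_norml => /andP[]; lra.
Qed.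

Lemma adapted_block g1 g2 g3 tau c n :
  unit_fun g1 -> unit_fun g2 -> unit_fun g3 -> `|tau| * (1 + `|c|) <= 1 ->
  adapted n.+3 (block_factor g1 g2 g3 tau c n).
Proof.
move=> u1 u2 u3 tc; have itv s := block_factor_itv n s u1 u2 u3 tc.
have [_ _ pa pm] : adapted n.+3 (fun s => g1 (s n.+1) * g2 (s n.+2) * g3 (s n.+3)).
  by apply: adaptedM; [apply: adaptedM|]; apply: adapted_coord => //; rewrite ltnW.
split.
- by move=> s; have /andP[] := itv s.
- by exists 2 => s; have /andP[] := itv s.
- by move=> s s' e; rewrite /block_factor (pa _ _ e).
- rewrite /block_factor; apply: measurable_funD; first exact: measurable_cst.
  apply: measurable_funM; first exact: measurable_cst.
  by apply: measurable_funB; [exact: pm|exact: measurable_cst].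
Qed.

(** Block j covers the indices from [j * p.+3 + 1] to [j.+1 * p.+3], and index 0 belongs to no
    block. The first p observations of a block are skipped; the three that count begin p.+1
    transitions after the end of the previous block. *)
Definition test_stat (g1 g2 g3 : T -> R) (tau c : R) p J (s : nat -> T) : R :=
  \prod_(j < J) block_factor g1 g2 g3 tau c (j * p.+3 + p) s.

Lemma adapted_test_stat g1 g2 g3 tau c p J :
  unit_fun g1 -> unit_fun g2 -> unit_fun g3 -> `|tau| * (1 + `|c|) <= 1 ->
  adapted (J * p.+3) (test_stat g1 g2 g3 tau c p J).
Proof.
move=> u1 u2 u3 tc; rewrite /test_stat; elim: J => [|J IH].
  by under eq_fun do rewrite big_ord0; exact: adapted1.
under eq_fun do rewrite big_ord_recr /=; apply: adaptedM.
  by apply: adapted_leq IH; rewrite leq_mul2r leqnSn orbT.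
by rewrite mulSnr !addnS; exact: adapted_block.
Qed.

Variables (Q : 'M[R]_k) (f : 'I_k -> T -> R) (m : 'I_k -> R).
Hypotheses (hQ : is_transition Q) (hm : is_distribution m).
Hypothesis hf : forall i, is_density lam (f i).

Let mf i : measurable_fun setT (f i). Proof. by have [] := hf i. Qed.
Let f0 i y : 0 <= f i y. Proof. by have [] := hf i. Qed.
Let Q0 i j : 0 <= Q i j. Proof. by have [] := hQ i. Qed.
Let m0 i : 0 <= m i. Proof. by have [] := hm. Qed.

Lemma measurable_fwd n n' j :
  measurable_fun setT (fun y : ntype lam n' => fwd Q f m n (nacc y) j).
Proof.
elim: n j => [|n IH] j /=.
  apply: measurable_funM => //; apply: (measurableT_comp (mf j)).
  exact: measurable_nacc.
apply: measurable_funM; last first.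
  by apply: (measurableT_comp (mf j)); exact: measurable_nacc.
by apply: measurable_sum => i; apply: measurable_funM.
Qed.

Lemma measurable_likS n n' :
  measurable_fun setT (fun y : ntype lam n' => likS Q f m n (nacc y)).
Proof.
under eq_fun do rewrite likS_fwd.
by apply: measurable_sum => j; exact: measurable_fwd.
Qed.

Lemma likS_ge0 n y : 0 <= likS Q f m n y.
Proof. by rewrite likS_fwd; apply: sumr_ge0 => j _; exact: fwd_ge0. Qed.

(** The mean, under the parameter [(Q, f)] and initial law [m], of [F] of the observations times [G]
    of the hidden state at time n. *)
Definition mass n (F : (nat -> T) -> R) (G : 'I_k -> R) : \bar R :=
  (\int[nmeas lam n]_y (F (nacc y) * \sum_j fwd Q f m n (nacc y) j * G j)%:E)%E.

Definition omean (g : T -> R) : 'I_k -> R :=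
  fun j => fine (\int[lam]_z (g z * f j z)%:E)%E.

Lemma omeanE g j : unit_fun g ->
  (\int[lam]_z (g z * f j z)%:E)%E = (omean g j)%:E /\ 0 <= omean g j <= 1.
Proof.
move=> [mg g01].
have g0 z : 0 <= g z * f j z by rewrite mulr_ge0 //; have /andP[] := g01 z.
have i0 : (0 <= \int[lam]_z (g z * f j z)%:E)%E.
  by apply: integral_ge0 => z _; rewrite lee_fin.
have i1 : (\int[lam]_z (g z * f j z)%:E <= 1)%E.
  have [_ _ <-] := hf j; apply: ge0_le_integral => //.
  - by move=> z _; rewrite lee_fin.
  - by apply/measurable_EFinP; exact: measurable_funM.
  - exact/measurable_EFinP.
  - by move=> z _; rewrite lee_fin ler_piMl //; have /andP[] := g01 z.
have fn : (\int[lam]_z (g z * f j z)%:E)%E \is a fin_num.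
  by rewrite ge0_fin_numE // (le_lt_trans i1) // ltry.
rewrite /omean fineK //; split=> //.
by rewrite -!lee_fin fineK // i0.
Qed.

(** Integrating out the last observation multiplies the weight by the emission mean of [g]; summing
    out the last state then applies [Q]. *)
Lemma mass_step n F g G : adapted n F -> unit_fun g -> (forall j, 0 <= G j) ->
  mass n.+1 (fun s => F s * g (s n.+1)) G =
  mass n F (mxapp Q (fun j => omean g j * G j)).
Proof.
move=> [F0 _ Fa Fm] ug G0; have [mg g01] := ug.
have g0 z : 0 <= g z by have /andP[] := g01 z.
pose H j (y : ntype lam n) := F (nacc y) * \sum_i fwd Q f m n (nacc y) i * Q i j.
have mH j : measurable_fun setT (H j).
  apply: measurable_funM => //; apply: measurable_sum => i.
  by apply: measurable_funM => //; exact: measurable_fwd.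
have H0 j y : 0 <= H j y.
  rewrite mulr_ge0 //; apply: sumr_ge0 => i _; rewrite mulr_ge0 //.
  exact: fwd_ge0.
transitivity (\sum_j \int[nmeas lam n.+1]_y
   ((H j y.1)%:E * (G j * (g y.2 * f j y.2))%:E))%E.
  rewrite -ge0_integral_sum //; last 2 first.
  - move=> j; apply: emeasurable_funM; apply/measurable_EFinP.
      by apply: (measurableT_comp (mH j)); exact: measurable_fst.
    apply: measurable_funM => //.
    apply: (@measurableT_comp _ _ _ _ _ _ (fun z => g z * f j z)).
      exact: measurable_funM.
    exact: measurable_snd.
  - move=> j y _; apply: mule_ge0; first by rewrite lee_fin; exact: H0.
    by rewrite lee_fin !mulr_ge0.
  apply: eq_integral => y _; under [RHS]eq_bigr do rewrite -EFinM.
  rewrite sumEFin; congr _%:E.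
  rewrite (_ : nacc y n.+1 = y.2); last by rewrite /= ltnn.
  rewrite mulr_sumr; apply: eq_bigr => j _ /=.
  rewrite (Fa (nacc y) (nacc y.1)); last by move=> t /= ->.
  rewrite (fwd_adapted _ _ _ (y' := nacc y.1)); last by move=> t /= ->.
  by rewrite ltnn /H; ring.
transitivity (\sum_j \int[nmeas lam n]_y (H j y * (omean g j * G j))%:E)%E.
  apply: eq_bigr => j _.
  rewrite (@ge0_integral_nmeasSM _ _ _ lam n (fun y => (H j y)%:E)
     (fun z => (G j * (g z * f j z))%:E)); last 4 first.
  - exact/measurable_EFinP.
  - by move=> y; rewrite lee_fin.
  - by apply/measurable_EFinP; do 2 apply: measurable_funM => //.
  - by move=> z; rewrite lee_fin !mulr_ge0.
  under [X in (_ * X)%E]eq_integral do rewrite EFinM.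
  rewrite [X in (_ * X)%E]ge0_integralZl //; last 3 first.
  - by apply/measurable_EFinP; apply: measurable_funM.
  - by move=> z _; rewrite lee_fin mulr_ge0.
  - by rewrite lee_fin.
  have [omE /andP[ge0 _]] := omeanE j ug.
  rewrite omE -EFinM [in RHS](eq_integral (fun y => (H j y)%:E * (omean g j * G j)%:E)%E) //.
  rewrite ge0_integralZr //.
  - by rewrite mulrC.
  - exact/measurable_EFinP.
  - by move=> y _; rewrite lee_fin.
  - by rewrite lee_fin mulr_ge0.
rewrite -ge0_integral_sum //; last 2 first.
- by move=> j; apply/measurable_EFinP; apply: measurable_funM.
- move=> j y _; rewrite lee_fin mulr_ge0 // mulr_ge0 //.
  by have [_ /andP[]] := omeanE j ug.
apply: eq_integral => y _; rewrite sumEFin; congr _%:E; rewrite /H /mxapp.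
under eq_bigr do rewrite -mulrA; rewrite -mulr_sumr; congr (_ * _).
under eq_bigr do rewrite mulr_suml.
rewrite exchange_big /=; apply: eq_bigr => i _; rewrite mulr_sumr.
by apply: eq_bigr => j _; ring.
Qed.

Lemma mxapp_ge0 G : (forall j, 0 <= G j) -> forall i, 0 <= mxapp Q G i.
Proof. by move=> G0 i; apply: sumr_ge0 => j _; rewrite mulr_ge0. Qed.

Lemma mxapp1 : mxapp Q (fun=> 1%R) = fun=> 1.
Proof.
apply/funext => i; rewrite /mxapp; under eq_bigr do rewrite mulr1.
by have [] := hQ i.
Qed.

Lemma unit_fun1 : unit_fun (fun=> 1%R).
Proof. by split=> [|z]; [exact: measurable_cst|rewrite ler01 lexx]. Qed.

Lemma omean1 j : omean (fun=> 1%R) j = 1.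
Proof.
rewrite /omean; under eq_integral do rewrite mul1r.
by have [_ _ ->] := hf j.
Qed.

Lemma mass_skip n F G : adapted n F -> (forall j, 0 <= G j) ->
  mass n.+1 F G = mass n F (mxapp Q G).
Proof.
move=> aF G0; transitivity (mass n.+1 (fun s => F s * 1) G).
  by apply: eq_integral => y _; rewrite mulr1.
rewrite (mass_step aF unit_fun1 G0); congr (mass n F (mxapp Q _)).
by apply/funext => j; rewrite omean1 mul1r.
Qed.

Lemma mass_skipn n p F G : adapted n F -> (forall j, 0 <= G j) ->
  mass (n + p) F G = mass n F (iter p (mxapp Q) G).
Proof.
move=> aF; elim: p G => [|p IH] G G0; first by rewrite addn0.
rewrite addnS mass_skip //; last exact: (adapted_leq (leq_addr _ _)).
by rewrite IH ?iterSr //; exact: mxapp_ge0.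
Qed.

Lemma mass01 : mass 0 (fun=> 1%R) (fun=> 1%R) = 1%E.
Proof.
rewrite /mass.
under eq_integral do rewrite mul1r -sumEFin.
rewrite ge0_integral_sum //; last 2 first.
- move=> j; apply/measurable_EFinP; apply: measurable_funM => //.
  exact: measurable_fwd.
- by move=> j y _; rewrite lee_fin mulr1 fwd_ge0.
transitivity (\sum_j (m j)%:E)%E; last first.
  by rewrite sumEFin; have [_ ->] := hm.
apply: eq_bigr => j _ /=; under eq_integral do rewrite mulr1 EFinM.
rewrite ge0_integralZl //.
- by have [_ _ ->] := hf j; rewrite mule1.
- exact/measurable_EFinP.
- by move=> z _; rewrite lee_fin.
- by rewrite lee_fin.
Qed.

Lemma iter_mxapp1 p : iter p (mxapp Q) (fun=> 1%R) = fun=> 1.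
Proof. by elim: p => //= p ->; exact: mxapp1. Qed.

Lemma mass1 n : mass n (fun=> 1%R) (fun=> 1%R) = 1%E.
Proof.
have := @mass_skipn 0 n (fun=> 1%R) (fun=> 1%R) (adapted1 0) (fun=> ler01).
by rewrite add0n iter_mxapp1 mass01.
Qed.

Lemma mass_likS n F : mass n F (fun=> 1%R) =
  (\int[nmeas lam n]_y (F (nacc y) * likS Q f m n (nacc y))%:E)%E.
Proof.
apply: eq_integral => y _; rewrite likS_fwd.
by under eq_bigr do rewrite mulr1.
Qed.

Lemma measurable_massfun n F G : adapted n F ->
  measurable_fun setT (fun y : ntype lam n =>
    (F (nacc y) * \sum_j fwd Q f m n (nacc y) j * G j)%:E).
Proof.
move=> [_ _ _ Fm]; apply/measurable_EFinP; apply: measurable_funM => //.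
by apply: measurable_sum => j; apply: measurable_funM => //; exact: measurable_fwd.
Qed.

Lemma massfun_ge0 n F G (y : ntype lam n) : adapted n F -> (forall j, 0 <= G j) ->
  0 <= F (nacc y) * \sum_j fwd Q f m n (nacc y) j * G j.
Proof.
move=> [F0 _ _ _] G0; rewrite mulr_ge0 //; apply: sumr_ge0 => j _.
by rewrite mulr_ge0 // fwd_ge0.
Qed.

Lemma mass_fin n F : adapted n F -> mass n F (fun=> 1%R) \is a fin_num.
Proof.
move=> aF; have [F0 [K FK] _ _] := aF.
have M0 : (0 <= mass n F (fun=> 1%R))%E.
  by apply: integral_ge0 => y _; rewrite lee_fin massfun_ge0.
have K0 : 0 <= Num.max K 0 by rewrite le_max lexx orbT.
rewrite ge0_fin_numE // (@le_lt_trans _ _ ((Num.max K 0)%:E * mass n (fun=> 1%R) (fun=> 1%R))%E) //.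
  rewrite -ge0_integralZl //; last 2 first.
  - exact: (measurable_massfun _ (adapted1 n)).
  - by move=> y _; rewrite lee_fin; apply: (@massfun_ge0 n (fun=> 1%R) _ y (adapted1 n)).
  apply: ge0_le_integral => //.
  - by move=> y _; rewrite lee_fin massfun_ge0.
  - exact: measurable_massfun.
  - apply: emeasurable_funM; first exact: measurable_cst.
    exact: (measurable_massfun _ (adapted1 n)).
  - move=> y _; rewrite lee_fin mul1r ler_wpM2r //.
      by apply: sumr_ge0 => j _; rewrite mulr1 fwd_ge0.
    by rewrite le_max FK.
by rewrite mass1 mule1 ltry.
Qed.

(* Integrating out a block of length [p + 3] whose last three coordinates carry
   the factor [1 + tau (g1 g2 g3 - c)] acts as a matrix on the hidden state. *)
Lemma mass_block n p F (g1 g2 g3 : T -> R) (tau c rho : R) :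
  adapted n F -> unit_fun g1 -> unit_fun g2 -> unit_fun g3 ->
  `|tau| * (1 + `|c|) <= 1 -> 0 <= rho ->
  (forall i, 1 + tau * (iter p.+1 (mxapp Q)
     (window Q (omean g1) (omean g2) (omean g3)) i - c) <= rho) ->
  (mass (n + p).+3 (fun s => F s * block_factor g1 g2 g3 tau c (n + p) s)%R (fun=> 1%R)
   <= rho%:E * mass n F (fun=> 1%R))%E.
Proof.
move=> aF u1 u2 u3 tc rho_ge0 hrho.
set psi := fun s : nat -> T => g1 (s (n + p).+1) * g2 (s (n + p).+2) * g3 (s (n + p).+3).
set h := block_factor g1 g2 g3 tau c (n + p).
have aF' : adapted (n + p) F by exact: (adapted_leq (leq_addr _ _)).
have aF3 : adapted (n + p).+3 F by do 3 apply: adaptedS.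
have apsi : adapted (n + p).+3 psi.
  by apply: adaptedM; [apply: adaptedM|]; apply: adapted_coord => //; rewrite ltnW.
have ah : adapted (n + p).+3 h by exact: adapted_block.
pose v := iter p.+1 (mxapp Q) (window Q (omean g1) (omean g2) (omean g3)).
have o0 g : unit_fun g -> forall j, 0 <= omean g j.
  by move=> ug j; have [_ /andP[]] := omeanE j ug.
have w0 j : 0 <= window Q (omean g1) (omean g2) (omean g3) j.
  rewrite mulr_ge0 ?o0 //; apply: mxapp_ge0 => i.
  by rewrite mulr_ge0 ?o0 //; apply: mxapp_ge0; apply: o0.
have massF : mass (n + p).+3 F (fun=> 1%R) = mass n F (fun=> 1%R).
  by rewrite -!addnS mass_skipn // iter_mxapp1.
have masspsi : mass (n + p).+3 (fun s => F s * psi s) (fun=> 1%R) = mass n F v.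
  transitivity (mass (n + p).+3 (fun s => (F s * g1 (s (n + p).+1) * g2 (s (n + p).+2))
     * g3 (s (n + p).+3)) (fun=> 1%R)).
    by apply: eq_integral => y _; rewrite /psi !mulrA.
  have a1 : adapted (n + p).+1 (fun s => F s * g1 (s (n + p).+1)).
    by apply: adaptedM; [exact: adaptedS|exact: adapted_coord].
  have a2 : adapted (n + p).+2 (fun s => F s * g1 (s (n + p).+1) * g2 (s (n + p).+2)).
    by apply: adaptedM; [exact: adaptedS|exact: adapted_coord].
  rewrite mass_step // mass_step //; last first.
    by apply: mxapp_ge0 => j; rewrite mulr_ge0 ?o0.
  rewrite mass_step //; last first.
    apply: mxapp_ge0 => j; rewrite mulr_ge0 ?o0 //.
    by apply: mxapp_ge0 => i; rewrite mulr_ge0 ?o0.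
  have -> : (fun j => omean g3 j * 1) = omean g3 by apply/funext => j; rewrite mulr1.
  rewrite -/(window Q (omean g1) (omean g2) (omean g3)).
  rewrite mass_skipn //; last by exact: mxapp_ge0.
  by rewrite -iterSr.
(* Masses are integrals of nonnegative functions, so [tau] is split into its positive and negative
   parts and negative terms are moved to the other side. *)
pose tp := Num.max tau 0; pose tm := Num.max (- tau) 0.
have tp0 : 0 <= tp by rewrite le_max lexx orbT.
have tm0 : 0 <= tm by rewrite le_max lexx orbT.
have tE : tau = tp - tm.
  have [t0|t0] := leP 0 tau.
    by rewrite /tp /tm (max_l t0) max_r ?oppr_le0 // subr0.
  by rewrite /tp /tm (max_r (ltW t0)) max_l ?oppr_ge0 ?(ltW t0) // sub0r opprK.
have ctau : 0 <= 1 - tau * c.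
  have : `|tau * c| <= 1.
    by rewrite normrM (le_trans _ tc) // ler_wpM2l // lerDr.
  by rewrite ler_norml => /andP[]; lra.
have v0 j : 0 <= v j.
  rewrite /v; elim: (p.+1) j => [|r IH] j //=; exact: mxapp_ge0.
have massv_fin : mass n F v \is a fin_num.
  by rewrite -masspsi; apply: mass_fin; exact: (adaptedM aF3 apsi).
have massF_fin : mass n F (fun=> 1%R) \is a fin_num by exact: mass_fin.
have massh_fin : mass (n + p).+3 (fun s => F s * h s) (fun=> 1%R) \is a fin_num.
  by apply: mass_fin; exact: (adaptedM aF3 ah).
have lin n' F1 F2 a b G : adapted n' F1 -> adapted n' F2 -> 0 <= a -> 0 <= b ->
    (forall j, 0 <= G j) ->
    mass n' (fun s => a * F1 s + b * F2 s) G =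
    (a%:E * mass n' F1 G + b%:E * mass n' F2 G)%E.
  move=> a1 a2 ha hb G0.
  rewrite -!ge0_integralZl //; try exact: measurable_massfun;
    try by move=> y _; rewrite lee_fin massfun_ge0.
  rewrite -ge0_integralD //.
  - by apply: eq_integral => y _; rewrite -!EFinM -EFinD; congr _%:E; ring.
  - by move=> y _; rewrite -EFinM lee_fin mulr_ge0 // massfun_ge0.
  - by apply: emeasurable_funM; [exact: measurable_cst|exact: measurable_massfun].
  - by move=> y _; rewrite -EFinM lee_fin mulr_ge0 // massfun_ge0.
  - by apply: emeasurable_funM; [exact: measurable_cst|exact: measurable_massfun].
have id1 : (mass (n + p).+3 (fun s => F s * h s)%R (fun=> 1%R) + tm%:E * mass n F v =
    (1 - tau * c)%:E * mass n F (fun=> 1%R) + tp%:E * mass n F v)%E.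
  rewrite -masspsi -massF -(lin _ _ _ _ _ _ aF3 (adaptedM aF3 apsi) ctau tp0 (fun=> ler01)).
  rewrite -[X in (X + _)%E]mul1e.
  rewrite -(lin _ _ _ _ _ _ (adaptedM aF3 ah) (adaptedM aF3 apsi) ler01 tm0 (fun=> ler01)).
  apply: eq_integral => y _; congr _%:E; congr (_ * _).
  by rewrite /h /block_factor -/(psi (nacc y)) tE; ring.
have rho0 i : (1 - tau * c) + tau * v i <= rho.
  by have := hrho i; rewrite -/v; lra.
have le1 : ((1 - tau * c)%:E * mass n F (fun=> 1%R) + tp%:E * mass n F v <=
    rho%:E * mass n F (fun=> 1%R) + tm%:E * mass n F v)%E.
  have mm (a : R) G : measurable_fun setT (fun y : ntype lam n =>
      (a%:E * (F (nacc y) * \sum_j fwd Q f m n (nacc y) j * G j)%:E)%E).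
    by apply: emeasurable_funM; [exact: measurable_cst|exact: measurable_massfun].
  have m_ge0 (a : R) G (y : ntype lam n) : 0 <= a -> (forall j, 0 <= G j) ->
      (0 <= a%:E * (F (nacc y) * \sum_j fwd Q f m n (nacc y) j * G j)%:E)%E.
    by move=> a0 G0; rewrite -EFinM lee_fin mulr_ge0 // massfun_ge0.
  rewrite -!ge0_integralZl //; try exact: measurable_massfun;
    try by move=> y _; rewrite lee_fin massfun_ge0.
  rewrite -!ge0_integralD //; try by move=> y _; exact: m_ge0.
  apply: ge0_le_integral => //.
  - by move=> y _; rewrite adde_ge0 // m_ge0.
  - exact: emeasurable_funD.
  - exact: emeasurable_funD.
  - move=> y _; rewrite -!EFinM -!EFinD lee_fin.
    rewrite ![_ * (F _ * _)]mulrCA -!mulrDr ler_wpM2l //; first by case: aF.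
    rewrite !mulr_sumr -!big_split /=; apply: ler_sum => j _.
    have := fwd_ge0 n (nacc y) j Q0 m0 f0; set a := fwd _ _ _ _ _ _ => a0.
    suff : 0 <= a * (rho + tm * v j - (1 - tau * c) - tp * v j) by lra.
    by rewrite mulr_ge0 //; have := rho0 j; rewrite tE; lra.
by rewrite -id1 leeD2rE // in le1; rewrite fin_numM.
Qed.

Lemma mass_test_stat p (g1 g2 g3 : T -> R) (tau c rho : R) J :
  unit_fun g1 -> unit_fun g2 -> unit_fun g3 ->
  `|tau| * (1 + `|c|) <= 1 -> 0 <= rho ->
  (forall i, 1 + tau * (iter p.+1 (mxapp Q)
     (window Q (omean g1) (omean g2) (omean g3)) i - c) <= rho) ->
  (mass (J * p.+3) (test_stat g1 g2 g3 tau c p J) (fun=> 1%R) <= (rho ^+ J)%:E)%E.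
Proof.
move=> u1 u2 u3 tc rho0 hrho; elim: J => [|J IH].
  rewrite mul0n expr0 -[leRHS]mass01 /mass le_eqVlt; apply/predU1P; left.
  apply: eq_integral => y _.
  by rewrite /test_stat big_ord0.
have aJ := adapted_test_stat p J u1 u2 u3 tc.
have rhoE : (0 <= rho%:E)%E by rewrite lee_fin.
rewrite exprS EFinM.
apply: (@le_trans _ _ (rho%:E * mass (J * p.+3) (test_stat g1 g2 g3 tau c p J) (fun=> 1%R))%E);
  last exact: lee_wpmul2l.
have := mass_block aJ u1 u2 u3 tc rho0 hrho.
apply: le_trans; rewrite mulSnr !addnS le_eqVlt; apply/predU1P; left.
by apply: eq_integral => y _; rewrite /test_stat big_ord_recr.
Qed.

(** Each complete block costs a factor [rho]; the observations of the incomplete one integrate to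
    1. *)
Lemma test_stat_bound p (g1 g2 g3 : T -> R) (tau c rho : R) n :
  unit_fun g1 -> unit_fun g2 -> unit_fun g3 ->
  `|tau| * (1 + `|c|) <= 1 -> 0 <= rho ->
  (forall i, 1 + tau * (iter p.+1 (mxapp Q)
     (window Q (omean g1) (omean g2) (omean g3)) i - c) <= rho) ->
  (\int[nmeas lam n]_y (test_stat g1 g2 g3 tau c p (n %/ p.+3) (nacc y)
     * likS Q f m n (nacc y))%:E <= (rho ^+ (n %/ p.+3))%:E)%E.
Proof.
move=> u1 u2 u3 tc rho0 hrho.
apply: le_trans (mass_test_stat (n %/ p.+3) u1 u2 u3 tc rho0 hrho).
have aJ := adapted_test_stat p (n %/ p.+3) u1 u2 u3 tc.
rewrite -mass_likS le_eqVlt; apply/predU1P; left.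
by rewrite {1}(divn_eq n p.+3) mass_skipn // iter_mxapp1.
Qed.

End mass.

(** * Growth of additive functionals of the observations *)

(** A geometric sum stopped at the last power of two below [h]; the induction also carries the bound
    [2 ^+ K] on the partial sum. *)
Lemma dyadic_tail_sum (R : realType) (h : R) K : 0 <= h ->
  \sum_(k < K) (2 ^+ k *+ (2 ^+ k < h)%R) <= 2 * h.
Proof.
move=> h0; suff [] : \sum_(k < K) (2 ^+ k *+ (2 ^+ k < h)%R) <= 2 * h /\
    \sum_(k < K) (2 ^+ k *+ (2 ^+ k < h)%R) <= 2 ^+ K :> R by [].
elim: K => [|K [IH1 IH2]].
  by rewrite big_ord0 expr0; split=> //; rewrite mulr_ge0.
rewrite big_ord_recr /= exprS.
have P0 : 0 <= 2 ^+ K :> R by rewrite exprn_ge0.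
have [Kh|Kh] := ltP (2 ^+ K) h; rewrite ?mulr1n ?mulr0n; split; lra.
Qed.

(** A geometric tail that starts at the first power of two above [h]. The invariant is that the sum
    is 0 before that index, and that afterwards the sum together with its whole remaining tail is at
    most [2 * h]. *)
Lemma dyadic_head_sum (R : realType) (h : R) K : 0 <= h ->
  \sum_(k < K) (h ^+ 2 / 2 ^+ k *+ (h <= 2 ^+ k)%R) <= 2 * h.
Proof.
move=> h0; suff H : if h <= 2 ^+ K
    then \sum_(k < K) (h ^+ 2 / 2 ^+ k *+ (h <= 2 ^+ k)%R) + 2 * (h ^+ 2 / 2 ^+ K) <= 2 * h
    else \sum_(k < K) (h ^+ 2 / 2 ^+ k *+ (h <= 2 ^+ k)%R) == 0.
  move: H; case: ifP => _; last by move/eqP ->; rewrite mulr_ge0.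
  by apply: le_trans; rewrite lerDl mulr_ge0 // divr_ge0 ?sqr_ge0 ?exprn_ge0.
elim: K => [|K IH].
  rewrite big_ord0 expr0 divr1; case: ifP => // h1; rewrite add0r ler_pM2l //.
  by rewrite expr2 ler_piMr.
rewrite big_ord_recr /=; have P0 : 0 < 2 ^+ K :> R by rewrite exprn_gt0.
have e2 : 2 * (h ^+ 2 / 2 ^+ K.+1) = h ^+ 2 / 2 ^+ K.
  rewrite [2 ^+ K.+1]exprS; move: P0; set a := 2 ^+ K => a0.
  by field; rewrite gt_eqF.
move: IH; have [hK|hK] := leP h (2 ^+ K).
  have -> : h <= 2 ^+ K.+1 by rewrite exprS; lra.
  by rewrite mulr1n e2; lra.
move/eqP ->; rewrite mulr0n addr0; case: ifP => // hK1.
rewrite e2 add0r ler_pdivrMr // expr2; move: hK1; rewrite exprS => hK1.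
have := ler_wpM2r h0 hK1; lra.
Qed.

(** * Moments of the observations given the hidden path *)

Section path_moments.
Context (R : realType) (k : nat) (dd : measure_display) (T : measurableType dd).
Variable lam : {sigma_finite_measure set T -> \bar R}.
Variable f : 'I_k -> T -> R.
Hypothesis hf : forall i, is_density lam (f i).
Variables (x : nat -> 'I_k) (n : nat).

Let mf i : measurable_fun setT (f i). Proof. by have [] := hf i. Qed.
Let f0 i y : 0 <= f i y. Proof. by have [] := hf i. Qed.

(** The conditional mean given the hidden path [x], under which the observations are independent
    with densities [f (x t)]. *)
Let I (phi : ntype lam n -> R) : \bar R :=
  (\int[nmeas lam n]_y (phi y * path_density f x y)%:E)%E.

Lemma path_mean_prod (u : nat -> T -> R) :
  (forall t, measurable_fun setT (u t)) -> (forall t z, 0 <= u t z) ->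
  I (fun y => \prod_(t < n.+1) u t (nacc y t)) =
  (\prod_(t < n.+1) \int[lam]_z (u t z * f (x t) z)%:E)%E.
Proof.
move=> mu u0.
rewrite -(@integral_prod_nacc _ _ _ lam n (fun t z => u t z * f (x t) z)).
- by apply: eq_integral => y _; rewrite /path_density -big_split.
- by move=> t; apply: measurable_funM; [exact: mu|exact: mf].
- by move=> t z; rewrite mulr_ge0.
Qed.

Lemma path_mean_pair (s t : 'I_n.+1) (u v : T -> R) : s != t ->
  measurable_fun setT u -> (forall z, 0 <= u z) ->
  measurable_fun setT v -> (forall z, 0 <= v z) ->
  I (fun y => u (nacc y s) * v (nacc y t)) =
  (\int[lam]_z (u z * f (x s) z)%:E * \int[lam]_z (v z * f (x t) z)%:E)%E.
Proof.
move=> st mu u0 mv v0.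
pose w (r : nat) : T -> R := if r == s then u else if r == t then v else fun=> 1.
have ne (r : 'I_n.+1) : r != s -> r != t -> w r = fun=> 1.
  move=> h1 h2; rewrite /w; case: eqP => [e|_].
    by move: h1; rewrite -val_eqE /= e eqxx.
  by case: eqP => [e|//]; move: h2; rewrite -val_eqE /= e eqxx.
have ws : w s = u by rewrite /w eqxx.
have wt : w t = v.
  rewrite /w eqxx; case: eqP => // e.
  by move: st; rewrite -val_eqE /= e eqxx.
have hw := @path_mean_prod w.
have -> : (fun y : ntype lam n => u (nacc y s) * v (nacc y t)) =
    fun y => \prod_(r < n.+1) w r (nacc y r).
  apply/funext => y; rewrite (bigD1 s) //= (bigD1 t) /=; last by rewrite eq_sym.
  rewrite ws wt big1 ?mulr1 // => r /andP[r1 r2]; by rewrite ne.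
rewrite hw; last 2 first.
- by move=> r; rewrite /w; case: eqP => // _; case: eqP.
- by move=> r z; rewrite /w; case: eqP => // _; case: eqP => // _; exact: ler01.
rewrite (bigD1 s) //= (bigD1 t) /=; last by rewrite eq_sym.
rewrite ws wt big1 ?mule1 // => r /andP[r1 r2]; rewrite ne //.
under eq_integral do rewrite mul1r.
by have [_ _ ->] := hf (x r).
Qed.

Lemma path_mean (t : 'I_n.+1) (u : T -> R) :
  measurable_fun setT u -> (forall z, 0 <= u z) ->
  I (fun y => u (nacc y t)) = (\int[lam]_z (u z * f (x t) z)%:E)%E.
Proof.
move=> mu u0; pose w (r : nat) : T -> R := if r == t then u else fun=> 1.
have ne (r : 'I_n.+1) : r != t -> w r = fun=> 1.
  move=> h1; rewrite /w; case: eqP => [e|//].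
  by move: h1; rewrite -val_eqE /= e eqxx.
have wt : w t = u by rewrite /w eqxx.
have hw := @path_mean_prod w.
have -> : (fun y : ntype lam n => u (nacc y t)) =
    fun y => \prod_(r < n.+1) w r (nacc y r).
  apply/funext => y; rewrite (bigD1 t) //= wt big1 ?mulr1 // => r r1.
  by rewrite ne.
rewrite hw; last 2 first.
- by move=> r; rewrite /w; case: eqP.
- by move=> r z; rewrite /w; case: eqP => // _; exact: ler01.
rewrite (bigD1 t) //= wt big1 ?mule1 // => r r1; rewrite ne //.
under eq_integral do rewrite mul1r.
by have [_ _ ->] := hf (x r).
Qed.

Lemma path_mass : I (fun=> 1) = 1%E.
Proof.
have h := @path_mean ord0 (fun=> 1) (measurable_cst _) (fun=> ler01).
rewrite [LHS]h; under eq_integral do rewrite mul1r.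
by have [_ _ ->] := hf (x 0%N).
Qed.

Variables (Z : T -> R) (B : R).
Hypotheses (mZ : measurable_fun setT Z) (Z0 : forall z, 0 <= Z z <= B).

Definition state_mean (u : T -> R) i : R := fine (\int[lam]_z (u z * f i z)%:E)%E.

Lemma state_meanE (u : T -> R) C i : measurable_fun setT u ->
  (forall z, 0 <= u z <= C) ->
  (\int[lam]_z (u z * f i z)%:E)%E = (state_mean u i)%:E /\ 0 <= state_mean u i.
Proof.
move=> mu u0.
have g0 z : 0 <= u z * f i z by rewrite mulr_ge0 //; have /andP[] := u0 z.
have i0 : (0 <= \int[lam]_z (u z * f i z)%:E)%E.
  by apply: integral_ge0 => z _; rewrite lee_fin.
have C0 : 0 <= `|C| by [].
have i1 : (\int[lam]_z (u z * f i z)%:E <= `|C|%:E)%E.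
  rewrite -[leRHS]mule1; have [_ _ <-] := hf i; rewrite -ge0_integralZl //; last 2 first.
  - exact/measurable_EFinP.
  - by move=> z _; rewrite lee_fin.
  apply: ge0_le_integral => //.
  - by move=> z _; rewrite lee_fin.
  - by apply/measurable_EFinP; apply: measurable_funM.
  - by apply: emeasurable_funM; [exact: measurable_cst|exact/measurable_EFinP].
  - move=> z _; rewrite -EFinM lee_fin ler_wpM2r //; have /andP[_ h] := u0 z.
    exact: (le_trans h (ler_norm _)).
have fn : (\int[lam]_z (u z * f i z)%:E)%E \is a fin_num.
  by rewrite ge0_fin_numE // (le_lt_trans i1) // ltry.
by rewrite /state_mean fineK //; split=> //; exact: fine_ge0.
Qed.

Let a i := state_mean Z i.
Let b i := state_mean (fun z => Z z ^+ 2) i.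

Let mD : measurable_fun setT (fun y : ntype lam n => path_density f x y).
Proof. exact: (measurable_path_density hf). Qed.

Let D0 (y : ntype lam n) : 0 <= path_density f x y.
Proof. exact: prodr_ge0. Qed.

Let mI (phi : ntype lam n -> R) : measurable_fun setT phi ->
  measurable_fun setT (fun y => (phi y * path_density f x y)%:E).
Proof. by move=> mphi; apply/measurable_EFinP; exact: measurable_funM. Qed.

Let ID (phi psi : ntype lam n -> R) : measurable_fun setT phi ->
  measurable_fun setT psi -> (forall y, 0 <= phi y) -> (forall y, 0 <= psi y) ->
  I (fun y => phi y + psi y) = (I phi + I psi)%E.
Proof.
move=> m1 m2 p1 p2; rewrite /I -ge0_integralD //; try exact: mI;
  try by move=> y _; rewrite lee_fin mulr_ge0.
by apply: eq_integral => y _; rewrite mulrDl EFinD.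
Qed.

Let IZ (c : R) (phi : ntype lam n -> R) : 0 <= c -> measurable_fun setT phi ->
  (forall y, 0 <= phi y) -> I (fun y => c * phi y) = (c%:E * I phi)%E.
Proof.
move=> c0 m1 p1; rewrite /I -ge0_integralZl //; try exact: mI;
  try by move=> y _; rewrite lee_fin mulr_ge0.
by apply: eq_integral => y _; rewrite -EFinM mulrA.
Qed.

Let Isum (J : finType) (phi : J -> ntype lam n -> R) :
  (forall j, measurable_fun setT (phi j)) -> (forall j y, 0 <= phi j y) ->
  I (fun y => \sum_j phi j y) = (\sum_j I (phi j))%E.
Proof.
move=> m1 p1; rewrite /I -ge0_integral_sum //; last 2 first.
- by move=> j; apply: mI.
- by move=> j y _; rewrite lee_fin mulr_ge0.
by apply: eq_integral => y _; rewrite sumEFin mulr_suml.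
Qed.

(** By conditional independence the centred cross terms have mean 0, and each variance is at most
    the second moment. *)
Lemma path_variance :
  (I (fun y => (\sum_(t < n.+1) (Z (nacc y t) - a (x t))) ^+ 2)%R
   <= (\sum_(t < n.+1) b (x t))%:E)%E.
Proof.
pose S (y : ntype lam n) := \sum_(t < n.+1) Z (nacc y t).
pose A := \sum_(t < n.+1) a (x t).
have Zge z : 0 <= Z z by have /andP[] := Z0 z.
have mZt t : measurable_fun setT (fun y : ntype lam n => Z (nacc y t)).
  by apply: (measurableT_comp mZ); exact: measurable_nacc.
have Z2 z : 0 <= Z z ^+ 2 <= B ^+ 2.
  have /andP[z0 zB] := Z0 z; rewrite sqr_ge0 /= lerXn2r // nnegrE //.
  exact: (le_trans z0 zB).
have mZ2 : measurable_fun setT (fun z => Z z ^+ 2) by exact: measurable_funX.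
have aE i : (\int[lam]_z (Z z * f i z)%:E)%E = (a i)%:E /\ 0 <= a i.
  exact: (state_meanE i mZ Z0).
have bE i : (\int[lam]_z (Z z ^+ 2 * f i z)%:E)%E = (b i)%:E /\ 0 <= b i.
  exact: (state_meanE i mZ2 Z2).
have a0 i : 0 <= a i by have [] := aE i.
have b0 i : 0 <= b i by have [] := bE i.
have mS : measurable_fun setT S by exact: measurable_sum.
have S0 y : 0 <= S y by apply: sumr_ge0.
have A0 : 0 <= A by apply: sumr_ge0.
have IS : I S = A%:E.
  rewrite Isum // -sumEFin; apply: eq_bigr => t _.
  by rewrite (@path_mean t Z) //; have [] := aE (x t).
have IS2 : (I (fun y => S y ^+ 2)%R <= (\sum_(t < n.+1) b (x t) + A ^+ 2)%:E)%E.
  have -> : (fun y => S y ^+ 2) =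
      fun y => \sum_(s < n.+1) \sum_(t < n.+1) Z (nacc y s) * Z (nacc y t).
    apply/funext => y; rewrite expr2 /S mulr_suml; apply: eq_bigr => s _.
    by rewrite mulr_sumr.
  rewrite Isum; last 2 first.
  - by move=> s; apply: measurable_sum => t; apply: measurable_funM.
  - by move=> s y; apply: sumr_ge0 => t _; rewrite mulr_ge0.
  rewrite expr2 {1}/A mulr_suml -big_split /= -sumEFin.
  apply: lee_sum => s _.
  rewrite Isum; last 2 first.
  - by move=> t; apply: measurable_funM.
  - by move=> t y; rewrite mulr_ge0.
  have -> : a (x s) * A = a (x s) * a (x s) + \sum_(t < n.+1 | t != s) a (x s) * a (x t).
    by rewrite /A mulr_sumr (bigD1 s).
  rewrite (bigD1 s) //= addrA EFinD; apply: leeD.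
    have -> : I (fun y => Z (nacc y s) * Z (nacc y s)) = (b (x s))%:E.
      rewrite -(bE (x s)).1 -(@path_mean s (fun z => Z z ^+ 2) mZ2 (fun z => sqr_ge0 _)).
      by apply: eq_integral => y _; rewrite expr2.
    by rewrite lee_fin lerDl mulr_ge0.
  rewrite -sumEFin; apply: lee_sum => t ts.
  rewrite (@path_mean_pair s t Z Z) //; last by rewrite eq_sym.
  by rewrite (aE (x s)).1 (aE (x t)).1.
pose D (y : ntype lam n) := \sum_(t < n.+1) (Z (nacc y t) - a (x t)).
have DE y : D y = S y - A by rewrite /D sumrB.
have mDD : measurable_fun setT (fun y => D y ^+ 2).
  apply: measurable_funX; apply: measurable_sum => t.
  by apply: measurable_funB.
(* The square is expanded without subtraction, by adding the cross term to both sides of an identity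
   between nonnegative integrals. *)
have id1 : (I (fun y => D y ^+ 2)%R + (2 * A)%:E * A%:E =
            I (fun y => S y ^+ 2)%R + (A ^+ 2)%:E)%E.
  have e1 : ((A ^+ 2)%:E = (A ^+ 2)%:E * I (fun=> 1%R))%E by rewrite path_mass mule1.
  have A2 : 0 <= 2 * A by rewrite mulr_ge0.
  have mS2 : measurable_fun setT (fun y => S y ^+ 2) by exact: measurable_funX.
  have mAS : measurable_fun setT (fun y => 2 * A * S y) by exact: measurable_funM.
  rewrite e1 -IS -(IZ A2 mS S0) -(IZ (sqr_ge0 A) (measurable_cst _) (fun=> ler01)).
  rewrite -(ID mDD mAS (fun y => sqr_ge0 _) (fun y => mulr_ge0 A2 (S0 y))).
  rewrite -(@ID _ (fun=> A ^+ 2 * 1) mS2 (measurable_cst _) (fun y => sqr_ge0 _)); last first.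
    by move=> y; rewrite mulr1 sqr_ge0.
  by apply: eq_integral => y _; congr _%:E; congr (_ * _); rewrite DE; ring.
rewrite -/(D) -(leeD2rE _ _ (_ : ((2 * A)%:E * A%:E)%E \is a fin_num)) // id1.
apply: (le_trans (leeD2r _ IS2)).
by rewrite -EFinM -!EFinD lee_fin; lra.
Qed.

End path_moments.

(** * Truncation on dyadic blocks *)

Section hmm_lln.
Context (R : realType) (k : nat) (dd : measure_display) (T : measurableType dd).
Variable lam : {sigma_finite_measure set T -> \bar R}.
Variables (Q : 'M[R]_k) (f : 'I_k -> T -> R) (m : 'I_k -> R).
Hypotheses (hQ : is_transition Q) (hm : is_distribution m).
Hypothesis hf : forall i, is_density lam (f i).
Context (dO : measure_display) (Omega : measurableType dO).
Variables (P : probability Omega R) (X : nat -> Omega -> 'I_k).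
Variable (Y : nat -> Omega -> T).
Hypothesis mX : forall t i, measurable [set w | X t w = i].
Hypothesis mY : forall t, measurable_fun setT (Y t).
Hypothesis hlaw : hmm_law lam Q f m P X Y.
Variables (h : T -> R) (eps : R).
Hypotheses (mh : measurable_fun setT h) (h0 : forall z, 0 <= h z).
Hypothesis eps0 : 0 < eps.
Hypothesis heps : forall i, (\int[lam]_z (h z * f i z)%:E <= eps%:E)%E.

Let mf i : measurable_fun setT (f i). Proof. by have [] := hf i. Qed.
Let f0 i y : 0 <= f i y. Proof. by have [] := hf i. Qed.

Let Bs j : set T := [set z | h z <= 2 ^+ j].

Let mBs j : measurable (Bs j).
Proof.
rewrite (_ : Bs j = setT `&` h @^-1` `]-oo, (2 ^+ j)]%classic); last first.
  by apply/seteqP; split=> z /=; rewrite in_itv /= => // -[].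
by apply: mh => //; exact: measurable_itv.
Qed.

Let Zt j z : R := h z * \1_(Bs j) z.
Let ct j z : R := \1_(~` Bs j) z.

Let mZt j : measurable_fun setT (Zt j).
Proof. by apply: measurable_funM => //; exact: measurable_indic. Qed.

Let mct j : measurable_fun setT (ct j).
Proof. by apply: measurable_indic; exact: measurableC. Qed.

Let Zt_itv j z : 0 <= Zt j z <= 2 ^+ j.
Proof.
rewrite /Zt indicE; have [zB|zB] := boolP (z \in Bs j).
  by rewrite mulr1 h0; move: zB; rewrite inE.
by rewrite mulr0 lexx exprn_ge0.
Qed.

Let ct_itv j z : 0 <= ct j z <= 1.
Proof. by rewrite /ct indicE; case: (_ \in _); rewrite ?lexx ?ler01. Qed.

(** Its mean in a fixed state is the cost of a block of [2 ^ j] observations: the Chebyshev bound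
    for the truncated average, plus the expected number of observations above the truncation
    level. *)
Let phi j z : R := Zt j z ^+ 2 / 2 ^+ j + 2 ^+ j * ct j z.

Let phi_ge0 j z : 0 <= phi j z.
Proof.
have /andP[c0 _] := ct_itv j z.
by rewrite addr_ge0 // ?divr_ge0 ?sqr_ge0 ?exprn_ge0 // mulr_ge0 ?exprn_ge0.
Qed.

Let mphi j : measurable_fun setT (phi j).
Proof.
apply: measurable_funD; apply: measurable_funM; try exact: measurable_cst.
  exact: measurable_funX.
exact: mct.
Qed.

(** The costs of all blocks add up to a multiple of [h], so a first moment of [h] is enough. *)
Let sum_phi J z : \sum_(j < J) phi j z <= 4 * h z.
Proof.
have e j : phi j z =
    (h z ^+ 2 / 2 ^+ j *+ (h z <= 2 ^+ j)%R) + (2 ^+ j *+ (2 ^+ j < h z)%R).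
  rewrite /phi /Zt /ct !indicE; have [hz|hz] := leP (h z) (2 ^+ j).
    have zB : Bs j z by [].
    have nzB : ~ (~` Bs j) z by move=> H; exact: (H zB).
    by rewrite (mem_set zB) (memNset nzB) mulr1 mulr0.
  have zB : ~ Bs j z by rewrite /Bs /= leNgt hz.
  by rewrite (memNset zB) (mem_set (zB : (~` Bs j) z)) mulr0 expr0n /= mul0r mulr1.
under eq_bigr do rewrite e; rewrite big_split /=.
have := dyadic_tail_sum J (h0 z); have := dyadic_head_sum J (h0 z); lra.
Qed.

(** Summing over all states gives a bound that holds for every hidden path. *)
Let PB j : \bar R := (\sum_i \int[lam]_z (phi j z * f i z)%:E)%E.

Let sum_PB : (\sum_(0 <= j <oo) PB j < +oo)%E.
Proof.
have g0 j i z : 0 <= phi j z * f i z by rewrite mulr_ge0.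
have mg j i : measurable_fun setT (fun z => (phi j z * f i z)%:E).
  by apply/measurable_EFinP; apply: measurable_funM.
rewrite nneseries_sum; last first.
  by move=> i j _; apply: integral_ge0 => z _; rewrite lee_fin.
apply: (@le_lt_trans _ _ (\sum_(i < k) (4 * eps)%:E)%E); last first.
  by rewrite sumEFin ltry.
apply: lee_sum => i _; rewrite -integral_nneseries //; last first.
  by move=> j z _; rewrite lee_fin.
have e4 : (0 <= 4%:R%:E :> \bar R)%E by rewrite lee_fin.
rewrite EFinM; apply: le_trans (lee_wpmul2l e4 (heps i)).
rewrite -ge0_integralZl //; last 2 first.
- by apply/measurable_EFinP; apply: measurable_funM.
- by move=> z _; rewrite lee_fin mulr_ge0.
apply: ge0_le_integral => //.
- by move=> z _; apply: nneseries_ge0 => j _ _; rewrite lee_fin.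
- by apply: ge0_emeasurable_sum => // j z _ _; rewrite lee_fin.
- apply: emeasurable_funM; first exact: measurable_cst.
  by apply/measurable_EFinP; apply: measurable_funM.
move=> z _; apply: lime_le.
  by apply: is_cvg_nneseries => j _ _; rewrite lee_fin.
near=> J; rewrite sumEFin -EFinM lee_fin big_mkord -mulr_suml mulrA.
by rewrite ler_wpM2r.
Unshelve. all: by end_near. Qed.

Let aj j i := state_mean lam f (Zt j) i.

Let aj_le j i : 0 <= aj j i <= eps.
Proof.
have [e a0] := state_meanE hf i (mZt j) (Zt_itv j).
rewrite a0 /= -lee_fin -e; apply: le_trans (heps i).
apply: ge0_le_integral => //.
- by move=> z _; rewrite lee_fin mulr_ge0 //; have /andP[] := Zt_itv j z.
- by apply/measurable_EFinP; apply: measurable_funM.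
- by apply/measurable_EFinP; apply: measurable_funM.
- by move=> z _; rewrite lee_fin ler_wpM2r // ler_piMr // indicE; case: (_ \in _).
Qed.

(** [ntype lam n] holds n.+1 observations, hence the predecessor. *)
Let nj j : nat := (2 ^ j).-1.

Let njE j : (nj j).+1 = (2 ^ j)%N.
Proof. by rewrite /nj prednK // expn_gt0. Qed.

Let Df j (x : nat -> 'I_k) (s : nat -> T) : R :=
  (\sum_(t < (nj j).+1) (Zt j (s t) - aj j (x t))) ^+ 2 / (2 ^+ j) ^+ 2
  + \sum_(t < (nj j).+1) ct j (s t).

Let Df_ge0 j x s : 0 <= Df j x s.
Proof.
rewrite addr_ge0 ?divr_ge0 ?sqr_ge0 //; apply: sumr_ge0 => t _.
by have /andP[] := ct_itv j (s t).
Qed.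

Let mDf j x : measurable_fun setT
  (fun y : ntype lam (nj j) => Df j x (nacc y)).
Proof.
apply: measurable_funD; last first.
  apply: measurable_sum => t; apply: (measurableT_comp (mct j)).
  exact: measurable_nacc.
apply: measurable_funM; last exact: measurable_cst.
apply: measurable_funX; apply: measurable_sum => t; apply: measurable_funB.
  by apply: (measurableT_comp (mZt j)); exact: measurable_nacc.
exact: measurable_cst.
Qed.

Let path_Df j (x : nat -> 'I_k) :
  (\int[nmeas lam (nj j)]_y (Df j x (nacc y) * path_density f x y)%:E <= PB j)%E.
Proof.
set n := nj j.
have p0 : 0 < 2 ^+ j :> R by rewrite exprn_gt0.
have mD : measurable_fun setT (fun y : ntype lam n => path_density f x y).
  exact: (measurable_path_density hf).
have D0 (y : ntype lam n) : 0 <= path_density f x y by exact: prodr_ge0.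
pose V (y : ntype lam n) := (\sum_(t < n.+1) (Zt j (nacc y t) - aj j (x t))) ^+ 2.
have V0 y : 0 <= V y by exact: sqr_ge0.
have mV : measurable_fun setT V.
  apply: measurable_funX; apply: measurable_sum => t; apply: measurable_funB.
    by apply: (measurableT_comp (mZt j)); exact: measurable_nacc.
  exact: measurable_cst.
have mc (t : 'I_n.+1) : measurable_fun setT (fun y : ntype lam n => ct j (nacc y t)).
  by apply: (measurableT_comp (mct j)); exact: measurable_nacc.
have c0 z : 0 <= ct j z by have /andP[] := ct_itv j z.
have i2 : 0 <= ((2 ^+ j) ^+ 2)^-1 :> R by rewrite invr_ge0 sqr_ge0.
have -> : (\int[nmeas lam n]_y (Df j x (nacc y) * path_density f x y)%:E =
   (((2 ^+ j) ^+ 2)^-1)%:E * \int[nmeas lam n]_y (V y * path_density f x y)%:E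
   + \sum_(t < n.+1) \int[nmeas lam n]_y (ct j (nacc y t) * path_density f x y)%:E)%E.
  rewrite -ge0_integralZl //; last 2 first.
  - by apply/measurable_EFinP; apply: measurable_funM.
  - by move=> y _; rewrite lee_fin; exact: mulr_ge0.
  rewrite -ge0_integral_sum //; last 2 first.
  - by move=> t; apply/measurable_EFinP; apply: measurable_funM.
  - by move=> t y _; rewrite lee_fin mulr_ge0.
  rewrite -ge0_integralD //; last 4 first.
  - by move=> y _; rewrite -EFinM lee_fin; exact: (mulr_ge0 i2 (mulr_ge0 (V0 y) (D0 y))).
  - apply: emeasurable_funM; first exact: measurable_cst.
    by apply/measurable_EFinP; apply: measurable_funM.
  - by move=> y _; apply: sume_ge0 => t _; rewrite lee_fin mulr_ge0.
  - apply: emeasurable_sum => t.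
    by apply/measurable_EFinP; apply: measurable_funM.
  apply: eq_integral => y _; rewrite sumEFin -EFinM -EFinD; congr _%:E.
  by rewrite /Df -/n -/(V y) mulrDl mulr_suml [V y / _]mulrC -mulrA.
have Z2 z : 0 <= Zt j z ^+ 2 <= (2 ^+ j) ^+ 2.
  have /andP[z0 zB] := Zt_itv j z; rewrite sqr_ge0 /=.
  by apply: lerXn2r; rewrite ?nnegrE // ltW.
have bE i := state_meanE hf i (measurable_funX 2 (mZt j)) Z2.
have cE i := state_meanE hf i (mct j) (ct_itv j).
have var := path_variance hf x n (mZt j) (Zt_itv j).
apply: (le_trans (leeD2r _ (lee_wpmul2l _ var))); first by rewrite lee_fin.
rewrite -EFinM.
have cm (t : 'I_n.+1) :
    (\int[nmeas lam n]_y (ct j (nacc y t) * path_density f x y)%:E)%E =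
    (state_mean lam f (ct j) (x t))%:E.
  exact: (etrans (path_mean hf x t (mct j) c0) (cE (x t)).1).
rewrite (eq_bigr _ (fun t _ => cm t)).
rewrite sumEFin -EFinD mulr_sumr -big_split /=.
pose pb i := state_mean lam f (phi j) i.
have pbE i : (\int[lam]_z (phi j z * f i z)%:E)%E = (pb i)%:E /\
   pb i = state_mean lam f (fun z => Zt j z ^+ 2) i / 2 ^+ j + 2 ^+ j * state_mean lam f (ct j) i.
  have e : (\int[lam]_z (phi j z * f i z)%:E)%E =
     (state_mean lam f (fun z => Zt j z ^+ 2) i / 2 ^+ j + 2 ^+ j * state_mean lam f (ct j) i)%:E.
    rewrite EFinD mulrC !EFinM -(bE i).1 -(cE i).1.
    have ip : 0 <= (2 ^+ j)^-1 :> R by rewrite invr_ge0 ltW.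
    have mZ2 : measurable_fun setT (fun z => (Zt j z ^+ 2 * f i z)%:E).
      by apply/measurable_EFinP; apply: measurable_funM => //; exact: measurable_funX.
    have mcf : measurable_fun setT (fun z => (ct j z * f i z)%:E).
      by apply/measurable_EFinP; apply: measurable_funM.
    have Zf0 z : (0 <= (Zt j z ^+ 2 * f i z)%:E)%E.
      by rewrite lee_fin; apply: mulr_ge0 => //; exact: sqr_ge0.
    have cf0 z : (0 <= (ct j z * f i z)%:E)%E by rewrite lee_fin; exact: mulr_ge0.
    have ipE : (0 <= ((2 ^+ j)^-1 : R)%:E)%E by rewrite lee_fin.
    have pE : (0 <= (2 ^+ j : R)%:E)%E by rewrite lee_fin ltW.
    rewrite -(ge0_integralZl _ measurableT mZ2 (fun z _ => Zf0 z) ipE).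
    rewrite -(ge0_integralZl _ measurableT mcf (fun z _ => cf0 z) pE).
    rewrite -ge0_integralD //; last 4 first.
    - by move=> z _; exact: mule_ge0.
    - by apply: emeasurable_funM => //; exact: measurable_cst.
    - by move=> z _; exact: mule_ge0.
    - by apply: emeasurable_funM => //; exact: measurable_cst.
    apply: eq_integral => z _; rewrite -!EFinM -EFinD; congr _%:E.
    by rewrite /phi; ring.
  by split; rewrite /pb /state_mean e.
rewrite /PB; under [X in (_ <= X)%E]eq_bigr do rewrite (pbE _).1.
rewrite sumEFin lee_fin.
have pb0 i : 0 <= pb i.
  rewrite -lee_fin -(pbE i).1; apply: integral_ge0 => z _.
  by rewrite lee_fin mulr_ge0.
apply: (@le_trans _ _ (\sum_(t < n.+1) (\sum_i pb i) / 2 ^+ j)).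
  apply: ler_sum => t _; rewrite ler_pdivlMr //.
  apply: (@le_trans _ _ (pb (x t))); last by rewrite (bigD1 (x t)) //= lerDl sumr_ge0.
  rewrite (pbE (x t)).2 mulrDl le_eqVlt; apply/predU1P; left.
  congr (_ + _); last by rewrite mulrC.
  by move: p0; set p := 2 ^+ j => p0; field; rewrite gt_eqF.
rewrite sumr_const card_ord -[leLHS]mulr_natr (njE j : n.+1 = _) natrX -mulrA.
by rewrite mulVf ?mulr1.
Qed.

Let Dw j w : R := Df j (X ^~ w) (Y ^~ w).

Let mDw j : measurable_fun setT (Dw j).
Proof.
have ma t : measurable_fun setT (fun w => aj j (X t w)).
  rewrite (_ : (fun w => _) = fun w => \sum_i aj j i * \1_[set w | X t w = i] w).
    apply: measurable_sum => i; apply: measurable_funM; first exact: measurable_cst.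
    exact: measurable_indic.
  apply/funext => w; rewrite (bigD1 (X t w)) //= indicE mem_set // mulr1.
  rewrite big1 ?addr0 // => i ne; rewrite indicE memNset ?mulr0 // => /= e.
  by rewrite e eqxx in ne.
apply: measurable_funD; last first.
  by apply: measurable_sum => t; exact: (measurableT_comp (mct j)).
apply: measurable_funM; last exact: measurable_cst.
apply: measurable_funX; apply: measurable_sum => t; apply: measurable_funB => //.
exact: (measurableT_comp (mZt j)).
Qed.

Let path_of n (x : {ffun 'I_n.+1 -> 'I_k}) (t : nat) := x (inord t).

(** The conditional bound is the same for every hidden path, and the path weights add up to 1. *)
Let Dw_mean j : (\int[P]_w (Dw j w)%:E <= PB j)%E.
Proof.
pose n := nj j.
have mE (x : {ffun 'I_n.+1 -> 'I_k}) : measurable (path_event X (path_of x) n).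
  exact: measurable_path_event.
have -> : (\int[P]_w (Dw j w)%:E = \sum_(x : {ffun 'I_n.+1 -> 'I_k})
    \int[P]_w ((Df j (path_of x) (nacc (nobs lam n (Y ^~ w))))%:E *
       (\1_(path_event X (path_of x) n) w)%:E))%E.
  rewrite -ge0_integral_sum //; last 2 first.
  - move=> x; apply: emeasurable_funM; apply/measurable_EFinP.
      exact: (measurableT_comp (@mDf j (path_of x))
                (@measurable_nobs _ _ _ lam _ _ Y n mY)).
    exact: measurable_indic.
  - by move=> x w _; rewrite mule_ge0 // lee_fin.
  apply: eq_integral => w _.
  have /(congr1 (fun r => (Dw j w)%:E * r%:E)%E) := sum_path_event R X n w.
  rewrite mule1 => <-.
  rewrite -sumEFin ge0_sume_distrr //; apply: eq_bigr => x _.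
  rewrite indicE; have [/set_mem wE|_] := boolP (w \in _); last by rewrite !mule0.
  rewrite !mule1; congr _%:E; rewrite /Dw /Df.
  congr (_ ^+ 2 / _ + _); apply: eq_bigr => t _.
    have tn : (t <= n)%N by rewrite -ltnS ltn_ord.
    by rewrite nacc_nobs // (wE t tn).
  by rewrite nacc_nobs // -ltnS ltn_ord.
have sumw : (\sum_(x : {ffun 'I_n.+1 -> 'I_k})
    (path_weight Q m (path_of x) n)%:E = 1)%E.
  transitivity (\sum_(x : {ffun 'I_n.+1 -> 'I_k})
     \int[P]_w (1%:E * (\1_(path_event X (path_of x) n) w)%:E))%E.
    apply: eq_bigr => x _.
    rewrite (@ge0_integral_path_law _ _ _ _ lam Q f m hQ hm hf _ _ P X Y mX mY hlaw
       (path_of x) n (fun=> 1%E)) //.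
    under eq_integral do rewrite mul1e EFinM.
    rewrite ge0_integralZl //; last 3 first.
    - by apply/measurable_EFinP; exact: (measurable_path_density hf).
    - by move=> y _; rewrite lee_fin; exact: prodr_ge0.
    - by rewrite lee_fin; exact: path_weight_ge0.
    have -> : (\int[nmeas lam n]_y (path_density f (path_of x) y)%:E = 1)%E.
      rewrite -(path_mass hf (path_of x) n).
      by apply: eq_integral => y _; rewrite mul1r.
    by rewrite mule1.
  rewrite -ge0_integral_sum //; last first.
    move=> x; apply: emeasurable_funM; first exact: measurable_cst.
    by apply/measurable_EFinP; exact: measurable_indic.
  transitivity (\int[P]_w (1%:E : \bar R))%E; last first.
    by rewrite integral_cst // mul1e; exact: probability_setT.
  apply: eq_integral => w _; under eq_bigr do rewrite mul1e.
  by rewrite sumEFin sum_path_event.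
have PB0 : (0 <= PB j)%E.
  by apply: sume_ge0 => i _; apply: integral_ge0 => z _; rewrite lee_fin mulr_ge0.
rewrite -[leRHS]mul1e -sumw ge0_sume_distrl; last first.
  by move=> x _; rewrite lee_fin; exact: path_weight_ge0.
apply: lee_sum => x _.
have pw0 : 0 <= path_weight Q m (path_of x) n by exact: path_weight_ge0.
rewrite (@ge0_integral_path_law _ _ _ _ lam Q f m hQ hm hf _ _ P X Y mX mY hlaw
   (path_of x) n (fun y => (Df j (path_of x) (nacc y))%:E)) //; last 2 first.
- by apply/measurable_EFinP; exact: mDf.
- by move=> y; rewrite lee_fin.
have pwE : (0 <= (path_weight Q m (path_of x) n)%:E)%E by rewrite lee_fin.
apply: le_trans (lee_wpmul2l pwE (path_Df j (path_of x))).
rewrite -ge0_integralZl //; last 2 first.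
- apply/measurable_EFinP; apply: measurable_funM; first exact: mDf.
  exact: (measurable_path_density hf).
- by move=> y _; rewrite lee_fin mulr_ge0 //; exact: prodr_ge0.
rewrite le_eqVlt; apply/predU1P; left; apply: eq_integral => y _.
by rewrite -!EFinM; congr _%:E; ring.
Qed.

(* Truncate at level [2^j] on the dyadic block [t < 2^j]: given the hidden path
   the truncated terms are independent, so Chebyshev needs no mixing. *)
Lemma hmm_lln_upper : {ae P, forall w, \forall n \near \oo,
  \sum_(t < n) h (Y t w) <= 4 * eps * n%:R}.
Proof.
have mf' j : measurable_fun setT (fun w => (Dw j w)%:E) by exact/measurable_EFinP.
have f0' j w : (0 <= (Dw j w)%:E)%E by rewrite lee_fin; exact: Df_ge0.
have fin : (\sum_(0 <= j <oo) \int[P]_w (Dw j w)%:E < +oo)%E.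
  apply: le_lt_trans sum_PB; apply: lee_nneseries => j _ //.
    by move=> _; apply: integral_ge0.
have := ae_cvg0_summable mf' f0' fin; apply: filterS => w cv.
have /fine_cvgP[_ cvr] := cv.
(* A deviation below 1 excludes every exceedance, since each [ct] is 0 or 1; below [eps ^+ 2] it
   bounds the centred sum by [eps * 2 ^+ j]. *)
pose c := Num.min 1 (eps ^+ 2).
have c0 : 0 < c by rewrite lt_min ltr01 exprn_gt0.
move/cvgrPdist_lt: cvr => /(_ c c0) [J _ hJ].
have key j : (J <= j)%N -> \sum_(t < (2 ^ j)%N) h (Y t w) <= 2 * eps * 2 ^+ j.
  move=> Jj; have := hJ j Jj; rewrite /= sub0r normrN ger0_norm ?Df_ge0 //.
  rewrite /c lt_min => /andP[D1 D2].
  have p0 : 0 < 2 ^+ j :> R by rewrite exprn_gt0.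
  have V0 : 0 <= (\sum_(t < (nj j).+1) (Zt j (Y t w) - aj j (X t w))) ^+ 2 / (2 ^+ j) ^+ 2.
    by rewrite divr_ge0 // sqr_ge0.
  have C0 (t : 'I_(nj j).+1) : 0 <= ct j (Y t w) by have /andP[] := ct_itv j (Y t w).
  have Cs0 : 0 <= \sum_(t < (nj j).+1) ct j (Y t w) by apply: sumr_ge0.
  have allB (t : 'I_(nj j).+1) : Zt j (Y t w) = h (Y t w).
    have : ct j (Y t w) < 1.
      apply: le_lt_trans D1; rewrite /Dw /Df.
      apply: (@le_trans _ _ (\sum_(t < (nj j).+1) ct j (Y t w))); last by rewrite lerDr.
      by rewrite (bigD1 t) //= lerDl; apply: sumr_ge0.
    rewrite /ct /Zt !indicE; have [yB|yB] := boolP (Y t w \in Bs j); first by rewrite mulr1.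
    rewrite mem_set ?ltxx //= => yB'; by move: yB; rewrite mem_set.
  have Vle : (\sum_(t < (nj j).+1) (Zt j (Y t w) - aj j (X t w))) ^+ 2 <= (eps * 2 ^+ j) ^+ 2.
    rewrite exprMn -ler_pdivrMr ?exprn_gt0 //; apply/ltW; apply: le_lt_trans D2.
    by rewrite /Dw /Df lerDl.
  have : \sum_(t < (nj j).+1) (Zt j (Y t w) - aj j (X t w)) <= eps * 2 ^+ j.
    have E0 : 0 <= eps * 2 ^+ j by rewrite mulr_ge0 ?ltW.
    rewrite leNgt; apply/negP => lt; move: Vle; rewrite leNgt => /negP; apply.
    by rewrite ltr_pXn2r // nnegrE // (le_trans E0) // ltW.
  rewrite sumrB => le1.
  have le2 : \sum_(t < (nj j).+1) aj j (X t w) <= eps * 2 ^+ j.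
    apply: (@le_trans _ _ (\sum_(t < (nj j).+1) eps)).
      by apply: ler_sum => t _; have /andP[] := aj_le j (X t w).
    by rewrite sumr_const card_ord njE -[leLHS]mulr_natr natrX.
  have -> : \sum_(t < (2 ^ j)%N) h (Y t w) = \sum_(t < (nj j).+1) Zt j (Y t w).
    by rewrite -(njE j); apply: eq_bigr => t _; rewrite allB.
  by move: le1 le2; lra.
(* Between two powers of two the sum of nonnegative terms is compared with the one at the next
   power, which doubles the constant. *)
exists (2 ^ J)%N => // n /= Jn.
have n0 : (0 < n)%N by rewrite (leq_trans _ Jn) // expn_gt0.
have /andP[l1 l2] := trunc_log_bounds (ltnSn 1) n0.
have Jl : (J <= (trunc_log 2 n).+1)%N.
  by rewrite -(@leq_exp2l 2) // (leq_trans Jn) // ltnW.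
have le1 : \sum_(t < n) h (Y t w) <= \sum_(t < (2 ^ (trunc_log 2 n).+1)%N) h (Y t w).
  rewrite -[leLHS](big_mkord xpredT (fun t => h (Y t w))).
  rewrite -[leRHS](big_mkord xpredT (fun t => h (Y t w))).
  by rewrite (big_cat_nat (leq0n n) (ltnW l2)) //= lerDl sumr_ge0.
apply: (le_trans (le_trans le1 (key _ Jl))).
have : 2 ^+ (trunc_log 2 n) <= n%:R :> R by rewrite -natrX ler_nat.
move=> hn; rewrite exprS; have := ler_wpM2l (ltW eps0) hn; lra.
Qed.

End hmm_lln.

(** * The prior mass of likely parameters *)

Section kullback.
Context (R : realType) (dd : measure_display) (T : measurableType dd).
Variable lam : {measure set T -> \bar R}.

Lemma expR_ge1Dx_sqr (c : R) : 0 <= c -> 1 + c + c ^+ 2 / 4 <= expR c.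
Proof.
move=> c0; have h : 1 + c / 2 <= expR (c / 2) by exact: expR_ge1Dx.
have -> : expR c = expR (c / 2) ^+ 2.
  by rewrite -expRM_natl; congr expR; field.
have : (1 + c / 2) ^+ 2 <= expR (c / 2) ^+ 2.
  by apply: lerXn2r; rewrite ?nnegrE ?expR_ge0 // addr_ge0 // divr_ge0.
by apply: le_trans; rewrite le_eqVlt; apply/predU1P; left; field.
Qed.

Let elogratio_pos (p r : R) : 0 < p -> 0 < r ->
  elogratio p r = (ln (p / r))%:E.
Proof. by move=> p0 r0; rewrite /elogratio !gt_eqF. Qed.

(* With [s = ln (r / p)] one has [p + eta p s^+ <= eta^2 p + p (e^s - s)]. *)
Lemma kl_pointwise (p r eta : R) (g : \bar R) : 0 <= p -> 0 <= r -> 0 <= eta ->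
  (p != 0 -> (elogratio p r <= g)%E) ->
  ((1 + eta)%:E * maxe (- (p%:E * g)) 0 + p%:E <=
   (eta ^+ 2 * p)%:E + r%:E + maxe (p%:E * g) 0)%E
  /\ (maxe (- (p%:E * g)) 0 <= r%:E)%E.
Proof.
move=> p0 r0 eta0 hg.
have [->|pn] := eqVneq p 0.
  by rewrite mul0e oppe0 maxxx mule0 !adde0 mulr0 add0e lee_fin.
have {}p0 : 0 < p by rewrite lt_neqAle eq_sym pn.
have {hg} := hg pn.
have [->|rn] := eqVneq r 0.
  rewrite /elogratio (negbTE pn) eqxx leye_eq => /eqP ->.
  rewrite gt0_muley ?lte_fin // maxye [(_ + +oo)%E]addey // leey.
  by split=> //; rewrite maxNye.
have {}r0 : 0 < r by rewrite lt_neqAle eq_sym rn.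
rewrite elogratio_pos //.
have rE : r = p * expR (ln (r / p)).
  by rewrite lnK ?posrE ?divr_gt0 //; field; rewrite gt_eqF.
set s := ln (r / p) in rE *.
have sE : ln (p / r) = - s.
  by rewrite /s -lnV ?posrE ?divr_gt0 // invf_div.
rewrite sE; case: g => [c| |] //; last first.
  move=> _; rewrite gt0_muley ?lte_fin // maxye [(_ + +oo)%E]addey // leey.
  by split=> //; rewrite maxNye lee_fin ltW.
rewrite lee_fin => sc.
have es : 1 + s <= expR s by exact: expR_ge1Dx.
rewrite -EFinM -EFinN -!EFin_max -!EFinM -!EFinD !lee_fin.
have [c0|c0] := leP 0 c.
  have pc : 0 <= p * c by rewrite mulr_ge0 // ltW.
  rewrite (max_l pc) max_r ?oppr_le0 // mulr0 add0r; split; last exact: ltW.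
  have h1 : p * (1 + s) <= r by rewrite rE ler_pM2l.
  have h2 : p * (- s) <= p * c by rewrite ler_pM2l.
  have h3 : 0 <= eta ^+ 2 * p by rewrite mulr_ge0 ?sqr_ge0 // ltW.
  by lra.
have pc : p * c <= 0 by rewrite pmulr_rle0 // ltW.
rewrite (max_r pc) max_l ?oppr_ge0 // addr0.
have cs : - c <= s by lra.
have mc0 : 0 <= - c by lra.
have e1 : 1 - c + (- c) ^+ 2 / 4 <= expR (- c) by exact: expR_ge1Dx_sqr.
have e2 : expR (- c) <= expR s by rewrite ler_expR.
have sq : eta * (- c) <= eta ^+ 2 + (- c) ^+ 2 / 4.
  by have := sqr_ge0 (eta - (- c) / 2); lra.
have key : (1 + eta) * (- c) + 1 <= eta ^+ 2 + expR s by lra.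
split.
  have := ler_wpM2l (ltW p0) key; rewrite !mulrDr -rE; lra.
have h1 : - c <= expR s by have := sqr_ge0 (- c); lra.
by have := ler_wpM2l (ltW p0) h1; rewrite -rE; lra.
Qed.

(** A small integral could hide a cancellation. With [Pp] and [N] the integrals of the positive and
    negative parts, integrating [kl_pointwise] gives [eta * N <= eta ^+ 2 + (Pp - N)], hence
    [N <= 2 * eta] and [Pp <= eta ^+ 2 + 2 * eta]. *)
Lemma kl_positive_part (p r : T -> R) (g : T -> \bar R) (eta : R) :
  is_density lam p -> is_density lam r -> measurable_fun setT g ->
  (forall y, p y != 0 -> (elogratio (p y) (r y) <= g y)%E) ->
  0 < eta -> eta <= 1 ->
  (\int[lam]_y ((p y)%:E * g y) < (eta ^+ 2)%:E)%E ->
  (\int[lam]_y maxe ((p y)%:E * g y) 0 <= (3 * eta)%:E)%E.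
Proof.
move=> [mp p0 ip] [mr r0 ir] mg hg eta0 eta1.
pose u y := ((p y)%:E * g y)%E.
have mu : measurable_fun setT u.
  by apply: emeasurable_funM => //; apply/measurable_EFinP.
have mpos : measurable_fun setT (fun y => maxe (u y) 0).
  by apply: measurable_maxe => //; exact: measurable_cst.
have mneg : measurable_fun setT (fun y => maxe (- u y) 0)%E.
  apply: measurable_maxe; last exact: measurable_cst.
  exact: measurableT_comp.
have pos0 y : (0 <= maxe (u y) 0)%E by rewrite le_max lexx orbT.
have neg0 y : (0 <= maxe (- u y) 0)%E by rewrite le_max lexx orbT.
have posE : (u^\+ = fun y => maxe (u y) 0)%E.
  by apply/funext => y; rewrite funeposE.
have negE : (u^\- = fun y => maxe (- u y) 0)%E.
  by apply/funext => y; rewrite funenegE.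
rewrite -/u [X in (X < _)%E -> _]integralE posE negE.
set Pp := (\int[lam]_y maxe (u y) 0)%E; set N := (\int[lam]_y maxe (- u y) 0)%E.
have kl y := kl_pointwise (p0 y) (r0 y) (ltW eta0) (hg y).
have N0 : (0 <= N)%E by apply: integral_ge0.
have Pp0 : (0 <= Pp)%E by apply: integral_ge0.
have mpE : measurable_fun setT (fun y => (p y)%:E) by exact/measurable_EFinP.
have mrE : measurable_fun setT (fun y => (r y)%:E) by exact/measurable_EFinP.
have N1 : (N <= 1)%E.
  rewrite -ir; apply: ge0_le_integral => // y _; exact: (kl y).2.
have Nfin : N \is a fin_num by rewrite ge0_fin_numE // (le_lt_trans N1) // ltry.
have pE0 y : (0 <= (p y)%:E)%E by rewrite lee_fin.
have rE0 y : (0 <= (r y)%:E)%E by rewrite lee_fin.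
have e1 : (0 <= (1 + eta)%:E)%E by rewrite lee_fin addr_ge0 // ltW.
have e2 : (0 <= (eta ^+ 2)%:E)%E by rewrite lee_fin sqr_ge0.
have m1 : measurable_fun setT (fun y => (1 + eta)%:E * maxe (- u y) 0)%E.
  by apply: emeasurable_funM => //; exact: measurable_cst.
have m2 : measurable_fun setT (fun y => (eta ^+ 2)%:E * (p y)%:E)%E.
  by apply: emeasurable_funM => //; exact: measurable_cst.
have m3 : measurable_fun setT (fun y => (eta ^+ 2)%:E * (p y)%:E + (r y)%:E)%E.
  exact: emeasurable_funD.
have q1 y : (0 <= (1 + eta)%:E * maxe (- u y) 0)%E by rewrite mule_ge0.
have q2 y : (0 <= (eta ^+ 2)%:E * (p y)%:E)%E by rewrite mule_ge0.
have q3 y : (0 <= (eta ^+ 2)%:E * (p y)%:E + (r y)%:E)%E by rewrite adde_ge0.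
have main : ((1 + eta)%:E * N + 1 <= (eta ^+ 2)%:E + 1 + Pp)%E.
  rewrite -{1}ip -{1}ir -(mule1 (eta ^+ 2)%:E) -{1}ip.
  rewrite -ge0_integralZl // -ge0_integralZl // -!ge0_integralD //.
  apply: ge0_le_integral => //.
  - by move=> y _; rewrite adde_ge0.
  - exact: emeasurable_funD.
  - exact: emeasurable_funD.
  - by move=> y _; have := (kl y).1; rewrite EFinM.
rewrite -(fineK Nfin) in main *; set n := fine N in main *.
move: main Pp0; case: Pp => [x| |] //.
rewrite -EFinM -EFinN -!EFinD !lee_fin lte_fin => main x0 lt.
have n0 : 0 <= n by rewrite fine_ge0.
have h : eta * n <= eta * (2 * eta) by move: main lt; lra.
have {}h : n <= 2 * eta by rewrite -(ler_pM2l eta0).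
have : eta ^+ 2 <= eta by rewrite expr2 ler_piMl // ltW.
by move: lt; lra.
Qed.

End kullback.

(** * Exchange of prior and sample space *)

Section prior_mass.
Context (R : realType) (dO dp : measure_display).
Context (Omega : measurableType dO) (Tp : measurableType dp).
Variables (P : probability Omega R) (pi : probability Tp R).

(** Tonelli's theorem: a set whose sections over the parameters are all null has null sections over
    almost every outcome. *)
Lemma ae_section_null (B : set (Tp * Omega)%type) : measurable B ->
  (forall t, P.-negligible (xsection B t)) ->
  {ae P, forall w, pi (ysection B w) = 0%E}.
Proof.
move=> mB nB.
pose F (tw : Tp * Omega) : \bar R := (\1_B tw)%:E.
have mF : measurable_fun setT F.
  by apply/measurable_EFinP; exact: measurable_indic.
have F0 tw : (0 <= F tw)%E by rewrite lee_fin.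
have i0 : (\int[pi]_t \int[P]_w F (t, w) = 0)%E.
  apply: integral0_eq => t _.
  have -> : (\int[P]_w F (t, w) = \int[P]_w (\1_(xsection B t) w)%:E)%E.
    by apply: eq_integral => w _; rewrite /F !indicE mem_xsection.
  rewrite integral_indic ?setIT //; last exact: measurable_xsection.
  exact/measure_negligible/nB/measurable_xsection.
have := fubini_tonelli (m1 := pi) (m2 := P) F mF F0; rewrite i0 => /esym i1.
pose phi w := (\int[pi]_t F (t, w))%E.
have mphi : measurable_fun setT phi.
  exact: (@measurable_fun_fubini_tonelli_G _ _ _ _ _ pi F mF F0).
have phi0 w : (0 <= phi w)%E by apply: integral_ge0.
have : ae_eq P setT phi (cst 0%E).
  apply/(ae_eq_integral_abs P measurableT mphi).
  by under eq_integral do rewrite gee0_abs //.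
apply: filterS => w /(_ I) /= <-; rewrite /phi.
have -> : (\int[pi]_t F (t, w) = \int[pi]_t (\1_(ysection B w) t)%:E)%E.
  by apply: eq_integral => t _; rewrite /F !indicE mem_ysection.
by rewrite integral_indic ?setIT //; exact: measurable_ysection.
Qed.

(** For almost every outcome the bound holds eventually for almost every parameter in [Th], hence
    from a common rank on a part of [Th] of positive mass. *)
Lemma prior_mass_lower (L : nat -> Tp -> Omega -> R) (p : nat -> Omega -> R)
    (Th : set Tp) (b b1 : R) :
  (forall n, measurable_fun setT (fun tw : Tp * Omega => L n tw.1 tw.2)) ->
  (forall n, measurable_fun setT (p n)) ->
  (forall n t w, 0 <= L n t w) -> (forall n w, 0 <= p n w) ->
  measurable Th -> (0 < pi Th)%E -> 0 < b -> b < b1 ->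
  (forall t, Th t -> {ae P, forall w, \forall n \near \oo,
     b1 ^+ n * p n w <= L n t w}) ->
  {ae P, forall w, \forall n \near \oo,
     ((b ^+ n * p n w)%:E <= \int[pi]_t (L n t w)%:E)%E}.
Proof.
move=> mL mp L0 p0 mTh Thpos b0 bb1 hTh.
have b10 : 0 < b1 by exact: lt_trans bb1.
pose dd n (tw : Tp * Omega) := L n tw.1 tw.2 - b1 ^+ n * p n tw.2.
have mdd n : measurable_fun setT (dd n).
  apply: measurable_funB => //; apply: measurable_funM; first exact: measurable_cst.
  by apply: (measurableT_comp (mp n)); exact: measurable_snd.
pose G n := [set tw | 0 <= dd n tw].
have mG n : measurable (G n).
  rewrite (_ : G n = setT `&` dd n @^-1` `[0, +oo[%classic); last first.
    by apply/seteqP; split=> z /=; rewrite in_itv /= andbT // => -[].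
  by apply: mdd => //; exact: measurable_itv.
pose A N : set (Tp * Omega) := \bigcap_(n in [set n | (N <= n)%N]) G n.
have mA N : measurable (A N).
  by apply: bigcap_measurable => [|n _]; [exists N => /=|exact: mG].
pose Bad : set (Tp * Omega) := (Th `*` setT) `&` ~` (\bigcup_N A N).
have mBad : measurable Bad.
  apply: measurableI; first exact: measurableX.
  by apply: measurableC; apply: bigcup_measurable => N _; exact: mA.
have := @ae_section_null Bad mBad.
have nBad t : P.-negligible (xsection Bad t).
  have [Tht|nTht] := pselect (Th t); last first.
    rewrite (_ : xsection Bad t = set0); first exact: negligible_set0.
    by apply/seteqP; split=> // w; rewrite /xsection /= inE => -[[]].
  have [C [mC C0 hC]] := hTh t Tht.
  exists C; split=> // w; rewrite /xsection /= inE => -[_ nA]; apply: hC => /= -[N _ hN].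
  apply: nA; exists N => // n Nn; rewrite /G /dd /= subr_ge0.
  exact: hN.
move=> /(_ nBad); apply: filterS => w Bw.
have [N posN] : exists N, (0 < pi (ysection (A N) w `&` Th))%E.
  apply: contrapT => /forallNP nN.
  have z N : pi (ysection (A N) w `&` Th) = 0%E.
    apply/eqP; rewrite eq_le measure_ge0 andbT leNgt; apply/negP; exact: nN.
  suff : (pi Th <= 0)%E by rewrite leNgt Thpos.
  have mys N : measurable (ysection (A N) w `&` Th).
    by apply: measurableI => //; exact: measurable_ysection.
  have sub : Th `<=` ysection Bad w `|` \bigcup_N (ysection (A N) w `&` Th).
    move=> t Tht; have [[N _ AN]|nAN] := pselect ((\bigcup_N A N) (t, w)).
      by right; exists N => //; split=> //; rewrite /ysection /= inE.
    by left; rewrite /ysection /= inE; split.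
  have : pi.-negligible (ysection Bad w `|` \bigcup_N (ysection (A N) w `&` Th)).
    apply: negligibleU.
      by apply/negligibleP => //; exact: measurable_ysection.
    apply: negligible_bigcup => N; exists (ysection (A N) w `&` Th).
    by split; [exact: mys|exact: z|exact: subset_refl].
  by move=> /(negligibleS sub) /(measure_negligible mTh) ->.
set E := ysection (A N) w `&` Th in posN.
have mE : measurable E by apply: measurableI => //; exact: measurable_ysection.
have Efin : pi E \is a fin_num by exact: fin_num_measure.
(* [del] is the prior mass on which the bound holds from rank [N]; the gap between [b] and [b1]
   absorbs it. *)
pose del := fine (pi E).
have del0 : 0 < del by rewrite /del fine_gt0 // posN /= ltey_eq Efin.
have br0 : 0 <= b / b1 by rewrite divr_ge0 // ltW.
have r1 : `|b / b1| < 1.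
  by rewrite ger0_norm // ltr_pdivrMr // mul1r.
have := cvg_expr r1 => /cvgrPdist_lt /(_ del del0) [M _ hM].
exists (maxn N M) => // n /= nNM.
have Nn : (N <= n)%N by rewrite (leq_trans _ nNM) // leq_maxl.
have Mn : (M <= n)%N by rewrite (leq_trans _ nNM) // leq_maxr.
have hr : (b / b1) ^+ n < del.
  by have := hM n Mn; rewrite /= sub0r normrN ger0_norm // exprn_ge0.
have mLw : measurable_fun setT (fun t => (L n t w)%:E).
  apply/measurable_EFinP.
  exact: (measurable_fun_pair1 w (mL n)).
apply: (@le_trans _ _ (\int[pi]_(t in E) (L n t w)%:E)%E); last first.
  by apply: ge0_subset_integral => // t _; rewrite lee_fin.
apply: (@le_trans _ _ (\int[pi]_(t in E) (b1 ^+ n * p n w)%:E)%E); last first.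
  apply: ge0_le_integral => //.
  - by move=> t _; rewrite lee_fin mulr_ge0 // exprn_ge0 // ltW.
  - exact: measurable_funTS.
  - move=> t [+ _]; rewrite /ysection /= inE => /(_ n Nn).
    by rewrite /G /dd /= subr_ge0 lee_fin.
have -> : (\int[pi]_(t in E) (b1 ^+ n * p n w)%:E = (b1 ^+ n * p n w * del)%:E)%E.
  by rewrite integral_cst // [RHS]EFinM /del fineK.
rewrite lee_fin.
rewrite mulrAC ler_wpM2r //.
move: hr; rewrite expr_div_n ltr_pdivrMr ?exprn_gt0 // => hr.
by rewrite mulrC ltW.
Qed.

End prior_mass.

(** * Positive part of the logarithmic density ratio *)

Section log_ratio.
Context (R : realType) (k : nat) (dd : measure_display) (T : measurableType dd).
Variables (fs f : 'I_k -> T -> R).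
Hypotheses (mfs : forall i, measurable_fun setT (fs i)).
Hypotheses (mf : forall i, measurable_fun setT (f i)).
Hypotheses (fs0 : forall i y, 0 <= fs i y) (f0 : forall i y, 0 <= f i y).

Definition max_logratio y : \bar R :=
  \big[maxe/-oo%E]_(j < k) elogratio (fs j y) (f j y).

Lemma measurable_elogratio j :
  measurable_fun setT (fun y => elogratio (fs j y) (f j y)).
Proof.
have -> : (fun y => elogratio (fs j y) (f j y)) =
    fun y => if fs j y == 0 then -oo%E else if f j y == 0 then +oo%E
             else (ln (fs j y) - ln (f j y))%:E.
  apply/funext => y; rewrite /elogratio; case: eqP => // /eqP p0.
  case: eqP => // /eqP r0; rewrite ln_div // posrE lt_neqAle eq_sym ?p0 ?r0 //=.
have mln g : measurable_fun setT g -> measurable_fun setT (fun y : T => ln (g y) : R).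
  by move=> mg; apply: measurableT_comp mg; exact: measurable_ln.
apply: measurable_fun_ifT.
- by apply: measurable_fun_eqr => //; exact: measurable_cst.
- exact: measurable_cst.
- apply: measurable_fun_ifT.
  + by apply: measurable_fun_eqr => //; exact: measurable_cst.
  + exact: measurable_cst.
  + by apply/measurable_EFinP; apply: measurable_funB; exact: mln.
Qed.

Lemma measurable_max_logratio : measurable_fun setT max_logratio.
Proof.
rewrite /max_logratio; elim: (index_enum _) => [|j r IH].
  by under eq_fun do rewrite big_nil; exact: measurable_cst.
under eq_fun do rewrite big_cons; apply: measurable_maxe => //.
exact: measurable_elogratio.
Qed.

Lemma le_max_logratio j y : (elogratio (fs j y) (f j y) <= max_logratio y)%E.
Proof. by rewrite /max_logratio (bigD1 j) //= le_max lexx. Qed.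

(** [fine] sends an infinite ratio to 0, so this controls the densities only where [max_logratio] is
    not [+oo]; the observations almost surely stay there. *)
Definition log_gap y : R := fine (maxe (max_logratio y) 0).

Lemma log_gap_ge0 y : 0 <= log_gap y.
Proof. by apply: fine_ge0; rewrite le_max lexx orbT. Qed.

Lemma measurable_log_gap : measurable_fun setT log_gap.
Proof.
apply: (measurableT_comp (fine_measurable measurableT)).
apply: measurable_maxe; last exact: measurable_cst.
exact: measurable_max_logratio.
Qed.

Lemma log_gap_density j y : max_logratio y != +oo%E ->
  fs j y <= expR (log_gap y) * f j y.
Proof.
move=> gn; have [->|p0] := eqVneq (fs j y) 0.
  by rewrite mulr_ge0 // expR_ge0.
have := le_max_logratio j y; rewrite {1}/elogratio (negbTE p0).
have {}p0 : 0 < fs j y by rewrite lt_neqAle eq_sym p0 fs0.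
have [_|r0] := eqVneq (f j y) 0.
  by rewrite leye_eq (negbTE gn).
have {}r0 : 0 < f j y by rewrite lt_neqAle eq_sym r0 f0.
move=> lg; rewrite -ler_pdivrMr // -ler_ln ?posrE ?expR_gt0 ?divr_gt0 // expRK.
rewrite -lee_fin /log_gap fineK; first by rewrite le_max lg.
rewrite fin_numE; apply/andP; split; last first.
  by rewrite neq_lt gt_max ltry lt_neqAle gn leey.
by rewrite -ltNye lt_max ltNyr orbT.
Qed.

Lemma log_gap_weight j y :
  ((log_gap y * fs j y)%:E <= maxe ((fs j y)%:E * max_logratio y) 0)%E.
Proof.
rewrite /log_gap; case: (max_logratio y) => [c| |].
- rewrite -(EFin_max c 0) -EFinM -(EFin_max _ 0) lee_fin le_max [fine _]/=.
  have [c0|c0] := leP 0 c; first by rewrite mulrC lexx.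
  by rewrite mul0r lexx orbT.
- by rewrite maxye /= mul0r le_max lexx orbT.
- by rewrite maxNye /= mul0r le_max lexx orbT.
Qed.

End log_ratio.

Lemma likS_ratio (R : realType) (k : nat) (dd : measure_display)
    (U : measurableType dd) (Q Qs : 'M[R]_k) (f fs : 'I_k -> U -> R)
    (m ms : 'I_k -> R) (n : nat) (y : nat -> U) (h : U -> R) (a c : R) :
  (forall i j, 0 <= Qs i j <= c * Q i j) ->
  (forall i, 0 <= ms i <= a * m i) ->
  (forall i t, (t <= n)%N -> 0 <= fs i (y t) <= expR (h (y t)) * f i (y t)) ->
  likS Qs fs ms n y <=
  a * c ^+ n * expR (\sum_(t < n.+1) h (y t)) * likS Q f m n y.
Proof.
move=> hQ hm hf; rewrite /likS mulr_sumr; apply: ler_sum => x _.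
have -> : a * c ^+ n * expR (\sum_(t < n.+1) h (y t)) *
   (m (x ord0) * \prod_(t < n) Q (x (inord t)) (x (inord t.+1)) *
    \prod_(t < n.+1) f (x t) (y t)) =
   (a * m (x ord0)) * (\prod_(t < n) (c * Q (x (inord t)) (x (inord t.+1)))) *
   \prod_(t < n.+1) (expR (h (y t)) * f (x t) (y t)).
  rewrite !big_split /= prodr_const card_ord -expR_sum; ring.
have m0 := hm (x ord0).
have P1 : 0 <= \prod_(t < n) Qs (x (inord t)) (x (inord t.+1)) <=
    \prod_(t < n) (c * Q (x (inord t)) (x (inord t.+1))).
  by rewrite prodr_ge0 /= ?ler_prod // => t _; have /andP[] := hQ (x (inord t)) (x (inord t.+1)).
have P2 : 0 <= \prod_(t < n.+1) fs (x t) (y t) <=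
    \prod_(t < n.+1) (expR (h (y t)) * f (x t) (y t)).
  have hh (t : 'I_n.+1) := hf (x t) t (ltn_ord t).
  by rewrite prodr_ge0 /= ?ler_prod // => t _; have /andP[] := hh t.
move: m0 P1 P2 => /andP[a1 a2] /andP[b1 b2] /andP[c1 c2].
by rewrite ler_pM // ?mulr_ge0 // ler_pM.
Qed.

Section evidence.
Context (R : realType) (k : nat) (dd : measure_display) (T : measurableType dd).
Variable lam : {sigma_finite_measure set T -> \bar R}.
Variables (Qs : 'M[R]_k) (fs : 'I_k -> T -> R) (ms : 'I_k -> R).
Hypotheses (hQs : is_transition Qs) (hms : is_distribution ms).
Hypothesis hfs : forall i, is_density lam (fs i).
Context (dO : measure_display) (Omega : measurableType dO).
Variables (P : probability Omega R) (X : nat -> Omega -> 'I_k).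
Variable (Y : nat -> Omega -> T).
Hypothesis mX : forall t i, measurable [set w | X t w = i].
Hypothesis mY : forall t, measurable_fun setT (Y t).
Hypothesis hlaw : hmm_law lam Qs fs ms P X Y.

Lemma obs_null (E : set T) t : measurable E ->
  (forall i, dmeasure lam (fs i) E = 0%E) -> P (Y t @^-1` E) = 0%E.
Proof.
move=> mE E0.
have mA : measurable (Y t @^-1` E) by rewrite -[X in measurable X]setTI; exact: mY.
pose po (x : {ffun 'I_t.+1 -> 'I_k}) (s : nat) := x (inord s).
have mpe x : measurable (path_event X (po x) t) by exact: measurable_path_event.
have -> : P (Y t @^-1` E) = (\int[P]_w (\1_(Y t @^-1` E) w)%:E)%E.
  by rewrite integral_indic // setIT.
transitivity (\sum_(x : {ffun 'I_t.+1 -> 'I_k})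
    \int[P]_w (\1_((Y t @^-1` E) `&` path_event X (po x) t) w)%:E)%E.
  rewrite -ge0_integral_sum //; last first.
    by move=> x; apply/measurable_EFinP; apply: measurable_indic; exact: measurableI.
  apply: eq_integral => w _; rewrite sumEFin; congr _%:E.
  under eq_bigr do rewrite indicI /=.
  by rewrite -mulr_sumr sum_path_event mulr1.
apply: big1 => x _; rewrite integral_indic ?setIT //; last exact: measurableI.
pose B s := if s == t then E else setT.
have hl : P [set w | forall s, (s <= t)%N -> X s w = po x s /\ B s (Y s w)] = 0%E.
  rewrite hlaw; last by move=> s; rewrite /B; case: eqP.
  by rewrite big_ord_recr /= {2}/B eqxx E0 !mule0.
rewrite -[RHS]hl; congr (P _).
apply/seteqP; split=> w /=.
  move=> [Ew h] s st; split; first exact: h.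
  by rewrite /B; case: eqP => // ->.
move=> h; split; last by move=> s /h[].
by have [_] := h t (leqnn t); rewrite /B eqxx.
Qed.

Variables (q : R) (Q : 'M[R]_k) (f : 'I_k -> T -> R) (m : 'I_k -> R).
Variables (e eta b1 : R).
Hypothesis hm : is_distribution m.
Hypotheses (q0 : 0 < q) (hth : Theta_q lam q (Q, f)) (hmq : forall i, q <= m i).
Hypotheses (e0 : 0 <= e) (hQe : forall i j, Qs i j <= Q i j + e).
Hypotheses (eta0 : 0 < eta) (eta1 : eta <= 1).
Hypothesis hKL : forall i,
  (\int[lam]_y ((fs i y)%:E * max_logratio fs f y) < (eta ^+ 2)%:E)%E.
Hypotheses (b10 : 0 < b1) (hb1 : b1 * (1 + e / q) * expR (12 * eta) < 1).

(** The initial laws cost [q^-1], each transition [1 + e / q], and the n emissions together at most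
    [expR (12 * eta) ^+ n], where 12 is 4 from [hmm_lln_upper] times 3 from [kl_positive_part]. *)
Lemma likelihood_ratio_lower : {ae P, forall w, \forall n \near \oo,
  b1 ^+ n * lik Qs fs ms n (Y ^~ w) <= lik Q f m n (Y ^~ w)}.
Proof.
have [[hQ Qq] hf] := hth; rewrite /= in hQ Qq hf.
have mf i : measurable_fun setT (f i) by have [] := hf i.
have f0 i y : 0 <= f i y by have [] := hf i.
have mfs i : measurable_fun setT (fs i) by have [] := hfs i.
have fs0 i y : 0 <= fs i y by have [] := hfs i.
pose g := max_logratio fs f; pose h := log_gap fs f.
have mg : measurable_fun setT g by exact: measurable_max_logratio.
have mh : measurable_fun setT h by exact: measurable_log_gap.
have h0 z : 0 <= h z by exact: log_gap_ge0.
have kl i := kl_positive_part (hfs i) (hf i) mg (fun y _ => le_max_logratio fs f i y)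
   eta0 eta1 (hKL i).
have mu i : measurable_fun setT (fun y => maxe ((fs i y)%:E * g y) 0)%E.
  apply: measurable_maxe; last exact: measurable_cst.
  by apply: emeasurable_funM => //; apply/measurable_EFinP.
have u0 i y : (0 <= maxe ((fs i y)%:E * g y) 0)%E by rewrite le_max lexx orbT.
have heps i : (\int[lam]_z (h z * fs i z)%:E <= (3 * eta)%:E)%E.
  apply: le_trans (kl i); apply: ge0_le_integral => //.
  - by move=> z _; rewrite lee_fin mulr_ge0.
  - by apply/measurable_EFinP; exact: measurable_funM.
  - by move=> z _; exact: log_gap_weight.
(* On [E] the ratio is infinite and [log_gap] useless; integrability of the positive part makes [E]
   null for every true emission law. *)
pose E : set T := [set y | g y = +oo%E].
have mE : measurable E.
  rewrite (_ : E = setT `&` g @^-1` [set +oo%E]).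
    by apply: mg => //; exact: emeasurable_set1.
  by apply/seteqP; split=> z //= -[].
have E0 i : dmeasure lam (fs i) E = 0%E.
  rewrite dmeasureE_indic //.
  have iu : lam.-integrable setT (fun y => maxe ((fs i y)%:E * g y) 0)%E.
    apply/integrableP; split=> //.
    under eq_integral do rewrite gee0_abs //.
    exact: le_lt_trans (kl i) (ltry _).
  transitivity (\int[lam]_y (cst 0%E y : \bar R))%E; last by rewrite integral0.
  apply: ge0_ae_eq_integral => //.
  - apply: emeasurable_funM; apply/measurable_EFinP => //; exact: measurable_indic.
  - by move=> y _; rewrite mule_ge0 // lee_fin.
  have := integrable_ae measurableT iu; apply: filterS => y /(_ Logic.I) fy _ /=.
  rewrite indicE; have [/set_mem Ey|_] := boolP (y \in E); last by rewrite mul0e.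
  have [->|p0] := eqVneq (fs i y) 0; first by rewrite mule0.
  have {}p0 : (0 < (fs i y)%:E)%E by rewrite lte_fin lt_neqAle eq_sym p0 fs0.
  by move: fy; rewrite (Ey : g y = _) (gt0_muley p0) maxye.
have nE : {ae P, forall w, forall t, Y t w \notin E}.
  have : P.-negligible (\bigcup_t (Y t @^-1` E)).
    apply: negligible_bigcup => t; exists (Y t @^-1` E); split=> //.
      by rewrite -[X in measurable X]setTI; exact: mY.
    exact: obs_null.
  apply: negligibleS => w /= /existsNP[t /negP]; rewrite negbK => /set_mem Ew.
  by exists t.
have eps3 : 0 < 3 * eta by rewrite mulr_gt0.
have lln := hmm_lln_upper hQs hms hfs mX mY hlaw mh h0 eps3 heps.
move: nE lln; apply: filterS2 => w nEw [N _ hN].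
pose rho := b1 * (1 + e / q) * expR (12 * eta).
have rho1 : rho < 1 by exact: hb1.
have eq0 : 0 <= 1 + e / q by rewrite addr_ge0 // divr_ge0 // ltW.
have eq1 : 1 <= 1 + e / q by rewrite lerDl divr_ge0 // ltW.
have rho0 : 0 <= rho by rewrite !mulr_ge0 ?expR_ge0 // ltW.
have r1 : `|rho| < 1 by rewrite ger0_norm.
(* Waiting until [rho ^+ n < q] absorbs the factor [q^-1] of the initial laws. *)
have := cvg_expr r1 => /cvgrPdist_lt /(_ q q0) [M _ hM].
exists (maxn N (maxn M 1)) => // n /= nNM.
have Nn : (N <= n)%N by rewrite (leq_trans _ nNM) // leq_maxl.
have Mn : (M <= n)%N by rewrite (leq_trans _ nNM) // leq_max leq_maxl orbT.
have n0 : (0 < n)%N by rewrite (leq_trans _ nNM) // leq_max leq_maxr orbT.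
have hr : rho ^+ n < q.
  by have := hM n Mn; rewrite /= sub0r normrN ger0_norm // exprn_ge0.
have hS := hN n Nn.
case: n n0 Nn Mn nNM hr hS => // n _ _ _ _ hr hS /=.
have ratio : likS Qs fs ms n (Y ^~ w) <=
  q^-1 * (1 + e / q) ^+ n * expR (\sum_(t < n.+1) h (Y t w)) * likS Q f m n (Y ^~ w).
  apply: likS_ratio => //.
  - move=> i j; have [Qs0 _] := hQs i; rewrite Qs0 /=.
    apply: (le_trans (hQe i j)); rewrite mulrDl mul1r lerD2l.
    by rewrite mulrAC ler_pdivlMr // ler_wpM2l.
  - move=> i; have [ms0 ms1] := hms; rewrite ms0 /=.
    apply: (@le_trans _ _ 1); last by rewrite mulrC ler_pdivlMr // mul1r.
    by rewrite -[leRHS]ms1 (bigD1 i) //= lerDl sumr_ge0.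
  - move=> i t tn; rewrite fs0 /=; apply: log_gap_density => //.
    by apply/negP => /eqP Et; have := nEw t; rewrite mem_set.
have L0 : 0 <= likS Q f m n (Y ^~ w) by exact: (likS_ge0 (lam := lam)).
have b1n : 0 <= b1 ^+ n.+1 by rewrite exprn_ge0 // ltW.
apply: (le_trans (ler_wpM2l b1n ratio)).
rewrite -[leRHS]mul1r !mulrA ler_wpM2r //.
have S12 : expR (\sum_(t < n.+1) h (Y t w)) <= expR (12 * eta) ^+ n.+1.
  rewrite -expRM_natl ler_expR; move: hS; rewrite mulrC mulrA -natrM; lra.
have en : (1 + e / q) ^+ n <= (1 + e / q) ^+ n.+1 by rewrite exprS ler_peMl // exprn_ge0.
apply: (@le_trans _ _ (rho ^+ n.+1 / q)); last by rewrite ler_pdivrMr // mul1r ltW.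
have -> : rho ^+ n.+1 / q =
    b1 ^+ n.+1 / q * (1 + e / q) ^+ n.+1 * expR (12 * eta) ^+ n.+1.
  by rewrite /rho [in LHS]exprMn [in LHS]exprMn; ring.
have bq : 0 <= b1 ^+ n.+1 / q by rewrite divr_ge0 // ltW.
apply: ler_pM; [|exact: expR_ge0|exact: ler_wpM2l|exact: S12].
by apply: mulr_ge0 => //; rewrite exprn_ge0.
Qed.

End evidence.

(** * Posterior decay on tested sets *)

Section geometric.
Context (R : realType).

(** Turns decay per block into decay per observation. By Bernoulli's inequality [z ^+ p] is at least
    [1 - (1 - x) / 2], hence at least [x]; the constant [z ^- p] pays for the incomplete block. *)
Lemma geometric_divn (x : R) p : 0 <= x < 1 -> (0 < p)%N ->
  exists C z : R, [/\ 0 < C, 0 < z < 1 & forall n, x ^+ (n %/ p) <= C * z ^+ n].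
Proof.
move=> /andP[x0 x1] p0.
have pR : 0 < p%:R :> R by rewrite ltr0n.
have pR1 : 1 <= p%:R :> R by rewrite ler1n.
pose d : R := (1 - x) / 2 / p%:R.
have d0 : 0 < d by rewrite !divr_gt0 // subr_gt0.
have d1 : d <= 1 / 2.
  by rewrite /d ler_pdivrMr // (@le_trans _ _ (1 / 2)) ?ler_peMr //; lra.
pose z := 1 - d.
have z0 : 0 < z by rewrite /z; lra.
have z1 : z < 1 by rewrite /z; lra.
have bern j : 1 - j%:R * d <= z ^+ j.
  elim: j => [|j IH]; first by rewrite mul0r subr0 expr0.
  rewrite exprS; have := ler_wpM2l (ltW z0) IH; apply: le_trans.
  rewrite /z -natr1; have : 0 <= j%:R * (d * d) by rewrite mulr_ge0 // mulr_ge0 // ltW.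
  lra.
have zp : x <= z ^+ p.
  have pd : p%:R * d = (1 - x) / 2 by rewrite /d mulrC divfK ?gt_eqF.
  by apply: le_trans (bern p); rewrite pd; lra.
exists (z ^- p), z; split; [by rewrite invr_gt0 exprn_gt0|by rewrite z0|].
move=> n; rewrite {2}(divn_eq n p) exprD [(_ * p)%N]mulnC exprM.
apply: (@le_trans _ _ ((z ^+ p) ^+ (n %/ p))).
  by apply: lerXn2r => //; rewrite nnegrE // exprn_ge0 // ltW.
rewrite mulrCA ler_peMr // ?exprn_ge0 ?exprn_ge0 ?(ltW z0) //.
rewrite mulrC ler_pdivlMr ?exprn_gt0 // mul1r.
by apply: ler_wiXn2l; rewrite ?(ltW z0) ?(ltW z1) // ltnW // ltn_pmod.
Qed.

Lemma ae_cvg0_geometric (d : measure_display) (T : measurableType d)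
    (mu : {measure set T -> \bar R}) (f : (T -> \bar R)^nat) (C z : R) :
  (forall n, measurable_fun setT (f n)) -> (forall n x, 0 <= f n x)%E ->
  0 <= C -> 0 <= z < 1 ->
  (forall n, \int[mu]_x f n x <= (C * z ^+ n)%:E)%E ->
  {ae mu, forall x, f n x @[n --> \oo] --> 0%E}.
Proof.
move=> mf f0 C0 /andP[z0 z1] hf; apply: ae_cvg0_summable => //.
apply: (@le_lt_trans _ _ (C / (1 - z))%:E); last exact: ltry.
apply: lime_le.
  by apply: is_cvg_nneseries => n _ _; exact: integral_ge0.
near=> n; apply: (@le_trans _ _ (\sum_(0 <= i < n) (C * z ^+ i)%:E)%E).
  by apply: lee_sum => i _; exact: hf.
rewrite sumEFin lee_fin -mulr_sumr ler_wpM2l //.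
have h1 : 0 < 1 - z by rewrite subr_gt0.
rewrite -[leRHS]mul1r ler_pdivlMr // big_mkord.
have -> : (\sum_(i < n) z ^+ i) * (1 - z) = 1 - z ^+ n.
  elim: (n) => [|j IH]; first by rewrite big_ord0 mul0r expr0 subrr.
  by rewrite big_ord_recr /= mulrDl IH exprS; ring.
by rewrite gerBl exprn_ge0.
Unshelve. all: by end_near. Qed.

End geometric.

Lemma measurable_ge0_inv (R : realType) (d : measure_display)
    (T : measurableType d) (f : T -> R) :
  measurable_fun setT f -> (forall x, 0 <= f x) ->
  measurable_fun setT (fun x => (f x)^-1).
Proof.
move=> mf f0.
have -> : (fun x => (f x)^-1) =
    fun x => if f x == 0 then 0 else expR (- ln (f x)).
  apply/funext => x; case: eqP => [->|/eqP fn]; first by rewrite invr0.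
  by rewrite expRN lnK // posrE lt_neqAle eq_sym fn f0.
apply: measurable_fun_ifT; last 2 first.
- exact: measurable_cst.
- apply: (measurableT_comp (@measurable_expR R)).
  by apply: measurableT_comp => //; apply: measurableT_comp mf; exact: measurable_ln.
by apply: measurable_fun_eqr => //; exact: measurable_cst.
Qed.

(** * Change of measure from the true parameter to the prior *)

Section change_of_measure.
Context (R : realType) (k : nat) (dd : measure_display) (T : measurableType dd).
Variable lam : {sigma_finite_measure set T -> \bar R}.
Context (dp : measure_display) (Tp : measurableType dp) (pi : probability Tp R).
Variables (Qt : Tp -> 'M[R]_k) (ft : Tp -> 'I_k -> T -> R) (m : 'I_k -> R).
Hypotheses (hm : is_distribution m) (hQt : forall t, is_transition (Qt t)).
Hypothesis hft : forall t i, is_density lam (ft t i).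
Hypothesis mQt : forall i j, measurable_fun setT (fun t => Qt t i j).
Hypothesis mft : forall i, measurable_fun setT (fun p : Tp * T => ft p.1 i p.2).

Lemma measurable_likS_joint (ds : measure_display) (S : measurableType ds)
    (y : nat -> S -> T) n :
  (forall t, measurable_fun setT (y t)) ->
  measurable_fun setT
    (fun ts : Tp * S => likS (Qt ts.1) (ft ts.1) m n (y ^~ ts.2)).
Proof.
move=> my; under eq_fun do rewrite likS_fwd.
have mQ i j : measurable_fun setT (fun ts : Tp * S => Qt ts.1 i j).
  by apply: (measurableT_comp (mQt i j)); exact: measurable_fst.
have mF i t : measurable_fun setT (fun ts : Tp * S => ft ts.1 i (y t ts.2)).
  have mp : measurable_fun setT (fun ts : Tp * S => (ts.1, y t ts.2)).
    apply: measurable_fun_pair; first exact: measurable_fst.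
    by apply: (measurableT_comp (my t)); exact: measurable_snd.
  exact: (measurableT_comp (mft i) mp).
apply: measurable_sum => j; elim: n j => [|n IH] j /=.
  by apply: measurable_funM => //; exact: measurable_cst.
apply: measurable_funM => //; apply: measurable_sum => i.
exact: measurable_funM.
Qed.

Variables (Qs : 'M[R]_k) (fs : 'I_k -> T -> R) (ms : 'I_k -> R).
Hypotheses (hQs : is_transition Qs) (hms : is_distribution ms).
Hypothesis hfs : forall i, is_density lam (fs i).
Context (dO : measure_display) (Omega : measurableType dO).
Variables (P : probability Omega R) (X : nat -> Omega -> 'I_k).
Variable (Y : nat -> Omega -> T).
Hypothesis mX : forall t i, measurable [set w | X t w = i].
Hypothesis mY : forall t, measurable_fun setT (Y t).
Hypothesis hlaw : hmm_law lam Qs fs ms P X Y.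

Lemma likS_adapted (Q : 'M[R]_k) f m' n (y y' : nat -> T) :
  (forall t, (t <= n)%N -> y t = y' t) -> likS Q f m' n y = likS Q f m' n y'.
Proof. by move=> e; rewrite !likS_fwd (fwd_adapted _ _ _ e). Qed.

Lemma measurable_evidence (V : set Tp) (ds : measure_display)
    (S : measurableType ds) (y : nat -> S -> T) n : measurable V ->
  (forall t, measurable_fun setT (y t)) ->
  measurable_fun setT
    (fun s => \int[pi]_(t in V) (likS (Qt t) (ft t) m n (y ^~ s))%:E)%E.
Proof.
move=> mV my.
pose F (ts : Tp * S) : \bar R := (\1_V ts.1 * likS (Qt ts.1) (ft ts.1) m n (y ^~ ts.2))%:E.
have mF : measurable_fun setT F.
  apply/measurable_EFinP; apply: measurable_funM; last exact: measurable_likS_joint.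
  by apply: (measurableT_comp (measurable_indic mV)); exact: measurable_fst.
have F0 ts : (0 <= F ts)%E by rewrite lee_fin mulr_ge0 //; exact: (likS_ge0 (lam := lam)).
have := @measurable_fun_fubini_tonelli_G _ _ _ _ _ pi F mF F0.
rewrite (_ : fubini_G _ _ = fun s => \int[pi]_(t in V) (likS (Qt t) (ft t) m n (y ^~ s))%:E)%E //.
apply/funext => s; rewrite /fubini_G [RHS]integral_mkcond; apply: eq_integral => t _.
by rewrite /F /patch indicE; case: (t \in V); rewrite ?mul1r ?mul0r.
Qed.

(** The true likelihood in the denominator cancels the density of the observations; Tonelli's
    theorem then leaves the mean of [H] under each parameter of [V], averaged over the prior. *)
Lemma change_of_measure (V : set Tp) n (H : (nat -> T) -> R) (r : R) :
  measurable V -> adapted lam n H -> 0 <= r ->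
  (forall t, V t -> (\int[nmeas lam n]_y
     (H (nacc y) * likS (Qt t) (ft t) m n (nacc y))%:E <= r%:E)%E) ->
  (\int[P]_w ((H (Y ^~ w) / likS Qs fs ms n (Y ^~ w))%:E *
     \int[pi]_(t in V) (likS (Qt t) (ft t) m n (Y ^~ w))%:E) <= r%:E)%E.
Proof.
move=> mV [H0 _ Ha Hm] r0 hV.
pose I (y : ntype lam n) := (\int[pi]_(t in V) (likS (Qt t) (ft t) m n (nacc y))%:E)%E.
have mI : measurable_fun setT I.
  apply: measurable_evidence => // t; exact: measurable_nacc.
have I0 y : (0 <= I y)%E.
  by apply: integral_ge0 => t _; rewrite lee_fin; exact: (likS_ge0 (lam := lam)).
have ps0 y : 0 <= likS Qs fs ms n y by exact: (likS_ge0 (lam := lam)).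
have mps : measurable_fun setT (fun y : ntype lam n => likS Qs fs ms n (nacc y)).
  exact: measurable_likS.
pose F (y : ntype lam n) : \bar R := ((H (nacc y) / likS Qs fs ms n (nacc y))%:E * I y)%E.
have mF : measurable_fun setT F.
  apply: emeasurable_funM => //; apply/measurable_EFinP; apply: measurable_funM => //.
  exact: measurable_ge0_inv.
have F0 y : (0 <= F y)%E by rewrite mule_ge0 // lee_fin divr_ge0.
have -> : (\int[P]_w ((H (Y ^~ w) / likS Qs fs ms n (Y ^~ w))%:E *
     \int[pi]_(t in V) (likS (Qt t) (ft t) m n (Y ^~ w))%:E) =
   \int[P]_w F (nobs lam n (Y ^~ w)))%E.
  apply: eq_integral => w _; rewrite /F /I.
  have e t : (t <= n)%N -> Y t w = nacc (nobs lam n (Y ^~ w)) t.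
    by move=> tn; rewrite nacc_nobs.
  rewrite (Ha _ _ e) (likS_adapted _ _ _ e); congr (_ * _)%E.
  by apply: eq_integral => t _; rewrite (likS_adapted _ _ _ e).
rewrite (ge0_integral_obs_law hQs hms hfs mX mY hlaw mF F0).
pose G (ty : Tp * ntype lam n) : \bar R :=
  (\1_V ty.1 * (H (nacc ty.2) * likS (Qt ty.1) (ft ty.1) m n (nacc ty.2)))%:E.
have mHs : measurable_fun setT (fun ty : Tp * ntype lam n => H (nacc ty.2)).
  exact: (measurableT_comp Hm measurable_snd).
have mG : measurable_fun setT G.
  apply/measurable_EFinP; apply: measurable_funM.
    by apply: (measurableT_comp (measurable_indic mV)); exact: measurable_fst.
  apply: measurable_funM => //.
  apply: (measurable_likS_joint (y := fun t (y : ntype lam n) => nacc y t)).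
  by move=> t; exact: measurable_nacc.
have G0 ty : (0 <= G ty)%E.
  by rewrite lee_fin !mulr_ge0 //; exact: (likS_ge0 (lam := lam)).
have mHI : measurable_fun setT (fun y : ntype lam n => (H (nacc y))%:E * I y)%E.
  by apply: emeasurable_funM => //; exact/measurable_EFinP.
apply: (@le_trans _ _ (\int[nmeas lam n]_y ((H (nacc y))%:E * I y))%E).
  apply: ge0_le_integral => //.
  - by move=> y _; rewrite mule_ge0 // lee_fin.
  - by apply: emeasurable_funM => //; exact/measurable_EFinP.
  - move=> y _; rewrite /F muleAC -EFinM lee_wpmul2r // lee_fin.
    (* Where the true likelihood vanishes the quotient is 0 by convention, hence an inequality
       instead of an equality. *)
    have [->|p0] := eqVneq (likS Qs fs ms n (nacc y)) 0; first by rewrite mulr0.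
    by rewrite divfK.
have -> : (\int[nmeas lam n]_y ((H (nacc y))%:E * I y) =
    \int[nmeas lam n]_y \int[pi]_t G (t, y))%E.
  apply: eq_integral => y _; rewrite /I -ge0_integralZl //; last 3 first.
  - apply/measurable_EFinP; apply: measurable_funTS.
    have := @measurable_likS_joint _ _ (fun t (y : ntype lam n) => nacc y t) n
      (fun t => measurable_nacc (lam := lam) t).
    by move=> /(measurable_fun_pair1 y).
  - by move=> t _; rewrite lee_fin; exact: (likS_ge0 (lam := lam)).
  - by rewrite lee_fin.
  rewrite integral_mkcond; apply: eq_integral => t _; rewrite /G /patch indicE.
  by case: (t \in V); rewrite ?mul1r ?mul0r // -EFinM.
rewrite -(@fubini_tonelli _ _ _ _ _ pi (nmeas lam n) G) //.
have le1 : (\int[pi]_t \int[nmeas lam n]_y G (t, y) <= \int[pi]_t (cst r%:E t))%E.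
  apply: ge0_le_integral => //.
  - by move=> t _; apply: integral_ge0.
  - exact: (@measurable_fun_fubini_tonelli_F _ _ _ _ _ (nmeas lam n) G mG G0).
  - move=> t _ /=; rewrite /G /=; have [/set_mem tV|tV] := boolP (t \in V).
      under eq_integral do rewrite indicE mem_set // mul1r.
      exact: hV.
    by rewrite integral0_eq ?lee_fin // => y _; rewrite indicE (negbTE tV) mul0r.
apply: (le_trans le1); rewrite integral_cst //.
by rewrite -[leRHS]mule1 lee_wpmul2l ?lee_fin // probability_le1.
Qed.

End change_of_measure.

(** * Tests along the observations *)

Section posterior_tests.
Context (R : realType) (k : nat) (dd : measure_display) (T : measurableType dd).
Variable lam : {sigma_finite_measure set T -> \bar R}.
Context (dp : measure_display) (Tp : measurableType dp) (pi : probability Tp R).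
Variables (Qt : Tp -> 'M[R]_k) (ft : Tp -> 'I_k -> T -> R) (m : 'I_k -> R).
Hypotheses (hm : is_distribution m) (hQt : forall t, is_transition (Qt t)).
Hypothesis hft : forall t i, is_density lam (ft t i).
Hypothesis mQt : forall i j, measurable_fun setT (fun t => Qt t i j).
Hypothesis mft : forall i, measurable_fun setT (fun p : Tp * T => ft p.1 i p.2).
Variables (Qs : 'M[R]_k) (fs : 'I_k -> T -> R) (ms : 'I_k -> R).
Hypotheses (hQs : is_transition Qs) (hms : is_distribution ms).
Hypothesis hfs : forall i, is_density lam (fs i).
Context (dO : measure_display) (Omega : measurableType dO).
Variables (P : probability Omega R) (X : nat -> Omega -> 'I_k).
Variable (Y : nat -> Omega -> T).
Hypothesis mX : forall t i, measurable [set w | X t w = i].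
Hypothesis mY : forall t, measurable_fun setT (Y t).
Hypothesis hlaw : hmm_law lam Qs fs ms P X Y.

Let ps n w := likS Qs fs ms n (Y ^~ w).
Let ev (V : set Tp) n w := (\int[pi]_(t in V) (likS (Qt t) (ft t) m n (Y ^~ w))%:E)%E.

Let ps0 n w : 0 <= ps n w.
Proof. exact: (likS_ge0 (lam := lam)). Qed.

Let ev0 V n w : (0 <= ev V n w)%E.
Proof. by apply: integral_ge0 => t _; rewrite lee_fin; exact: (likS_ge0 (lam := lam)). Qed.

Let mev V n : measurable V -> measurable_fun setT (ev V n).
Proof.
move=> mV.
exact: (@measurable_evidence _ _ _ _ lam _ _ pi Qt ft m hm hQt hft mQt mft V _ _ Y n mV mY).
Qed.

Lemma measurable_adapted_obs n F : adapted lam n F ->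
  measurable_fun setT (fun w => F (Y ^~ w)).
Proof.
move=> [_ _ Fa Fm].
rewrite (_ : (fun w => _) = fun w => F (nacc (nobs lam n (Y ^~ w)))).
  exact: (measurableT_comp Fm (@measurable_nobs _ _ _ lam _ _ Y n mY)).
by apply/funext => w; apply: Fa => t tn; rewrite nacc_nobs.
Qed.

Lemma measurable_likS_obs n :
  measurable_fun setT (fun w => likS Qs fs ms n (Y ^~ w)).
Proof.
have := measurableT_comp (@measurable_likS _ _ _ _ lam Qs fs ms hfs n n)
  (@measurable_nobs _ _ _ lam _ _ Y n mY).
rewrite (_ : _ \o _ = ps n) //; apply/funext => w /=; apply: likS_adapted => t tn.
by rewrite nacc_nobs.
Qed.

Let mps n : measurable_fun setT (ps n) := @measurable_likS_obs n.

Lemma likS_true_gt0 : {ae P, forall w n, 0 < likS Qs fs ms n (Y ^~ w)}.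
Proof.
have nul n : P.-negligible [set w | ps n w = 0].
  have mA : measurable [set w | ps n w = 0].
    rewrite (_ : [set w | _] = setT `&` ps n @^-1` [set 0]).
      by apply: mps => //; exact: measurable_set1.
    by apply/seteqP; split=> z //= -[].
  exists [set w | ps n w = 0]; split => //.
  pose Z : set (ntype lam n) := [set y | likS Qs fs ms n (nacc y) = 0].
  have mZ : measurable Z.
    rewrite (_ : Z = setT `&` (fun y : ntype lam n => likS Qs fs ms n (nacc y)) @^-1` [set 0]).
      exact: (@measurable_likS _ _ _ _ lam Qs fs ms hfs n n measurableT _ (measurable_set1 0)).
    by apply/seteqP; split=> z //= -[].
  have i0 : (\int[nmeas lam n]_y ((\1_Z y)%:E * (likS Qs fs ms n (nacc y))%:E) = 0)%E.
    apply: integral0_eq => y _; rewrite indicE; have [/set_mem Zy|_] := boolP (y \in Z).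
      by rewrite (Zy : likS _ _ _ _ _ = 0) mule0.
    by rewrite mul0e.
  have mI : measurable_fun setT (fun y => (\1_Z y)%:E : \bar R).
    by apply/measurable_EFinP; exact: measurable_indic.
  have I0 y : (0 <= (\1_Z y)%:E :> \bar R)%E by rewrite lee_fin.
  have h := ge0_integral_obs_law hQs hms hfs mX mY hlaw mI I0; rewrite i0 in h.
  transitivity (\int[P]_w (\1_[set w | ps n w = 0] w)%:E)%E.
    by rewrite integral_indic // setIT.
  transitivity (\int[P]_w (\1_Z (nobs lam n (Y ^~ w)))%:E)%E; last exact: h.
  apply: eq_integral => w _; congr _%:E; rewrite !indicE; congr (_%:R).
  congr (nat_of_bool _); apply/idP/idP => /set_mem /= h1; apply/mem_set => /=.
    by rewrite /Z /= -[RHS]h1; apply: likS_adapted => t tn; rewrite nacc_nobs.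
  by rewrite -[RHS]h1; apply: likS_adapted => t tn; rewrite nacc_nobs.
have := negligible_bigcup nul; apply: negligibleS => w /= /existsNP[n /negP h].
by exists n => //=; apply/eqP; rewrite eq_le ps0 andbT leNgt.
Qed.

(** The case [H = 1] of the change of measure: the evidence divided by the true likelihood has mean
    at most 1, and the true likelihood is almost surely positive. *)
Lemma evidence_lty : {ae P, forall w n,
  (\int[pi]_t (likS (Qt t) (ft t) m n (Y ^~ w))%:E < +oo)%E}.
Proof.
have fin n : {ae P, forall w, ((1 / ps n w)%:E * ev setT n w)%E \is a fin_num}.
  have mf : measurable_fun setT (fun w => (1 / ps n w)%:E * ev setT n w)%E.
    apply: emeasurable_funM; last exact: mev.
    apply/measurable_EFinP; apply: measurable_funM; first exact: measurable_cst.
    exact: measurable_ge0_inv.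
  have nn w : (0 <= (1 / ps n w)%:E * ev setT n w)%E.
    by rewrite mule_ge0 // lee_fin divr_ge0.
  have i1 : P.-integrable setT (fun w => (1 / ps n w)%:E * ev setT n w)%E.
    apply/integrableP; split=> //; under eq_integral do rewrite gee0_abs //.
    apply: (@le_lt_trans _ _ 1%E); last exact: ltry.
    apply: (@change_of_measure _ _ _ _ lam _ _ pi Qt ft m hm hQt hft mQt mft _ _ _
      hQs hms hfs _ _ P X Y mX mY hlaw setT n (fun=> 1) 1) => //.
      exact: adapted1.
    move=> t _; have := mass1 (hQt t) hm (hft t) n.
    by rewrite mass_likS => ->.
  by have := integrable_ae measurableT i1; apply: filterS => w; apply.
have all : {ae P, forall w n, ((1 / ps n w)%:E * ev setT n w)%E \is a fin_num}.
  exact: ae_foralln.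
move: likS_true_gt0 all; apply: filterS2 => w pos h n.
have := h n; have ip : 0 < 1 / ps n w by rewrite divr_gt0 // pos.
rewrite -/(ev setT n w); have := ev0 setT n w; case: (ev setT n w) => [x _ _| |] //; first exact: ltry.
by rewrite gt0_muley ?lte_fin.
Qed.

Variables (V : set Tp) (p : nat) (g1 g2 g3 : T -> R) (tau c kap : R).
Hypotheses (mV : measurable V).
Hypotheses (u1 : unit_fun g1) (u2 : unit_fun g2) (u3 : unit_fun g3).
Hypotheses (c_itv : -1 <= c <= 2) (kap_itv : 0 < kap <= 1).
Hypotheses (tau0 : tau != 0) (tau_kap : 8 * `|tau| <= kap).
Hypothesis hV : forall t, V t -> forall i,
  1 + tau * (iter p.+1 (mxapp (Qt t)) (window (Qt t) (omean lam (ft t) g1)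
    (omean lam (ft t) g2) (omean lam (ft t) g3)) i - c) <= 1 - `|tau| * kap.
Hypothesis hs : forall i,
  1 - tau * (iter p.+1 (mxapp Qs) (window Qs (omean lam fs g1)
    (omean lam fs g2) (omean lam fs g3)) i - c) <= 1 - `|tau| * kap.

Let tp : 0 < `|tau|. Proof. by rewrite normr_gt0. Qed.

Let tc : `|tau| * (1 + `|c|) <= 1.
Proof.
have c2 : `|c| <= 2 by rewrite ler_norml; move: c_itv => /andP[]; lra.
have t8 : `|tau| <= 1 / 8 by move: tau_kap kap_itv => ? /andP[]; lra.
have : `|tau| * (1 + `|c|) <= 1 / 8 * (1 + 2).
  by apply: ler_pM; rewrite ?normr_ge0 ?addr_ge0 // lerD2l.
lra.
Qed.

Let rho : R := 1 - `|tau| * kap.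

Let tk : 8 * `|tau| ^+ 2 <= `|tau| * kap /\ `|tau| * kap <= 1 / 8.
Proof.
split; first by have := ler_wpM2l (ltW tp) tau_kap; rewrite expr2; lra.
have t8 : `|tau| <= 1 / 8 by move: tau_kap kap_itv => ? /andP[]; lra.
have : `|tau| * kap <= 1 / 8 * 1.
  by move: kap_itv => /andP[/ltW ? ?]; apply: ler_pM.
lra.
Qed.

Let rho_itv : 0 < rho < 1.
Proof.
have tk0 : 0 < `|tau| * kap by rewrite mulr_gt0 //; have /andP[] := kap_itv.
by have [_ h] := tk; rewrite /rho; apply/andP; split; lra.
Qed.

Let test t0 n (s : nat -> T) := test_stat g1 g2 g3 t0 c p (n %/ p.+3) s.

Let tcN : `|- tau| * (1 + `|c|) <= 1. Proof. by rewrite normrN. Qed.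

Let adapted_test t0 n : `|t0| * (1 + `|c|) <= 1 -> adapted lam n (test t0 n).
Proof.
move=> h; apply: adapted_leq (leq_trunc_div n p.+3) _.
exact: adapted_test_stat.
Qed.

Let test_ge0 t0 n s : `|t0| * (1 + `|c|) <= 1 -> 0 <= test t0 n s.
Proof. by move=> h; have [] := @adapted_test t0 n h. Qed.

(** The product of two opposite factors is [1 - tau ^+ 2 * (psi - c) ^+ 2], and [c_itv] keeps
    [psi - c] within [-2, 2]. The condition [8 * |tau| <= kap] places [rho] strictly below
    [rho']. *)
Let rho' : R := 1 - 4 * `|tau| ^+ 2.

Let rho'_gt : rho < rho' /\ 0 < rho'.
Proof.
have t2 : 0 < `|tau| ^+ 2 by rewrite exprn_gt0.
by have [h1 h2] := tk; rewrite /rho /rho'; split; lra.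
Qed.

Let test_prod n s : rho' ^+ (n %/ p.+3) <= test tau n s * test (- tau) n s.
Proof.
rewrite /test /test_stat -big_split /= -[X in _ ^+ X]card_ord -prodr_const.
apply: ler_prod => j _; rewrite (ltW rho'_gt.2) /=.
rewrite /block_factor; set psi := (X in X - c).
have /andP[a b] : 0 <= psi <= 1.
  rewrite /psi; move: (j * p.+3 + p)%N => n'.
  have /andP[? ?] := u1.2 (s n'.+1); have /andP[? ?] := u2.2 (s n'.+2).
  have /andP[? ?] := u3.2 (s n'.+3).
  by rewrite !mulr_ge0 //= !mulr_ile1 // mulr_ge0.
have -> : (1 + tau * (psi - c)) * (1 + - tau * (psi - c)) = 1 - tau ^+ 2 * (psi - c) ^+ 2.
  ring.
have h : (psi - c) ^+ 2 <= 4.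
  have /andP[c1 c2] := c_itv.
  have : 0 <= (2 - (psi - c)) * (2 + (psi - c)) by rewrite mulr_ge0 //; lra.
  lra.
have : tau ^+ 2 * (psi - c) ^+ 2 <= 4 * `|tau| ^+ 2.
  by rewrite real_normK ?num_real // mulrC ler_wpM2r // sqr_ge0.
by rewrite /rho'; lra.
Qed.

(** Under the true parameter the test with [- tau] has mean at most [rho ^+ J] on [J] blocks, hence
    is eventually below [rho' ^+ J]. Since the product of both tests is at least [rho' ^+ J], the
    other one has to reach 1. *)
Let tests_cvg : {ae P, forall w, \forall n \near \oo, 1 <= test tau n (Y ^~ w)}.
Proof.
have [rr r0] := rho'_gt; have /andP[rho0 rho1] := rho_itv.
have x_itv : 0 <= rho / rho' < 1.
  by rewrite divr_ge0 ?(ltW r0) ?(ltW rho0) //= ltr_pdivrMr // mul1r.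
have [C [z [C0 /andP[z0 z1] hC]]] := geometric_divn x_itv (ltn0Sn p.+2).
have aN n := @adapted_test (- tau) n tcN.
pose F n w : \bar R := (test (- tau) n (Y ^~ w) / rho' ^+ (n %/ p.+3))%:E.
have mF n : measurable_fun setT (F n).
  apply/measurable_EFinP; apply: measurable_funM; last exact: measurable_cst.
  exact: (measurable_adapted_obs (aN n)).
have F0 n w : (0 <= F n w)%E.
  by rewrite lee_fin divr_ge0 ?exprn_ge0 ?(ltW r0) //; exact: test_ge0.
have hF n : (\int[P]_w F n w <= (C * z ^+ n)%:E)%E.
  apply: (@le_trans _ _ ((rho / rho') ^+ (n %/ p.+3))%:E); last by rewrite lee_fin.
  have i0 : 0 <= (rho' ^+ (n %/ p.+3))^-1 by rewrite invr_ge0 exprn_ge0 // ltW.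
  have iE : (0 <= ((rho' ^+ (n %/ p.+3))^-1)%:E)%E by rewrite lee_fin.
  have [H0 _ Ha Hm] := aN n.
  have mT : measurable_fun setT (fun y : ntype lam n => (test (- tau) n (nacc y))%:E).
    exact/measurable_EFinP.
  have -> : (\int[P]_w F n w = ((rho' ^+ (n %/ p.+3))^-1)%:E *
      \int[P]_w (test (- tau) n (nacc (nobs lam n (Y ^~ w))))%:E)%E.
    rewrite -ge0_integralZl //; last 2 first.
    - exact: (measurableT_comp mT (@measurable_nobs _ _ _ lam _ _ Y n mY)).
    - by move=> w _; rewrite lee_fin.
    apply: eq_integral => w _; rewrite /F mulrC EFinM; congr (_ * _%:E)%E.
    by apply: Ha => t tn; rewrite nacc_nobs.
  have T0 (y : ntype lam n) : (0 <= (test (- tau) n (nacc y))%:E)%E by rewrite lee_fin.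
  rewrite (ge0_integral_obs_law hQs hms hfs mX mY hlaw mT T0).
  rewrite expr_div_n mulrC EFinM; apply: lee_wpmul2l => //.
  have hs' i : 1 + - tau * (iter p.+1 (mxapp Qs) (window Qs (omean lam fs g1)
    (omean lam fs g2) (omean lam fs g3)) i - c) <= rho by have := hs i; rewrite /rho; lra.
  have := test_stat_bound hQs hms hfs n u1 u2 u3 tcN (ltW rho0) hs'.
  by under eq_integral do rewrite EFinM.
have z01 : 0 <= z < 1 by rewrite (ltW z0).
have := ae_cvg0_geometric mF F0 (ltW C0) z01 hF; apply: filterS => w cv.
have /fine_cvgP[_ /cvgrPdist_lt /(_ 1 ltr01) [N _ hN]] := cv.
exists N => // n Nn; have := hN n Nn; rewrite /= sub0r normrN.
have rn : 0 < rho' ^+ (n %/ p.+3) by rewrite exprn_gt0.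
have t0 := @test_ge0 (- tau) n (Y ^~ w) tcN.
rewrite ger0_norm; last by rewrite divr_ge0 // ltW.
rewrite ltr_pdivrMr // mul1r => lt1.
have tp1 := test_prod n (Y ^~ w).
have t1 := @test_ge0 tau n (Y ^~ w) tc.
rewrite leNgt; apply/negP => lt2.
have : test tau n (Y ^~ w) * test (- tau) n (Y ^~ w) <= test (- tau) n (Y ^~ w).
  by rewrite ler_piMl // ltW.
by move: tp1 lt1; lra.
Qed.

Lemma posterior_test : exists2 z : R, 0 < z < 1 &
  {ae P, forall w, \forall n \near \oo,
    (\int[pi]_(t in V) (likS (Qt t) (ft t) m n (Y ^~ w))%:E
     <= (z ^+ n * likS Qs fs ms n (Y ^~ w))%:E)%E}.
Proof.
have /andP[rho0 rho1] := rho_itv.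
have x_itv : 0 <= rho < 1 by rewrite (ltW rho0).
have [C [z1 [C0 /andP[z0 z11] hC]]] := geometric_divn x_itv (ltn0Sn p.+2).
pose z := (1 + z1) / 2.
have zz : z1 < z by rewrite /z; lra.
have zp : 0 < z by exact: lt_trans zz.
have zlt : z < 1 by rewrite /z; lra.
exists z; first by rewrite zp.
have at1 n := @adapted_test tau n tc.
pose F n w : \bar R := ((z ^+ n)^-1%:E *
  ((test tau n (Y ^~ w) / ps n w)%:E * ev V n w))%E.
have zn n : 0 < z ^+ n by rewrite exprn_gt0.
have ziE n : (0 <= ((z ^+ n)^-1)%:E)%E by rewrite lee_fin invr_ge0 ltW.
have in0 n w : (0 <= (test tau n (Y ^~ w) / ps n w)%:E * ev V n w)%E.
  by rewrite mule_ge0 // lee_fin divr_ge0 //; exact: test_ge0.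
have F0 n w : (0 <= F n w)%E by rewrite mule_ge0.
have min n : measurable_fun setT
    (fun w => (test tau n (Y ^~ w) / ps n w)%:E * ev V n w)%E.
  apply: emeasurable_funM; last exact: mev.
  apply/measurable_EFinP; apply: measurable_funM; last exact: measurable_ge0_inv.
  exact: (measurable_adapted_obs (at1 n)).
have mF n : measurable_fun setT (F n).
  by apply: emeasurable_funM => //; exact: measurable_cst.
have hF n : (\int[P]_w F n w <= (C * (z1 / z) ^+ n)%:E)%E.
  rewrite /F ge0_integralZl //.
  apply: (@le_trans _ _ (((z ^+ n)^-1)%:E * (C * z1 ^+ n)%:E)%E); last first.
    rewrite -EFinM lee_fin le_eqVlt; apply/predU1P; left.
    by rewrite [(z1 / z) ^+ n]expr_div_n; move: (z ^+ n) => zn'; ring.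
  apply: lee_wpmul2l => //.
  apply: (@le_trans _ _ (rho ^+ (n %/ p.+3))%:E); last by rewrite lee_fin.
  apply: (@change_of_measure _ _ _ _ lam _ _ pi Qt ft m hm hQt hft mQt mft _ _ _
      hQs hms hfs _ _ P X Y mX mY hlaw V n (test tau n)) => //.
    by rewrite exprn_ge0 // ltW.
  move=> t Vt; exact: (test_stat_bound (hQt t) hm (hft t) n u1 u2 u3 tc (ltW rho0) (hV Vt)).
have zz01 : 0 <= z1 / z < 1.
  by rewrite divr_ge0 ?(ltW z0) ?(ltW zp) //= ltr_pdivrMr // mul1r.
have cv := ae_cvg0_geometric mF F0 (ltW C0) zz01 hF.
have cv2 : {ae P, forall w, (F n w @[n --> \oo] --> 0%E) /\
    (\forall n \near \oo, 1 <= test tau n (Y ^~ w))}.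
  by move: cv tests_cvg; apply: filterS2 => w.
move: cv2 likS_true_gt0; apply: filterS2 => w [cvw [N2 _ hN2]] pos.
have /fine_cvgP[[N0 _ hN0] /cvgrPdist_lt /(_ 1 ltr01) [N1 _ hN1]] := cvw.
exists (maxn N0 (maxn N1 N2)) => // n /= nN.
have n0 : (N0 <= n)%N by rewrite (leq_trans _ nN) // leq_maxl.
have n1 : (N1 <= n)%N by rewrite (leq_trans _ nN) // leq_max leq_maxl orbT.
have n2 : (N2 <= n)%N by rewrite (leq_trans _ nN) // leq_max leq_maxr orbT.
have ffin := hN0 n n0; have := hN1 n n1; rewrite /= sub0r normrN ger0_norm ?fine_ge0 //.
have tt := hN2 n n2; rewrite /= in tt.
rewrite -lte_fin fineK // /F -/(ev V n w) => lt.
have pn : 0 < ps n w by exact: pos.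
have a0 : 0 < test tau n (Y ^~ w) / ps n w by rewrite divr_gt0 // (lt_le_trans ltr01).
move: lt; have := ev0 V n w; case: (ev V n w) => [x| |] //; last first.
  by rewrite gt0_muley ?lte_fin // gt0_muley ?lte_fin // invr_gt0.
rewrite -!EFinM lte_fin !lee_fin => x0 lt.
move: lt; rewrite mulrC ltr_pdivrMr // mul1r mulrAC ltr_pdivrMr // => lt.
by apply: ltW; apply: le_lt_trans lt; rewrite ler_peMl.
Qed.

End posterior_tests.

(** * Consistency *)

(* [A] need not be measurable: the integral over it is then an inner one. *)
Lemma subset_integral_inner (R : realType) (d : measure_display)
    (T : measurableType d) (mu : {measure set T -> \bar R}) (A B : set T)
    (f : T -> \bar R) : (forall x, 0 <= f x)%E -> A `<=` B ->
  (\int[mu]_(x in A) f x <= \int[mu]_(x in B) f x)%E.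
Proof.
move=> f0 AB; rewrite !ge0_integralE //; apply: le_ereal_sup => _ [h hA <-].
exists h => // x; apply: (le_trans (hA x)); rewrite /patch.
case: ifPn => [/set_mem Ax|_]; first by rewrite mem_set //; exact: AB.
by case: ifPn.
Qed.

Section consistency.
Context (R : realType) (k : nat) (dd : measure_display) (T : measurableType dd).
Variable lam : {sigma_finite_measure set T -> \bar R}.
Hypothesis hk : (0 < k)%N.
Context (dp : measure_display) (Tp : measurableType dp) (pi : probability Tp R).
Variables (Qt : Tp -> 'M[R]_k) (ft : Tp -> 'I_k -> T -> R) (m : 'I_k -> R).
Hypotheses (hm : is_distribution m) (hQt : forall t, is_transition (Qt t)).
Hypothesis hft : forall t i, is_density lam (ft t i).
Hypothesis mQt : forall i j, measurable_fun setT (fun t => Qt t i j).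
Hypothesis mft : forall i, measurable_fun setT (fun p : Tp * T => ft p.1 i p.2).
Variables (Qs : 'M[R]_k) (fs : 'I_k -> T -> R) (ms : 'I_k -> R) (q : R).
Hypotheses (q0 : 0 < q) (hQs : Delta_q q Qs) (hms : is_stationary Qs ms).
Hypothesis uQs : Qs \in unitmx.
Hypothesis hfs : forall i, is_density lam (fs i).
Context (dO : measure_display) (Omega : measurableType dO).
Variables (P : probability Omega R) (X : nat -> Omega -> 'I_k).
Variable (Y : nat -> Omega -> T).
Hypothesis mX : forall t i, measurable [set w | X t w = i].
Hypothesis mY : forall t, measurable_fun setT (Y t).
Hypothesis hlaw : hmm_law lam Qs fs ms P X Y.
Hypothesis hsupp : pi [set t | Delta_q q (Qt t)] = 1%E.
Hypothesis hev : forall b : R, 0 < b < 1 ->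
  {ae P, forall w, \forall n \near \oo, ((b ^+ n * lik Qs fs ms n (Y ^~ w))%:E
     <= \int[pi]_t (lik (Qt t) (ft t) m n (Y ^~ w))%:E)%E}.
Variables (I : finType) (g : I -> T -> R) (b0 : I) (e : R) (A : set Tp).
Hypotheses (ug : forall b, unit_fun (g b)) (g1 : g b0 = fun=> 1) (e0 : 0 < e).
Hypothesis indep : forall a : 'I_k -> R,
  (forall b, \sum_i a i * omean lam fs (g b) i = 0) -> forall i, a i = 0.
Hypothesis hA : forall t (s : 'S_k), Delta_q q (Qt t) ->
  (forall i j, `|Qt t (s i) (s j) - Qs i j| < e) ->
  (forall b i, `|omean lam (ft t) (g b) (s i) - omean lam fs (g b) i| < e) -> A t.

Let i0 : 'I_k := Ordinal hk.

Let hTs : is_transition Qs. Proof. by have [] := hQs. Qed.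
Let hds : is_distribution ms. Proof. by have [] := hms. Qed.

Let om01 (f : 'I_k -> T -> R) b i : (forall i, is_density lam (f i)) -> 0 <= omean lam f (g b) i <= 1.
Proof. by move=> hf; have [_ h] := omeanE hf i (ug b). Qed.

Let ms_neq0 i : ms i != 0.
Proof.
have [[ms0 ms1] st] := hms; have [_ Qq] := hQs; rewrite gt_eqF // -st.
apply: (@lt_le_trans _ _ (\sum_j ms j * q)); first by rewrite -mulr_suml ms1 mul1r.
by apply: ler_sum => j _; rewrite ler_wpM2l.
Qed.

Let win (Q : 'M[R]_k) (f : 'I_k -> T -> R) (abc : I * I * I) :=
  window Q (omean lam f (g abc.1.1)) (omean lam f (g abc.1.2)) (omean lam f (g abc.2)).

Let cs abc := \sum_x ms x * win Qs fs abc x.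

Let win01 (Q : 'M[R]_k) (f : 'I_k -> T -> R) abc : is_transition Q -> (forall i, is_density lam (f i)) ->
  forall i, 0 <= win Q f abc i <= 1.
Proof. by move=> hQ hf; apply: window_itv => // i; exact: om01. Qed.

Let cs01 abc : 0 <= cs abc <= 1.
Proof.
have [ms0 ms1] := hds; have w01 := @win01 Qs fs abc hTs hfs.
apply/andP; split.
  by apply: sumr_ge0 => x _; rewrite mulr_ge0 //; have /andP[] := w01 x.
by rewrite -[leRHS]ms1; apply: ler_sum => x _; rewrite ler_piMr //; have /andP[] := w01 x.
Qed.

(** The conditional mean, given state i, of a product of three consecutive observables that begins
    p.+1 steps later. *)
Let stat p t abc i := iter p.+1 (mxapp (Qt t)) (win (Qt t) (ft t) abc) i.

Let measurable_omean b i : measurable_fun setT (fun t => omean lam (ft t) (g b) i).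
Proof.
have [mg g01] := ug b.
pose F (tz : Tp * T) : \bar R := (g b tz.2 * ft tz.1 i tz.2)%:E.
have mF : measurable_fun setT F.
  apply/measurable_EFinP; apply: measurable_funM => //.
  by apply: (measurableT_comp mg); exact: measurable_snd.
have F0 tz : (0 <= F tz)%E.
  rewrite lee_fin mulr_ge0 //; first by have /andP[] := g01 tz.2.
  by have [] := hft tz.1 i.
apply: (measurableT_comp (fine_measurable measurableT)).
exact: (@measurable_fun_fubini_tonelli_F _ _ _ _ _ lam F mF F0).
Qed.

Let measurable_stat p abc i : measurable_fun setT (fun t => stat p t abc i).
Proof.
have mapp (v : Tp -> 'I_k -> R) : (forall j, measurable_fun setT (fun t => v t j)) ->
    forall j, measurable_fun setT (fun t => mxapp (Qt t) (v t) j).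
  by move=> mv j; apply: measurable_sum => l; exact: measurable_funM.
have mw j : measurable_fun setT (fun t => win (Qt t) (ft t) abc j).
  apply: measurable_funM; first exact: measurable_omean.
  apply: (mapp _) => l; apply: measurable_funM; first exact: measurable_omean.
  by apply: (mapp _) => r; exact: measurable_omean.
rewrite /stat; elim: (p.+1) i => [|r IH] j //=; exact: mapp.
Qed.

Let Vset p kap (v : I * I * I * bool) : set Tp :=
  [set t | forall i, 3 * kap <= (if v.2 then 1 else -1) * (stat p t v.1 i - cs v.1)].

Let measurable_Vset p kap v : measurable (Vset p kap v).
Proof.
rewrite (_ : Vset p kap v = \big[setI/setT]_(i < k)
   (setT `&` (fun t => (if v.2 then 1 else -1) * (stat p t v.1 i - cs v.1)) @^-1`
      `[3 * kap, +oo[%classic)).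
  apply: bigsetI_measurable => i _.
  have mS : measurable_fun setT
      (fun t => (if v.2 then 1 else -1) * (stat p t v.1 i - cs v.1)).
    apply: measurable_funM; first exact: measurable_cst.
    by apply: measurable_funB; [exact: measurable_stat|exact: measurable_cst].
  by apply: mS => //; exact: measurable_itv.
apply/seteqP; split=> t; rewrite -bigcap_seq /=.
  move=> h i _; split=> //; rewrite /preimage /=.
  by rewrite in_itv /= andbT; exact: h.
move=> h i; have [_] := h i (mem_index_enum i).
by rewrite /preimage /= in_itv /= andbT.
Qed.

(** Outside [A] some statistic started from [i0] deviates by at least [4 * kap]; p is so large that
    changing the initial state alters it by at most [kap], which leaves [3 * kap] from every
    state. *)
Let kl_constants : exists kap p, [/\ 0 < kap, kap <= 1 / 8,
  (1 - k%:R * q) ^+ p.+1 <= kap &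
  forall t, Delta_q q (Qt t) -> ~ A t -> exists v, Vset p kap v t].
Proof.
have Os1 i : omean lam fs (g b0) i = 1 by rewrite g1; exact: omean1.
have Qs1 i : \sum_j Qs i j = 1 by have [] := hTs i.
have [kap0 kap00 hsep] := @triple_moment_separation R k I b0 Qs ms
  (fun b => omean lam fs (g b)) e Qs1 uQs ms_neq0 Os1 indep e0.
pose kap := Num.min (kap0 / 4) (1 / 8).
have kp : 0 < kap by rewrite lt_min !divr_gt0.
have k8 : kap <= 1 / 8 by rewrite ge_min lexx orbT.
have k4 : kap <= kap0 / 4 by rewrite ge_min lexx.
have kq1 := Delta_q_le1 i0 hQs.
have kq0 : 0 < k%:R * q by rewrite mulr_gt0 // ltr0n.
have c1 : `|1 - k%:R * q| < 1 by rewrite ger0_norm; lra.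
have := cvg_expr c1 => /cvgrPdist_lt /(_ kap kp) [p _ hp].
have pow : (1 - k%:R * q) ^+ p.+1 <= kap.
  have := hp p.+1 (leqnSn p); rewrite /= sub0r normrN ger0_norm; first by move/ltW.
  by rewrite exprn_ge0 //; lra.
exists kap, p; split=> // t dQ nA.
(* The separation is applied with the law of the chain p.+1 steps after [i0], in place of a
   stationary law. *)
have [mr [dmr hmr]] := iter_mxapp_row p.+1 i0 (hQt t).
have O1 i : omean lam (ft t) (g b0) i = 1 by rewrite g1; exact: omean1.
have [a [b [c habc]]] := hsep (Qt t) mr (fun b => omean lam (ft t) (g b)) (hQt t) dmr
  (fun b i => om01 b i (hft t)) O1 (fun s h1 h2 => nA (hA dQ h1 h2)).
have osc i j := iter_mxapp_osc p.+1 i j dQ (@win01 (Qt t) (ft t) (a, b, c) (hQt t) (hft t)).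
have e1 : triple_moment (Qt t) mr (omean lam (ft t) (g a)) (omean lam (ft t) (g b))
   (omean lam (ft t) (g c)) = stat p t (a, b, c) i0 by rewrite /stat hmr.
rewrite e1 in habc.
rewrite -[X in _ - X]/(cs (a, b, c)) in habc.
have [c0|c0] := leP 0 (stat p t (a, b, c) i0 - cs (a, b, c)).
  rewrite ger0_norm // in habc; exists (a, b, c, true) => i /=.
  by have := osc i0 i; rewrite -/(stat _ _ _ _) mul1r -/(stat _ _ _ _); move: pow habc; lra.
rewrite ltr0_norm // in habc; exists (a, b, c, false) => i /=.
by have := osc i i0; rewrite -/(stat _ _ _ _) mulN1r -/(stat _ _ _ _); move: pow habc; lra.
Qed.

Let Vset_negligible p kap v (eps : R) : 0 < kap -> kap <= 1 / 8 ->
  (1 - k%:R * q) ^+ p.+1 <= kap -> 0 < eps ->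
  {ae P, forall w, \forall n \near \oo,
    (\int[pi]_(t in Vset p kap v) (likS (Qt t) (ft t) m n (Y ^~ w))%:E <=
     eps%:E * \int[pi]_t (likS (Qt t) (ft t) m n (Y ^~ w))%:E)%E}.
Proof.
move=> kp k8 pow eps0.
pose sg : R := if v.2 then 1 else -1.
have sg2 : sg * sg = 1 by rewrite /sg; case: v.2; rewrite ?mulr1 ?mulrN1 ?opprK.
have sgn : `|sg| = 1 by rewrite /sg; case: v.2; rewrite ?normrN normr1.
(* The threshold lies [2 * kap] away from the true moment: the tested parameters are at least
   [3 * kap] away on that side and the true statistic at most [kap], so both are at distance at
   least [kap] from [c]. The size of [tau] gives equality in [8 * |tau| <= kap]. *)
pose c := cs v.1 + sg * (2 * kap); pose tau := - sg * (kap / 8).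
have /andP[c0 c1] := cs01 v.1.
have c_itv : -1 <= c <= 2.
  by rewrite /c /sg; case: v.2; rewrite ?mul1r ?mulN1r; apply/andP; split; lra.
have kap_itv : 0 < kap <= 1 by rewrite kp /=; lra.
have tauE : `|tau| = kap / 8 by rewrite /tau normrM normrN sgn mul1r ger0_norm // divr_ge0 // ltW.
have tau0 : tau != 0 by rewrite -normr_gt0 tauE divr_gt0.
have tk : 8 * `|tau| <= kap by rewrite tauE; lra.
have hV t : Vset p kap v t -> forall i,
  1 + tau * (iter p.+1 (mxapp (Qt t)) (win (Qt t) (ft t) v.1) i - c) <= 1 - `|tau| * kap.
  move=> Vt i; have := Vt i; rewrite -/sg -/(stat p t v.1 i) => h.
  have : kap / 8 * (3 * kap) <= kap / 8 * (sg * (stat p t v.1 i - cs v.1)).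
    by rewrite ler_pM2l // divr_gt0.
  have -> : tau * (stat p t v.1 i - c) =
      - (kap / 8 * (sg * (stat p t v.1 i - cs v.1))) + (sg * sg) * (kap / 8 * (2 * kap)).
    by rewrite /tau /c; ring.
  by rewrite tauE sg2; lra.
have hs i : 1 - tau * (iter p.+1 (mxapp Qs) (win Qs fs v.1) i - c) <= 1 - `|tau| * kap.
  have := stationary_iter_mxapp_close p.+1 i hQs hms (@win01 Qs fs v.1 hTs hfs).
  rewrite -/(cs v.1); set x := iter _ _ _ i => close.
  have h : sg * (x - cs v.1) <= kap.
    apply: (le_trans (ler_norm _)); rewrite normrM sgn mul1r.
    exact: le_trans close pow.
  have : kap / 8 * (sg * (x - cs v.1)) <= kap / 8 * kap by rewrite ler_pM2l // divr_gt0.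
  have -> : tau * (x - c) =
      - (kap / 8 * (sg * (x - cs v.1))) + (sg * sg) * (kap / 8 * (2 * kap)).
    by rewrite /tau /c; ring.
  by rewrite tauE sg2; lra.
have [z /andP[z0 z1] hz] := @posterior_test _ _ _ _ lam _ _ pi Qt ft m hm hQt hft mQt mft
  Qs fs ms hTs hds hfs _ _ P X Y mX mY hlaw (Vset p kap v) p _ _ _ tau c kap
  (measurable_Vset p kap v) (ug v.1.1.1) (ug v.1.1.2) (ug v.1.2) c_itv kap_itv tau0 tk hV hs.
pose b := (1 + z) / 2.
have bz : z < b by rewrite /b; lra.
have b01 : 0 < b < 1 by rewrite /b; apply/andP; split; lra.
have /andP[bp _] := b01.
have zb0 : 0 <= z / b by rewrite divr_ge0 // ltW.
have zb1 : `|z / b| < 1 by rewrite ger0_norm // ltr_pdivrMr // mul1r.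
(* [likS] at n is [lik] at n.+1, so the evidence bound carries one more factor [b]. *)
have /cvgrPdist_lt /(_ (eps * b) (mulr_gt0 eps0 bp)) [M _ hM] := cvg_expr zb1.
move: hz (hev b01); apply: filterS2 => w [N1 _ hN1] [N2 _ hN2].
exists (maxn N1 (maxn N2 M)) => // n /= nN.
have n1 : (N1 <= n)%N by rewrite (leq_trans _ nN) // leq_maxl.
have n2 : (N2 <= n.+1)%N by rewrite leqW // (leq_trans _ nN) // leq_max leq_maxl orbT.
have n3 : (M <= n)%N by rewrite (leq_trans _ nN) // leq_max leq_maxr orbT.
apply: (le_trans (hN1 n n1)); have := hN2 n.+1 n2; rewrite /=.
have epsE : (0 <= eps%:E)%E by rewrite lee_fin ltW.
move/(lee_wpmul2l epsE); apply: le_trans; rewrite -EFinM lee_fin mulrA.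
apply: ler_wpM2r; first exact: (likS_ge0 (lam := lam)).
have := hM n n3; rewrite /= sub0r normrN ger0_norm ?exprn_ge0 //.
rewrite (expr_div_n z b n) ltr_pdivrMr ?exprn_gt0 // => /ltW.
by rewrite [b ^+ n.+1]exprS (mulrA eps b).
Qed.

Theorem posterior_consistency : {ae P, forall w,
  (fun n => posterior pi (fun t => (Qt t, ft t)) m n (Y ^~ w) A) @ \oo --> 1%E}.
Proof.
have [kap [p [kp k8 pow cover]]] := kl_constants.
(* Countably many tolerances and finitely many sets, so one null set serves for all. *)
have negl : {ae P, forall w (vj : (I * I * I * bool)%type) j, \forall n \near \oo,
    (\int[pi]_(t in Vset p kap vj) (likS (Qt t) (ft t) m n (Y ^~ w))%:E <=
     (j.+1%:R^-1)%:E * \int[pi]_t (likS (Qt t) (ft t) m n (Y ^~ w))%:E)%E}.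
  apply: filter_forall => vj; apply: ae_foralln => j.
  by apply: Vset_negligible => //; rewrite invr_gt0.
have half : 0 < (2^-1 : R) < 1 by apply/andP; split; lra.
have pos := likS_true_gt0 hTs hds hfs mX mY hlaw.
have lty := @evidence_lty _ _ _ _ lam _ _ pi Qt ft m hm hQt hft mQt mft
  Qs fs ms hTs hds hfs _ _ P X Y mX mY hlaw.
have good : {ae P, forall w, (forall n, 0 < likS Qs fs ms n (Y ^~ w)) /\
   (forall n, (\int[pi]_t (likS (Qt t) (ft t) m n (Y ^~ w))%:E < +oo)%E)}.
  by move: pos lty; apply: filterS2.
have good2 : {ae P, forall w, ((forall n, 0 < likS Qs fs ms n (Y ^~ w)) /\
   (forall n, (\int[pi]_t (likS (Qt t) (ft t) m n (Y ^~ w))%:E < +oo)%E)) /\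
   (\forall n \near \oo, ((2^-1 ^+ n * lik Qs fs ms n (Y ^~ w))%:E
     <= \int[pi]_t (lik (Qt t) (ft t) m n (Y ^~ w))%:E)%E)}.
  by move: good (hev half); apply: filterS2.
move: good2 negl; apply: filterS2 => w [[psw ltyw] [N0 _ hN0]] hV.
pose L n t := (likS (Qt t) (ft t) m n (Y ^~ w))%:E : \bar R.
have L0 n t : (0 <= L n t)%E by rewrite lee_fin; exact: (likS_ge0 (lam := lam)).
have mL n : measurable_fun setT (L n).
  apply/measurable_EFinP.
  exact: (measurable_fun_pair1 w (@measurable_likS_joint _ _ _ _ _ _ Qt ft m mQt mft _ _ Y n mY)).
pose G : set Tp := [set t | Delta_q q (Qt t)].
have mG : measurable G.
  rewrite (_ : G = \big[setI/setT]_(i < k) \big[setI/setT]_(j < k)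
     (setT `&` (fun t => Qt t i j) @^-1` `[q, +oo[%classic)).
    apply: bigsetI_measurable => i _; apply: bigsetI_measurable => j _.
    by apply: mQt => //; exact: measurable_itv.
  apply/seteqP; split=> t.
    move=> [_ h]; rewrite -bigcap_seq => i _; rewrite -bigcap_seq => j _; split=> //.
    by rewrite /preimage /= in_itv /= andbT; exact: h.
  move=> h; split; first exact: hQt.
  move=> i j; move: h; rewrite -bigcap_seq => /(_ i (mem_index_enum i)).
  rewrite -bigcap_seq => /(_ j (mem_index_enum j)) [_].
  by rewrite /preimage /= in_itv /= andbT.
have G1 : pi (~` G) = 0%E.
  by rewrite probability_setC // (hsupp : pi G = 1%E) subee.
pose B : set Tp := \big[setU/set0]_(v : (I * I * I * bool)%type) Vset p kap v.
have mB : measurable B by apply: bigsetU_measurable => v _; exact: measurable_Vset.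
(* A measurable subset of [A]. The integral over [A] is an inner one, so it is reached through
   inclusions only. *)
pose A' := G `&` ~` B.
have mA' : measurable A' by apply: measurableI => //; exact: measurableC.
have A'A : A' `<=` A.
  move=> t [Gt nB]; apply: contrapT => nA; have [v Vt] := cover t Gt nA.
  by apply: nB; rewrite /B -bigcup_seq; exists v => //=; rewrite mem_index_enum.
pose K : R := #|{: (I * I * I * bool)%type}|%:R.
have Bint n : (\int[pi]_(t in B) L n t <=
    \sum_(v : (I * I * I * bool)%type) \int[pi]_(t in Vset p kap v) L n t)%E.
  under [X in (_ <= X)%E]eq_bigr do rewrite integral_mkcond.
  rewrite -ge0_integral_sum //; last 2 first.
  - move=> v; apply/(measurable_restrictT _ (measurable_Vset p kap v)).
    exact: measurable_funTS.
  - by move=> v t _; rewrite /patch; case: ifP.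
  rewrite [leLHS]integral_mkcond; apply: ge0_le_integral => //.
  - by move=> t _; rewrite /patch; case: ifP.
  - by apply/(measurable_restrictT _ mB); exact: measurable_funTS.
  - apply: emeasurable_sum => v.
    apply/(measurable_restrictT _ (measurable_Vset p kap v)).
    exact: measurable_funTS.
  - move=> t _; rewrite {1}/patch; case: ifPn => [/set_mem|_]; last first.
      by apply: sume_ge0 => v _; rewrite /patch; case: ifP.
    rewrite /B -bigcup_seq => -[v _ Vt]; rewrite (bigD1 v) //= {1}/patch mem_set //.
    by rewrite leeDl //; apply: sume_ge0 => v' _; rewrite /patch; case: ifP.
have split_int n : (\int[pi]_t L n t <= \int[pi]_(t in A') L n t + \int[pi]_(t in B) L n t)%E.
  rewrite (@ge0_negligible_integral _ _ _ pi setT (~` G)) //; last exact: measurableC.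
  rewrite setTD setCK.
  have -> : (\int[pi]_(t in A') L n t + \int[pi]_(t in B) L n t =
      \int[pi]_(t in A' `|` B) L n t)%E.
    rewrite ge0_integral_setU //; first exact: measurable_funTS.
    by rewrite disj_set2E; apply/eqP; rewrite /A' -setIA setICl setI0.
  apply: subset_integral_inner => // t Gt; have [Bt|nBt] := pselect (B t); first by right.
  by left; split.
have K0 : 0 <= K by [].
pose D n := fine (\int[pi]_t L n t); pose N n := fine (\int[pi]_(t in A) L n t).
have DE n : (\int[pi]_t L n t)%E = (D n)%:E.
  by rewrite fineK // ge0_fin_numE ?ltyw //; exact: integral_ge0.
have NleD n : (\int[pi]_(t in A) L n t <= (D n)%:E)%E.
  by rewrite -DE; apply: subset_integral_inner.
have NE n : (\int[pi]_(t in A) L n t)%E = (N n)%:E.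
  rewrite fineK // ge0_fin_numE; last by apply: integral_ge0.
  by apply: le_lt_trans (NleD n) (ltry _).
have Dgt0 n : (N0 <= n)%N -> 0 < D n.
  move=> n0; have := hN0 n.+1 (leqW n0); rewrite /= -/(L n) DE lee_fin.
  by apply: lt_le_trans; rewrite mulr_gt0 ?exprn_gt0 ?invr_gt0.
have postE n : (N0 <= n)%N ->
    posterior pi (fun t => (Qt t, ft t)) m n.+1 (Y ^~ w) A = (N n / D n)%:E.
  move=> n0; have d0 := Dgt0 n n0; rewrite /posterior /= -/(L n) NE DE.
  by rewrite inver gt_eqF // -EFinM.
have low j : \forall n \near \oo, (1 - K / j.+1%:R) * D n <= N n.
  have : \forall n \near \oo, forall v : (I * I * I * bool)%type,
    (\int[pi]_(t in Vset p kap v) L n t <= (j.+1%:R^-1)%:E * \int[pi]_t L n t)%E.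
    by apply: filter_forall => v; exact: hV.
  apply: filterS => n hn.
  have Bn : (\int[pi]_(t in B) L n t <= (K / j.+1%:R * D n)%:E)%E.
    apply: (le_trans (Bint n)).
    apply: (@le_trans _ _ (\sum_(v : (I * I * I * bool)%type) (j.+1%:R^-1 * D n)%:E)%E).
      by apply: lee_sum => v _; have := hn v; rewrite DE -EFinM.
    by rewrite sumEFin sumr_const lee_fin -[leLHS]mulr_natl mulrA.
  have := split_int n; rewrite DE => h.
  have : ((D n)%:E <= (N n)%:E + (K / j.+1%:R * D n)%:E)%E.
    apply: (le_trans h); apply: leeD => //; rewrite -NE.
    exact: subset_integral_inner.
  by rewrite -EFinD lee_fin mulrBl mul1r lerBlDr.
have up n : N n <= D n by rewrite -lee_fin -NE NleD.
apply/fine_cvgP; split.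
  exists N0.+1 => // -[|n] //= n0.
  by rewrite postE.
apply/cvgrPdist_le => eps eps0.
pose j := Num.bound (K / eps).
have Kj : K / j.+1%:R <= eps.
  rewrite ler_pdivrMr // mulrC -ler_pdivrMr // ltW //.
  have := archi_boundP (divr_ge0 K0 (ltW eps0)); rewrite -/j => /lt_trans; apply.
  by rewrite ltr_nat.
have [N1 _ hN1] := low j.
exists (maxn N0 N1).+1 => // -[|n] //= n0.
move: n0; rewrite ltnS geq_max => /andP[n1 n2].
have d0 := Dgt0 n n1; rewrite postE //=.
have r1 : N n / D n <= 1 by rewrite ler_pdivrMr // mul1r.
have r2 : 1 - K / j.+1%:R <= N n / D n by rewrite ler_pdivlMr //; exact: hN1.
rewrite ger0_norm ?subr_ge0 // lerBlDr -lerBlDl.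
by apply: le_trans r2; rewrite lerD2l lerN2.
Qed.

End consistency.

(** * Reduction to finitely many observables *)

(** As long as the kernel is nonzero, some member of the family fails to annihilate a kernel vector,
    and adding it lowers the rank of the kernel. *)
Lemma finite_separation (F : fieldType) (k : nat) (S : Type)
    (v : S -> 'I_k -> F) :
  (forall a : 'I_k -> F, (forall s, \sum_i a i * v s i = 0) ->
     forall i, a i = 0) ->
  exists (N : nat) (s : 'I_N -> S), forall a : 'I_k -> F,
    (forall b, \sum_i a i * v (s b) i = 0) -> forall i, a i = 0.
Proof.
move=> sep; pose M N (s : 'I_N -> S) := \matrix_(i < k, b < N) v (s b) i.
have ker0 N (s : 'I_N -> S) (a : 'rV[F]_k) :
    (a *m M N s == 0) = [forall b, \sum_i a 0 i * v (s b) i == 0].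
  apply/eqP/forallP => [/rowP h b|h].
    by have := h b; rewrite !mxE => {2}<-; apply/eqP/eq_bigr => i _; rewrite mxE.
  by apply/rowP => b; rewrite !mxE -[RHS](eqP (h b)); apply: eq_bigr => i _; rewrite mxE.
suff: forall n N (s : 'I_N -> S), (\rank (kermx (M N s)) <= n)%N ->
  exists (N' : nat) (s' : 'I_N' -> S), forall a : 'I_k -> F,
    (forall b, \sum_i a i * v (s' b) i = 0) -> forall i, a i = 0.
  have s0 : 'I_0 -> S by case.
  by move/(_ _ 0%N s0 (leqnn _)).
elim=> [|n IHn] N s; rewrite ?leqn0.
  rewrite mxrank_eq0 => /eqP K0; exists N, s => a ha i.
  have : ((\row_i a i) <= kermx (M N s))%MS.
    rewrite sub_kermx ker0; apply/forallP => b; apply/eqP.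
    by rewrite -[RHS](ha b); apply: eq_bigr => j _; rewrite mxE.
  by rewrite K0 submx0 => /eqP/rowP/(_ i); rewrite !mxE.
have [/eqP K0|/rowV0Pn[a /sub_kermxP/eqP aK a0] rn] := eqVneq (kermx (M N s)) 0.
  by move=> _; apply: (IHn N s); move: K0; rewrite -mxrank_eq0 => /eqP ->.
have [s0 s0P] : exists s0, \sum_i a 0 i * v s0 i != 0.
  apply/not_existsP => h; move/eqP: a0; apply; apply/rowP => i; rewrite mxE.
  by apply: (sep (fun i => a 0 i)) => s'; apply/eqP/negPn/negP; exact: h.
pose s' (b : 'I_(N + 1)) := if fintype.split b is inl c then s c else s0.
have s'l b : s' (lshift 1 b) = s b by rewrite /s' (unsplitK (inl b)).
have s'r b : s' (rshift N b) = s0 by rewrite /s' (unsplitK (inr b)).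
apply: (IHn _ s'); rewrite -ltnS (leq_trans _ rn) //; apply: rank_ltmx.
rewrite /ltmx; apply/andP; split.
  apply/rV_subP => u; rewrite !sub_kermx !ker0 => /forallP h.
  by apply/forallP => b; have := h (lshift 1 b); rewrite s'l.
apply/negP => sub; have : (a <= kermx (M _ s'))%MS.
  by apply: submx_trans sub; rewrite sub_kermx.
rewrite sub_kermx ker0 => /forallP /(_ (rshift N ord0)); rewrite s'r.
by apply/negP.
Qed.

Lemma continuous_measurable_Rd (R : realType) (d : nat) (g : 'rV[R]_d -> R) :
  continuous g -> @measurable_fun _ _ (Rd R d) R setT g.
Proof.
move=> /continuousP cg; apply: (@measurability _ _ (Rd R d) R setT g _ (RGenOpens.measurableE R)).
move=> _ [_ [a [b ->]] <-]; rewrite setTI; apply: sub_sigma_algebra.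
exact/cg/itv_open.
Qed.

Lemma omean_indic (R : realType) (k : nat) (dd : measure_display)
    (T : measurableType dd) (lam : {sigma_finite_measure set T -> \bar R})
    (f : 'I_k -> T -> R) (A : set T) (i : 'I_k) :
  is_density lam (f i) -> measurable A ->
  omean lam f (\1_A) i = fine (dmeasure lam (f i) A).
Proof.
move=> [mf f0 _] mA; rewrite /omean (dmeasureE_indic _ mf f0 mA).
by congr fine; apply: eq_integral => y _; rewrite EFinM.
Qed.

(** Tests take [0, 1]-valued observables, whereas weak neighbourhoods are given by bounded functions
    of either sign. *)
Definition rescale (R : realType) (T : Type) (M : R) (g : T -> R) (y : T) :=
  (g y + M) / (2 * M).

Lemma unit_fun_rescale (R : realType) (dd : measure_display)
    (T : measurableType dd) (M : R) (g : T -> R) :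
  0 < M -> measurable_fun setT g -> (forall y, `|g y| <= M) ->
  unit_fun (rescale M g).
Proof.
move=> M0 mg gM; split.
  by apply: measurable_funM => //; apply: measurable_funD.
move=> y; have := gM y; rewrite ler_norml => /andP[h1 h2].
have M2 : 0 < 2 * M by rewrite mulr_gt0.
by rewrite /rescale ler_pdivlMr // ler_pdivrMr // mul0r mul1r; apply/andP; split; lra.
Qed.

Lemma integral_dmeasure_rescale (R : realType) (k : nat) (dd : measure_display)
    (T : measurableType dd) (lam : {sigma_finite_measure set T -> \bar R})
    (f : 'I_k -> T -> R) (M : R) (g : T -> R) (i : 'I_k) :
  (forall i, is_density lam (f i)) ->
  0 < M -> measurable_fun setT g -> (forall y, `|g y| <= M) ->
  (\int[dmeasure lam (f i)]_y (g y)%:E)%E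
    = (2 * M * omean lam f (rescale M g) i - M)%:E.
Proof.
move=> hf M0 mg gM; have [mf f0 f1] := hf i.
have [mh h01] := unit_fun_rescale M0 mg gM.
set nu := dmeasure lam (f i).
have nu1 : nu setT = 1%E by rewrite /nu dmeasureE.
have ih : (\int[nu]_y (rescale M g y)%:E)%E = (omean lam f (rescale M g) i)%:E.
  rewrite ge0_integral_dmeasure //.
  - by have [<- _] := omeanE hf i (conj mh h01).
  - exact/measurable_EFinP.
  - by move=> y; rewrite lee_fin; case/andP: (h01 y).
have bh (h : T -> R) : measurable_fun setT h -> (forall y, 0 <= h y) ->
  (\int[nu]_y (h y)%:E < +oo)%E -> nu.-integrable setT (EFin \o h).
  move=> mh' h0 hoo; apply/integrableP; split; first exact/measurable_EFinP.
  by under eq_integral do rewrite /= ger0_norm //.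
have M2 : 0 < 2 * M by rewrite mulr_gt0.
have iM : (\int[nu]_y M%:E)%E = M%:E.
  by rewrite (integral_cst nu measurableT M%:E) nu1 mule1.
have i2 : (\int[nu]_y (2 * M * rescale M g y)%:E)%E
    = (2 * M * omean lam f (rescale M g) i)%:E.
  under eq_integral do rewrite EFinM.
  rewrite ge0_integralZl_EFin // ?ih -?EFinM //.
  - by move=> y _; rewrite lee_fin; case/andP: (h01 y).
  - exact/measurable_EFinP.
  - exact: ltW.
have gE y : g y = 2 * M * rescale M g y - M.
  by rewrite /rescale mulrC divfK ?gt_eqF //; ring.
under eq_integral do rewrite gE EFinB.
rewrite integralB_EFin //.
- by rewrite i2 iM -EFinB.
- apply: bh.
  + exact: measurable_funM.
  + by move=> y; have [h1 _] := andP (h01 y); exact: mulr_ge0 (ltW M2) h1.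
  + by rewrite i2 ltry.
- by apply: bh => //; [move=> y; exact: ltW | rewrite iM ltry].
Qed.

Lemma mx_norm_ltP (R : realType) (m n : nat) (A : 'M[R]_(m, n)) (e : R) :
  0 < e -> reflect (forall i j, `|A i j| < e) (mx_norm A < e).
Proof.
move=> e0; rewrite mx_normrE; apply: (iffP idP) => [h i j|h].
  apply: le_lt_trans h; exact: (le_bigmax _ (fun ij => `|A ij.1 ij.2|) (i, j)).
by apply/bigmax_ltP; split => // -[i j] _; exact: h.
Qed.

Section sigma_finite_pack.
Context (R : realType) (dd : measure_display) (T : measurableType dd).
Variables (lam : {measure set T -> \bar R}) (hlam : sigma_finite setT lam).

Let sf (A : set T) := lam A.

HB.instance Definition _ := isMeasure.Build _ _ _ sf
  (measure0 lam) (measure_ge0 lam) (@measure_semi_sigma_additive _ _ _ lam).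
HB.instance Definition _ := Measure_isSigmaFinite.Build _ _ _ sf hlam.

(** Equality of measures allows [subst] to replace a measure with a sigma-finiteness hypothesis by a
    bundled one. *)
Lemma sigma_finite_measureE : exists lam' : {sigma_finite_measure set T -> \bar R},
  lam = lam' :> {measure set T -> \bar R}.
Proof. by exists sf; exact: eq_measure. Qed.

End sigma_finite_pack.

(** * Evidence bound from the Kullback-type assumption *)

Section evidence.
Context (R : realType) (k : nat) (dd : measure_display) (T : measurableType dd).
Variable lam : {sigma_finite_measure set T -> \bar R}.
Context (dp : measure_display) (Tp : measurableType dp) (pi : probability Tp R).
Variables (Qt : Tp -> 'M[R]_k) (ft : Tp -> 'I_k -> T -> R) (m : 'I_k -> R).
Hypotheses (hm : is_distribution m) (hQt : forall t, is_transition (Qt t)).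
Hypothesis hft : forall t i, is_density lam (ft t i).
Hypothesis mQt : forall i j, measurable_fun setT (fun t => Qt t i j).
Hypothesis mft : forall i, measurable_fun setT (fun p : Tp * T => ft p.1 i p.2).
Variables (Qs : 'M[R]_k) (fs : 'I_k -> T -> R) (ms : 'I_k -> R) (q : R).
Hypotheses (q0 : 0 < q) (hmq : forall i, q <= m i).
Hypotheses (hQs : is_transition Qs) (hms : is_distribution ms).
Hypothesis hfs : forall i, is_density lam (fs i).
Hypothesis kl : exists e0 : R, 0 < e0 /\ forall e : R, 0 < e < e0 ->
  exists Th : set Tp, [/\ measurable Th, (0 < pi Th)%E & forall t, Th t ->
    [/\ Delta_q q (Qt t), (forall i j, `|Qt t i j - Qs i j| < e) &
        forall i, (\int[lam]_y ((fs i y)%:E * max_logratio fs (ft t) y)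
                   < e%:E)%E]].

(** [Qs] is a limit of matrices with entries at least [q]. *)
Lemma kl_support_Delta_q : Delta_q q Qs.
Proof.
split=> // i j; have [e0 [e00 h]] := kl.
apply/ler_addgt0Pr => e egt0; pose e' := Num.min e (e0 / 2).
have [|Th [_ piTh hTh]] := h e'.
  rewrite /e' lt_min egt0 divr_gt0 //= gt_min; apply/orP; right.
  by rewrite ltr_pdivrMr // ltr_pMr // ltr1n.
have /set0P[t Tht] : Th != set0.
  by apply: contraTneq piTh => ->; rewrite measure0 ltxx.
have [[_ hq] hQ _] := hTh t Tht.
have := hQ i j; rewrite ltr_norml => /andP[_ h2].
have : e' <= e by rewrite /e' ge_min lexx.
by have := hq i j; lra.
Qed.

Context (dO : measure_display) (Omega : measurableType dO).
Variables (P : probability Omega R) (X : nat -> Omega -> 'I_k).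
Variable (Y : nat -> Omega -> T).
Hypothesis mX : forall t i, measurable [set w | X t w = i].
Hypothesis mY : forall t, measurable_fun setT (Y t).
Hypothesis hlaw : hmm_law lam Qs fs ms P X Y.

Lemma evidence_lower (b : R) : 0 < b < 1 ->
  {ae P, forall w, \forall n \near \oo, ((b ^+ n * lik Qs fs ms n (Y ^~ w))%:E
     <= \int[pi]_t (lik (Qt t) (ft t) m n (Y ^~ w))%:E)%E}.
Proof.
move=> /andP[bgt0 blt1]; have [e0 [e00 h]] := kl.
pose b1 := (b + 1) / 2; have bb1 : b < b1 by rewrite /b1; lra.
have b10 : 0 < b1 by lra. have b11 : b1 < 1 by rewrite /b1; lra.
(* With [b1 = expR (- l)], the choices of [eta] and [e] make both [expR (12 * eta)] and [1 + e / q]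
   at most [expR (l / 3)], which leaves a factor [expR (- l / 3)] below 1. *)
pose l := - ln b1; have l0 : 0 < l by rewrite /l oppr_gt0 ln_lt0 // b10.
pose eta := Num.min 1 (l / 36).
have eta0 : 0 < eta by rewrite lt_min ltr01 divr_gt0.
have eta1 : eta <= 1 by rewrite ge_min lexx.
have etal : eta <= l / 36 by rewrite ge_min lexx orbT.
pose e := Num.min (e0 / 2) (Num.min (eta ^+ 2) (q * l / 3)).
have egt0 : 0 < e by rewrite !lt_min !divr_gt0 ?exprn_gt0 ?mulr_gt0.
have ee0 : e <= e0 / 2 by rewrite ge_min lexx.
have eeta : e <= eta ^+ 2 by rewrite !ge_min lexx orbT.
have eq : e <= q * l / 3 by rewrite !ge_min lexx !orbT.
have hb1 : b1 * (1 + e / q) * expR (12 * eta) < 1.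
  have b1E : b1 = expR (- l) by rewrite /l opprK lnK.
  have el : (1 + e / q) * expR (12 * eta) <= expR (l / 3) * expR (l / 3).
    apply: ler_pM.
    - by rewrite addr_ge0 // divr_ge0 // ltW.
    - exact: expR_ge0.
    - apply: (le_trans (expR_ge1Dx _)); rewrite ler_expR ler_pdivrMr //; lra.
    - rewrite ler_expR; lra.
  apply: (@le_lt_trans _ _ (b1 * (expR (l / 3) * expR (l / 3)))).
    by rewrite -mulrA ler_pM2l.
  by rewrite b1E -!expRD expR_lt1; lra.
have [|Th [mTh piTh hTh]] := h e; first by rewrite egt0 /=; lra.
apply: (@prior_mass_lower _ _ _ _ _ P pi
  (fun n t w => lik (Qt t) (ft t) m n (Y ^~ w))
  (fun n w => lik Qs fs ms n (Y ^~ w)) Th b b1) => //.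
- move=> [|n]; first exact: measurable_cst.
  exact: (measurable_likS_joint m mQt mft n mY).
- move=> [|n]; first exact: measurable_cst.
  exact: (measurable_likS_obs Qs ms hfs mY n).
- by move=> [|n] t w //=; exact: (likS_ge0 (lam := lam)).
- by move=> [|n] w //=; exact: (likS_ge0 (lam := lam)).
move=> t Tht; have [hQ hQe hK] := hTh t Tht.
apply: (likelihood_ratio_lower hQs hms hfs mX mY hlaw hm q0 _ hmq (ltW egt0)
  _ eta0 eta1 _ b10 hb1).
- by split=> // i; exact: hft.
- by move=> i j; have := hQe i j; rewrite ltr_norml => /andP[h1 _]; lra.
- by move=> i; apply: (lt_le_trans (hK i)); rewrite lee_fin.
Qed.

End evidence.

Theorem theorem2
  (R : realType) (k d : nat) (hk : (0 < k)%N) (hd : (0 < d)%N)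
  (* reference measure lambda on R^d, sigma-finite *)
  (lam : {measure set (Rd R d) -> \bar R}) (hlam : sigma_finite setT lam)
  (* true parameter theta* = (Qs, fs) *)
  (Qs : 'M[R]_k) (fs : 'I_k -> Rd R d -> R)
  (hQs : is_transition Qs) (hfs : forall i, is_density lam (fs i))
  (* mus = mu^{Q*}, the stationary distribution of Qs *)
  (mus : 'I_k -> R) (hmus : is_stationary Qs mus)
  (* f_1* lam, ..., f_k* lam linearly independent *)
  (hlin : forall a : 'I_k -> R,
      (forall A, measurable A ->
         (\sum_(i < k) (a i)%:E * dmeasure lam (fs i) A = 0)%E) ->
      forall i, a i = 0)
  (* Qs has full rank *)
  (hrank : \rank Qs = k)
  (q : R) (hq : 0 < q)
  (* fixed initial distribution mu of the prior model, mu_i >= q *)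
  (mu0 : 'I_k -> R) (hmu0 : is_distribution mu0) (hmu0q : forall i, q <= mu0 i)
  (* prior pi = pi_Q (x) pi_f, given as probabilities on measurable parameter *)
  (* spaces TQ, Tf mapped into Delta_k^k and F^k                             *)
  (dQ df : measure_display) (TQ : measurableType dQ) (Tf : measurableType df)
  (piQ : probability TQ R) (pif : probability Tf R)
  (Qof : TQ -> 'M[R]_k) (fof : Tf -> 'I_k -> Rd R d -> R)
  (hQof : forall t, is_transition (Qof t))
  (hfof : forall t i, is_density lam (fof t i))
  (mQof : forall i j, measurable_fun setT (fun t => Qof t i j))
  (mfof : forall i, measurable_fun setT (fun p : Tf * Rd R d => fof p.1 i p.2))
  (* support of the prior included in Theta(q) *)
  (hsupp : (piQ \x pif)%E [set t | Theta_q lam q (Qof t.1, fof t.2)] = 1%E)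
  (* assumption (A1) *)
  (A1 : exists e0 : R, 0 < e0 /\
     forall e : R, 0 < e < e0 ->
     exists Th : set ('M[R]_k * ('I_k -> Rd R d -> R)),
       [/\ Th `<=` Theta_q lam q,
           measurable [set t : TQ * Tf | Th (Qof t.1, fof t.2)],
           (0 < (piQ \x pif) [set t | Th (Qof t.1, fof t.2)])%E &
       forall Q f, Th (Q, f) ->
       [/\ mx_norm (Q - Qs) < e,
           (\big[maxe/-oo]_(i < k)
              \int[lam]_y ((fs i y)%:E *
                   \big[maxe/-oo]_(j < k) elogratio (fs j y) (f j y)) < e%:E)%E,
           (forall y, 0 < \sum_(i < k) fs i y -> 0 < \sum_(j < k) f j y),
           (exists M : R, forall y, 0 < \sum_(i < k) fs i y ->
                                    forall j, f j y <= M) &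
           (\sum_(i < k) \int[lam]_y ((fs i y)%:E *
                                `|eln (\sum_(j < k) f j y)|) < +oo)%E]])
  (* assumption (A2), for some integer l >= 3 *)
  (A2 : exists l : nat, (3 <= l)%N /\
     forall delta : R, 0 < delta ->
     exists (Fn : nat -> set ('I_k -> Rd R d -> R)) (r1 C : R),
       [/\ 0 < r1, 0 < C,
           (forall n, (0 < n)%N ->
              measurable (fof @^-1` Fn n) /\
              (pif (~` (fof @^-1` Fn n)) <= (C * expR (- (n%:R * r1)))%:E)%E) &
           (\sum_(1 <= n <oo)
              (covering_number lam (delta / (36 * l%:R)) (Fn n) *
               (expR (- (n%:R * delta ^+ 2 * k%:R ^+ 2 * q ^+ 2
                          / (32 * l%:R))))%:E) < +oo)%E])
  (* the observations: a realisation of the HMM (X_t, Y_t)_{t>=1} under *)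
  (* P^{theta*} = P^{theta*, mu^{Q*}}  (time t+1 is index t)              *)
  (dO : measure_display) (Omega : measurableType dO) (P : probability Omega R)
  (X : nat -> Omega -> 'I_k) (Y : nat -> Omega -> Rd R d)
  (mX : forall t i, measurable [set w | X t w = i])
  (mY : forall t, measurable_fun setT (Y t))
  (hlaw : forall (n : nat) (x : nat -> 'I_k) (B : nat -> set (Rd R d)),
      (forall t, measurable (B t)) ->
      P [set w | forall t, (t <= n)%N -> X t w = x t /\ B t (Y t w)] =
      ((mus (x 0%N))%:E * \prod_(t < n) (Qs (x t) (x t.+1))%:E
        * \prod_(t < n.+1) dmeasure lam (fs (x t)) (B t))%E)
  (* neighbourhoods *)
  (UQ : set 'M[R]_k) (hUQ : norm_nbhd Qs UQ)
  (Uf : 'I_k -> set {measure set (Rd R d) -> \bar R})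
  (hUf : forall i, weak_nbhd (dmeasure lam (fs i)) (Uf i)) :
  {ae P, forall w,
    (fun n => posterior (piQ \x pif)%E (fun t => (Qof t.1, fof t.2)) mu0 n
       (fun t => Y t w)
       [set t | exists s : 'S_k,
          UQ (\matrix_(i, j) Qof t.1 (s i) (s j)) /\
          forall i, Uf i (dmeasure lam (fof t.2 (s i)))])
    @ \oo --> 1%E}.
Proof.
have [lam' lamE] := sigma_finite_measureE hlam; subst lam.
pose pi : probability (TQ * Tf)%type R := (piQ \x pif)%E.
pose Qt (t : TQ * Tf) := Qof t.1; pose ft (t : TQ * Tf) := fof t.2.
have hQt t : is_transition (Qt t) by exact: hQof.
have hft t i : is_density lam' (ft t i) by exact: hfof.
have mQt i j : measurable_fun setT (fun t => Qt t i j).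
  exact: (measurableT_comp (mQof i j) measurable_fst).
have mft i : measurable_fun setT (fun p : (TQ * Tf) * Rd R d => ft p.1 i p.2).
  have mp : measurable_fun setT (fun p : (TQ * Tf) * Rd R d => (p.1.2, p.2)).
    apply/measurable_fun_pairP; split; last exact: measurable_snd.
    exact: (measurableT_comp measurable_snd measurable_fst).
  exact: (measurableT_comp (mfof i) mp).
have kl : exists e0 : R, 0 < e0 /\ forall e : R, 0 < e < e0 ->
    exists Th : set (TQ * Tf), [/\ measurable Th, (0 < pi Th)%E &
      forall t, Th t -> [/\ Delta_q q (Qt t),
        (forall i j, `|Qt t i j - Qs i j| < e) &
        forall i, (\int[lam']_y ((fs i y)%:E * max_logratio fs (ft t) y)
                   < e%:E)%E]].
  have [e0 [e00 h]] := A1; exists e0; split=> // e he.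
  have [Th [ThS mTh piTh hTh]] := h e he.
  exists [set t | Th (Qof t.1, fof t.2)]; split=> // t Tht.
  have [hQ hK _ _ _] := hTh _ _ Tht; have e_gt0 := andP he.
  split; first by have [] := ThS _ Tht.
    by move=> i j; have /mx_norm_ltP := hQ; rewrite e_gt0.1 => /(_ isT i j); rewrite !mxE.
  by move=> i; apply: le_lt_trans hK; exact: le_bigmax.
have hDq : Delta_q q Qs := kl_support_Delta_q hQs kl.
have hev := evidence_lower hmu0 hQt hft mQt mft hq hmu0q hQs hmus.1 hfs kl
  mX mY hlaw.
have uQs : Qs \in unitmx by rewrite -row_free_unit /row_free hrank.
have suppE : pi [set t | Delta_q q (Qt t)] = 1%E.
  rewrite -[RHS]hsupp; congr (pi _); apply/seteqP; split=> t /= h.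
    by split=> //= i; exact: hfof.
  by case: h.
have dfin i (A : set (Rd R d)) : measurable A -> dmeasure lam' (fs i) A \is a fin_num.
  move=> mA; have [mf f0 f1] := hfs i.
  rewrite ge0_fin_numE // (@le_lt_trans _ _ 1%E) ?ltry // -f1.
  by rewrite -(dmeasureE lam' mf f0); apply: le_measure; rewrite ?inE.
(* Independence is tested on all measurable sets; finitely many of them suffice. *)
have [N [S hS]] : exists N (S : 'I_N -> {A : set (Rd R d) | measurable A}),
    forall a : 'I_k -> R,
      (forall b, \sum_i a i * fine (dmeasure lam' (fs i) (sval (S b))) = 0) ->
    forall i, a i = 0.
  apply: (finite_separation
    (v := fun A i => fine (dmeasure lam' (fs i) (sval A)))) => a ha.
  apply: hlin => A mA; have /= h := congr1 EFin (ha (exist _ A mA)).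
  rewrite -sumEFin in h; rewrite -[RHS]h; apply: eq_bigr => i _.
  by rewrite EFinM fineK // dfin.
have mS c : measurable (sval (S c)) := proj2_sig (S c).
have [n hn] := fin_all_exists hUf.
have [g hg0] := fin_all_exists hn; have [eg hg] := fin_all_exists hg0.
pose J := {i : 'I_k & 'I_(n i)}.
have [M hM] : exists M : J -> R, forall j y, `|g (tag j) (tagged j) y| <= M j.
  have bnd (j : J) : exists M, forall y, `|g (tag j) (tagged j) y| <= M.
    by have [_ [/(_ (tagged j)) []]] := hg (tag j).
  by have [M hM] := fin_all_exists bnd; exists M.
pose M0 := 1 + \sum_j `|M j|.
have M00 : 0 < M0 by rewrite ltr_pwDl // sumr_ge0.
have gM0 i (j : 'I_(n i)) y : `|g i j y| <= M0.
  apply: (le_trans (hM (Tagged _ j) y)); apply: (le_trans (ler_norm _)).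
  rewrite /M0 (bigD1 (Tagged _ j : J)) //= addrCA lerDl addr_ge0 // sumr_ge0 //.
have mg i (j : 'I_(n i)) : @measurable_fun _ _ (Rd R d) R setT (g i j).
  by apply: continuous_measurable_Rd; have [_ [/(_ j) []]] := hg i.
have [eQ [eQ0 hQU]] := hUQ.
pose em := \big[Num.min/1]_i eg i.
have em0 : 0 < em by apply: lt_bigmin => [|i _]; rewrite ?ltr01 //; have [] := hg i.
(* Means of rescaled functions within [em / (2 * M0)] give integrals within [em], which is at most
   every [eg i]. *)
pose e := Num.min eQ (em / (2 * M0)).
have M2 : 0 < 2 * M0 by rewrite mulr_gt0.
have e0 : 0 < e by rewrite lt_min eQ0 divr_gt0.
(* The indicators separate the true emission laws, the rescaled functions describe the weak
   neighbourhoods, and the constant is the distinguished observable of the identifiability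
   argument. *)
pose G (b : option ('I_N + J)) : Rd R d -> R :=
  match b with
  | None => fun=> 1
  | Some (inl c) => \1_(sval (S c))
  | Some (inr j) => rescale M0 (g (tag j) (tagged j))
  end.
apply: (@posterior_consistency _ _ _ _ lam' hk _ _ pi Qt ft mu0 hmu0 hQt hft
  mQt mft Qs fs mus q hq hDq hmus uQs hfs _ _ P X Y mX mY hlaw suppE hev
  _ G None e) => //.
- move=> [[c|j]|] /=.
  + split; first by apply/measurable_indicP; exact: mS.
    by move=> z; rewrite indicE; case: (_ \in _); rewrite ?lexx ?ler01.
  + exact: unit_fun_rescale.
  + by split=> [|z]; [exact: measurable_cst | rewrite ler01 lexx].
- move=> a ha; apply: hS => c.
  rewrite -[RHS](ha (Some (inl c))); apply: eq_bigr => j _ /=.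
  by rewrite omean_indic //; exact: mS.
- move=> t s _ hQ hG; exists s; split.
    apply: hQU; apply/mx_norm_ltP => // i j; rewrite !mxE.
    by apply: (lt_le_trans (hQ i j)); rewrite /e ge_min lexx.
  move=> i; have [_ [_]] := hg i; apply.
    by have [mf f0 f1] := hfof t.2 (s i); rewrite dmeasureE.
  move=> j; rewrite !(integral_dmeasure_rescale _ _ M00 (mg i j) (gM0 i j)) //.
  rewrite -EFinB abse_EFin lte_fin.
  have := hG (Some (inr (Tagged _ j))) i => /= hh.
  rewrite opprB addrA subrK -mulrBr normrM gtr0_norm // mulrC.
  rewrite -ltr_pdivlMr //; apply: (lt_le_trans hh).
  rewrite /e ge_min; apply/orP; right; rewrite ler_pM2r ?invr_gt0 //.
  exact: bigmin_le.
Qed.
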